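(* Let $m$ be a positive integer, let $K\subseteq\mathbb{R}$ be compact with finitely many isolated points, and let $\gamma:K\to\mathbb{H}$. Suppose there exist a modulus of continuity $\omega$ and a constant $M>0$ such that for every $X\subseteq K$ with $\#X=m+2$ there is a curve $\Gamma_X\in C^{m,\omega}(\mathbb{R},\mathbb{R}^3)$ with $\Gamma_X=\gamma$ on $X$, such that $\sup_X\|\Gamma_X\|<\infty$ (supremum over all such $X$) and $$\left|\frac{A(\Gamma_X;a,b)}{V(\Gamma_X;a,b)}\right|\le M\,\omega(b-a)\quad\text{for all } a,b\in K \text{ with } a<b.$$ Then there is a horizontal curve $\Gamma\in C^{m,\sqrt{\omega}}(\mathbb{R},\mathbb{R}^3)$ with $\Gamma|_K=\gamma$.
   Context: The Heisenberg group $\mathbb{H}$ is $\mathbb{R}^3$ with group law $(x,y,z)*(x',y',z') = (x+x',\,y+y',\,z+z'+2(yx'-xy'))$. An absolutely continuous curve $\Gamma=(f,g,h):\mathbb{R}\to\mathbb{R}^3$ is horizontal if $h'=2(f'g-fg')$ a.e. A modulus of continuity is a continuous, increasing, concave function $\omega:[0,\infty)\to[0,\infty)$ with $\omega(0)=0$. $C^{m,\omega}(\mathbb{R})$ is the space of $m$-times continuously differentiable $\phi:\mathbb{R}\to\mathbb{R}$ with finite seminorm $\|\phi\|=\sup_{a\neq b}|\phi^{(m)}(b)-\phi^{(m)}(a)|/\omega(|b-a|)$; $C^{m,\omega}(\mathbb{R},\mathbb{R}^3)$ consists of curves with all three components in $C^{m,\omega}(\mathbb{R})$, and $\|\Gamma\|$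 denotes the sum of the seminorms of its components. For $\Gamma=(f,g,h)$ of class $C^m$ and $a\in\mathbb{R}$ let $T_af(x)=\sum_{k=0}^m\frac{f^{(k)}(a)}{k!}(x-a)^k$ (similarly $T_ag$), and for $a,b\in\mathbb{R}$: $A(\Gamma;a,b)= h(b)-h(a)-2\int_a^b\big((T_af)'T_ag-(T_ag)'T_af\big) + 2f(a)(g(b)-T_ag(b)) - 2g(a)(f(b)-T_af(b))$, $V(\Gamma;a,b)=(b-a)^{2m}+(b-a)^m\int_a^b(|(T_af)'|+|(T_ag)'|)$. *)

(* Defs.v *)
From Stdlib Require Import Reals Lra List Rtopology Factorial.
From Coquelicot Require Import Coquelicot.
Open Scope R_scope.

(* A curve R -> R^3 (identified with the Heisenberg group H = R^3). *)
Definition curve := R -> R * R * R.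
Definition cf (G : curve) : R -> R := fun x => fst (fst (G x)).
Definition cg (G : curve) : R -> R := fun x => snd (fst (G x)).
Definition ch (G : curve) : R -> R := fun x => snd (G x).

Definition modulus_of_continuity (w : R -> R) : Prop :=
  w 0 = 0 /\
  (forall t, 0 <= t -> 0 <= w t) /\
  (forall x, 0 <= x -> forall eps, 0 < eps -> exists delta, 0 < delta /\
      forall y, 0 <= y -> Rabs (y - x) < delta -> Rabs (w y - w x) < eps) /\
  (forall s t, 0 <= s -> s < t -> w s < w t) /\
  (forall s t l, 0 <= s -> 0 <= t -> 0 <= l <= 1 ->
      l * w s + (1 - l) * w t <= w (l * s + (1 - l) * t)).

Definition Cm (m : nat) (phi : R -> R) : Prop :=
  (forall k, (k <= m)%nat -> forall x, ex_derive_n phi k x) /\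
  (forall x, continuous (Derive_n phi m) x).

Definition holder_quotients (m : nat) (w : R -> R) (phi : R -> R) (r : R) : Prop :=
  exists a b, a <> b /\
    r = Rabs (Derive_n phi m b - Derive_n phi m a) / w (Rabs (b - a)).

Definition holder_sup (m : nat) (w : R -> R) (phi : R -> R) : Rbar :=
  Lub_Rbar (holder_quotients m w phi).

Definition holder_seminorm (m : nat) (w : R -> R) (phi : R -> R) : R :=
  real (holder_sup m w phi).

Definition Cmw (m : nat) (w : R -> R) (phi : R -> R) : Prop :=
  Cm m phi /\ is_finite (holder_sup m w phi).

Definition Cmw_curve (m : nat) (w : R -> R) (G : curve) : Prop :=
  Cmw m w (cf G) /\ Cmw m w (cg G) /\ Cmw m w (ch G).

Definition curve_seminorm (m : nat) (w : R -> R) (G : curve) : R :=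
  holder_seminorm m w (cf G) + holder_seminorm m w (cg G)
  + holder_seminorm m w (ch G).

Definition taylor (m : nat) (phi : R -> R) (a : R) : R -> R :=
  fun x => sum_f_R0 (fun k => Derive_n phi k a / INR (Factorial.fact k) * (x - a) ^ k) m.

Definition A_fun (m : nat) (G : curve) (a b : R) : R :=
  let f := cf G in let g := cg G in let h := ch G in
  let Tf := taylor m f a in let Tg := taylor m g a in
  h b - h a
  - 2 * RInt (fun x => Derive Tf x * Tg x - Derive Tg x * Tf x) a b
  + 2 * f a * (g b - Tg b) - 2 * g a * (f b - Tf b).

Definition V_fun (m : nat) (G : curve) (a b : R) : R :=
  let Tf := taylor m (cf G) a in let Tg := taylor m (cg G) a in
  (b - a) ^ (2 * m)
  + (b - a) ^ m * RInt (fun x => Rabs (Derive Tf x) + Rabs (Derive Tg x)) a b.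

Definition null_set (N : R -> Prop) : Prop :=
  forall eps, 0 < eps -> exists u v : nat -> R,
    (forall n, u n <= v n) /\
    (forall x, N x -> exists n, u n <= x <= v n) /\
    (forall n, sum_f_R0 (fun k => v k - u k) n < eps).

Fixpoint nonoverlap (lo : R) (l : list (R * R)) (b : R) : Prop :=
  match l with
  | nil => True
  | (x, y) :: l' => lo <= x /\ x <= y /\ y <= b /\ nonoverlap y l' b
  end.

Definition len_sum (l : list (R * R)) : R :=
  fold_right (fun p s => snd p - fst p + s) 0 l.

Definition var_sum (f : R -> R) (l : list (R * R)) : R :=
  fold_right (fun p s => Rabs (f (snd p) - f (fst p)) + s) 0 l.

Definition abs_continuous (f : R -> R) : Prop :=
  forall a b, a <= b -> forall eps, 0 < eps -> exists delta, 0 < delta /\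
    forall l, nonoverlap a l b -> len_sum l < delta -> var_sum f l < eps.

Definition horizontal (G : curve) : Prop :=
  abs_continuous (cf G) /\ abs_continuous (cg G) /\ abs_continuous (ch G) /\
  exists N, null_set N /\ forall x, ~ N x ->
    ex_derive (cf G) x /\ ex_derive (cg G) x /\ ex_derive (ch G) x /\
    Derive (ch G) x = 2 * (Derive (cf G) x * cg G x - cf G x * Derive (cg G) x).

Definition isolated_point (K : R -> Prop) (x : R) : Prop :=
  K x /\ exists eps, 0 < eps /\ forall y, K y -> Rabs (y - x) < eps -> y = x.

Definition finitely_many_isolated (K : R -> Prop) : Prop :=
  exists l : list R, forall x, isolated_point K x -> In x l.

Definition has_card (X : R -> Prop) (n : nat) : Prop :=
  exists l : list R, NoDup l /\ length l = n /\ forall x, X x <-> In x l.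

(* Main.v *)
Require Import Defs.
From Stdlib Require Import Reals List Rtopology.
From Stdlib Require Import Lra Lia Factorial Classical ClassicalEpsilon Permutation.
From Coquelicot Require Import Coquelicot.
Open Scope R_scope.

(** On the set [K'] of non-isolated points of [K], clusters of [m + 1] points determine
    the [m]-jets of the first two components: two interpolants sharing [m + 1] points are close
    by Rolle's theorem, and one passes between clusters by exchanging points one at a time.
    These jets satisfy Whitney's condition, also after adding the finitely many isolated points
    with arbitrary jets, so they extend to [f, g] of class [C^{m,w}].  The bound on [A / V]
    says that the lift of [(f, g)] misses the prescribed third coordinate over a gap of length [L]
    by at most [C w(L) L^m (L^m + L sup|f'| + L sup|g'|)].  Such a defect is corrected inside
    the gap by a perturbation of size [sqrt(w(L)) L^m]: by testing [f'] or [g'] against a bump if one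
    of them is large (a change linear in the perturbation), and by the area of a small loop,
    quadratic in the perturbation, otherwise; this is where the square root comes from.  After
    the correction, the third coordinate minus the lift is constant across gaps and has
    derivative zero along [K'], hence vanishes. *)

(** * Calculus on the line *)

(** The bound on [A / V] is stated with the Taylor polynomials of the interpolant itself. To use it
    between two points [a] and [b] of [K'] one needs a curve that passes through both and whose jet
    at [a] is almost the limit jet. This is what [m + 2] nodes permit: [b], [a] and [m] points close
    to [a]. Such a curve shares [m + 1] nodes with an interpolant on a cluster at [a], so its jet at
    [a] is controlled. How close the nodes must be depends on [b - a], so every pair gets its own
    interpolant.

    Isolated points cost only constants: they stay at a positive distance from the rest, where
    [w(L)] and all powers of [L] are bounded below, so any mismatch there satisfies the required
    estimates.

    All data are extended by zero beyond an interval [[p, q]] around [K]. Every complementary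
    interval is then a bounded gap with both ends in the set, and all functions involved are
    bounded. Boundedness matters twice: it makes the smoothness class stable under the products in
    the horizontality equation, and it lets a [w]-estimate imply a [sqrt w]-estimate at large
    distances. *)

Lemma is_derive_eps (f : R -> R) (x l : R) :
  (forall eps, 0 < eps -> exists delta, 0 < delta /\ forall y, Rabs (y - x) < delta ->
     Rabs (f y - f x - l * (y - x)) <= eps * Rabs (y - x)) -> is_derive f x l.
Proof.
  intros H; split; [apply is_linear_scal_l |].
  intros z Hz.
  assert (E : x = z) by exact (is_filter_lim_locally_unique (K := R_AbsRing) (V := R_NormedModule) x z Hz); subst z.
  intros eps; destruct (H eps (cond_pos eps)) as [d [Hd Hy]].
  exists (mkposreal d Hd); intros y Hb.
  unfold norm, minus, plus, opp, scal; simpl; unfold abs, mult; simpl.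
  replace (f y + - f x + - ((y + - x) * l)) with (f y - f x - l * (y - x)) by ring.
  apply Hy, Hb.
Qed.

Lemma is_derive_eps_inv (f : R -> R) (x l : R) :
  is_derive f x l ->
  forall eps, 0 < eps -> exists delta, 0 < delta /\ forall y, Rabs (y - x) < delta ->
     Rabs (f y - f x - l * (y - x)) <= eps * Rabs (y - x).
Proof.
  intros [_ H] eps Heps.
  destruct (H x (fun P h => h) (mkposreal eps Heps)) as [d Hd].
  exists d; split; [apply cond_pos |]; intros y Hy.
  specialize (Hd y Hy).
  unfold norm, minus, plus, opp, scal in Hd; simpl in Hd; unfold abs, mult in Hd; simpl in Hd.
  replace (f y - f x - l * (y - x)) with (f y + - f x + - ((y + - x) * l)) by ring.
  exact Hd.
Qed.

Lemma is_derive_continuous (f : R -> R) (x l : R) : is_derive f x l -> continuous f x.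
Proof. intros H; apply (ex_derive_continuous (V := R_NormedModule)); now exists l. Qed.

Lemma is_derive_continuity_pt (f : R -> R) (x l : R) : is_derive f x l -> continuity_pt f x.
Proof. intros H; apply continuity_pt_filterlim; now apply (is_derive_continuous f x l). Qed.

Lemma is_derive_ext_val (f : R -> R) (x l l' : R) : l = l' -> is_derive f x l -> is_derive f x l'.
Proof. intros ->; trivial. Qed.

Lemma continuous_mult_R (f g : R -> R) (x : R) :
  continuous f x -> continuous g x -> continuous (fun y => f y * g y) x.
Proof. intros; now apply (continuous_mult (K := R_AbsRing)). Qed.

Lemma continuous_minus_R (f g : R -> R) (x : R) :
  continuous f x -> continuous g x -> continuous (fun y => f y - g y) x.
Proof. intros; now apply (continuous_minus (K := R_AbsRing) (V := R_NormedModule)). Qed.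

Lemma continuous_plus_R (f g : R -> R) (x : R) :
  continuous f x -> continuous g x -> continuous (fun y => f y + g y) x.
Proof. intros; now apply (continuous_plus (K := R_AbsRing) (V := R_NormedModule)). Qed.

Lemma is_derive_minus_R (f g : R -> R) (x df dg : R) :
  is_derive f x df -> is_derive g x dg -> is_derive (fun y => f y - g y) x (df - dg).
Proof. intros; now apply (is_derive_minus (K := R_AbsRing) (V := R_NormedModule)). Qed.

Lemma is_derive_plus_R (f g : R -> R) (x df dg : R) :
  is_derive f x df -> is_derive g x dg -> is_derive (fun y => f y + g y) x (df + dg).
Proof. intros; now apply (is_derive_plus (K := R_AbsRing) (V := R_NormedModule)). Qed.

Lemma continuous_scal_R (c : R) (f : R -> R) (x : R) :
  continuous f x -> continuous (fun y => c * f y) x.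
Proof. intros; now apply (continuous_scal_r (K := R_AbsRing) (V := R_NormedModule)). Qed.

Lemma mvt_point (f g : R -> R) (x y : R) :
  (forall z, is_derive f z (g z)) ->
  exists z, Rmin x y <= z <= Rmax x y /\ f y - f x = g z * (y - x).
Proof.
  intros H; apply MVT_gen; intros z Hz; [apply H |].
  apply (is_derive_continuity_pt f z (g z)), H.
Qed.

Lemma mvt_abs (f g : R -> R) (p q B x y : R) :
  (forall z, is_derive f z (g z)) ->
  (forall z, p <= z <= q -> Rabs (g z) <= B) ->
  p <= x <= q -> p <= y <= q -> Rabs (f y - f x) <= B * Rabs (y - x).
Proof.
  intros H Hg Hx Hy; destruct (mvt_point f g x y H) as [z [Hz ->]].
  rewrite Rabs_mult; apply Rmult_le_compat_r; [apply Rabs_pos | apply Hg].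
  revert Hz; unfold Rmin, Rmax; destruct (Rle_dec x y); lra.
Qed.

Lemma rolle (f g : R -> R) (x y : R) :
  (forall z, is_derive f z (g z)) -> x < y -> f x = f y -> exists z, x < z < y /\ g z = 0.
Proof.
  intros H Hxy Heq.
  assert (pr : forall z, x < z < y -> derivable_pt f z).
  { intros z _; exists (g z); apply is_derive_Reals, H. }
  destruct (Rolle f x y pr) as [c [Hc Hz]]; try assumption.
  - intros z _; apply (is_derive_continuity_pt f z (g z)), H.
  - exists c; split; [exact Hc |].
    rewrite <- Hz; symmetry; apply derive_pt_eq_0, is_derive_Reals, H.
Qed.

Lemma const_interval (f : R -> R) (p q x y : R) :
  (forall z, p <= z <= q -> is_derive f z 0) ->
  p <= x <= q -> p <= y <= q -> f x = f y.
Proof.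
  intros H Hx Hy.
  destruct (Rtotal_order x y) as [h | [h | h]]; [| now subst |].
  - apply (eq_is_derive f x y); [| exact h]; intros t Ht; apply H; lra.
  - symmetry; apply (eq_is_derive f y x); [| exact h]; intros t Ht; apply H; lra.
Qed.

Lemma continuous_ex_RInt (f : R -> R) (a b : R) : (forall x, continuous f x) -> ex_RInt f a b.
Proof. intros H; apply (ex_RInt_continuous (V := R_CompleteNormedModule)); intros; apply H. Qed.

Lemma is_derive_prim (f : R -> R) (a x : R) :
  (forall x, continuous f x) -> is_derive (fun y => RInt f a y) x (f x).
Proof.
  intros H; apply (is_derive_RInt f (fun y => RInt f a y) a x); [| apply H].
  apply filter_forall; intros b.
  apply (RInt_correct (V := R_CompleteNormedModule)); now apply continuous_ex_RInt.
Qed.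

Lemma RInt_deriv (f g : R -> R) (a b : R) :
  (forall x, is_derive f x (g x)) -> (forall x, continuous g x) -> RInt g a b = f b - f a.
Proof.
  intros H Hc.
  assert (E : forall x, is_derive (fun y => RInt g a y - f y) x 0).
  { intros x; replace 0 with (g x - g x) by ring.
    apply is_derive_minus_R; [now apply is_derive_prim | apply H]. }
  pose proof (const_interval _ (Rmin a b) (Rmax a b) a b (fun z _ => E z)) as E2.
  simpl in E2; rewrite RInt_point in E2; unfold zero in E2; simpl in E2.
  pose proof (Rmin_l a b); pose proof (Rmin_r a b); pose proof (Rmax_l a b); pose proof (Rmax_r a b).
  assert (0 - f a = RInt g a b - f b) by (apply E2; lra); lra.
Qed.

Lemma continuous_bounded (f : R -> R) (p q : R) :
  p <= q -> (forall x, continuous f x) -> exists B, 0 <= B /\ forall x, p <= x <= q -> Rabs (f x) <= B.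
Proof.
  intros Hpq H.
  destruct (continuity_ab_maj (fun x => Rabs (f x)) p q Hpq) as [Mx [HM _]].
  - intros c _; apply (continuity_pt_comp f Rabs).
    + apply continuity_pt_filterlim, H.
    + apply Rcontinuity_abs.
  - exists (Rabs (f Mx)); split; [apply Rabs_pos | exact HM].
Qed.

Lemma continuous_eps (f : R -> R) (x : R) :
  (forall eps, 0 < eps -> exists delta, 0 < delta /\ forall y, Rabs (y - x) < delta ->
     Rabs (f y - f x) < eps) <-> continuous f x.
Proof.
  split.
  - intros H; apply filterlim_locally; intros eps.
    destruct (H eps (cond_pos eps)) as [d [Hd Hy]].
    exists (mkposreal d Hd); intros y Hb; apply Hy, Hb.
  - intros H eps Heps.
    apply (proj1 (filterlim_locally f (f x))) with (eps := mkposreal eps Heps) in H.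
    destruct H as [d Hd]; exists d; split; [apply cond_pos | intros y Hy; apply Hd, Hy].
Qed.

Lemma pow_le_one (x : R) (n : nat) : 0 <= x <= 1 -> x ^ n <= 1.
Proof. intros H; rewrite <- (pow1 n); now apply pow_incr. Qed.

(** * Towers of derivatives *)

(** Derivatives are carried as data instead of through [Derive_n]: towers can then be shifted,
    added, rescaled and glued piecewise. [Derive_n] returns only where the given curves and the
    final curve meet the definitions of the statement. *)
Definition chain (n : nat) (F : nat -> R -> R) : Prop :=
  forall k, (k < n)%nat -> forall x, is_derive (F k) x (F (S k) x).

Lemma chain_shift (n : nat) (F : nat -> R -> R) :
  chain (S n) F -> chain n (fun k => F (S k)).
Proof. intros H k Hk x; apply H; lia. Qed.

Lemma chain_le (n n' : nat) (F : nat -> R -> R) : (n' <= n)%nat -> chain n F -> chain n' F.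
Proof. intros Hn H k Hk; apply H; lia. Qed.

Lemma chain_minus (n : nat) (F G : nat -> R -> R) :
  chain n F -> chain n G -> chain n (fun k x => F k x - G k x).
Proof.
  intros HF HG k Hk x.
  apply is_derive_minus_R; [now apply HF | now apply HG].
Qed.

Lemma chain_plus (n : nat) (F G : nat -> R -> R) :
  chain n F -> chain n G -> chain n (fun k x => F k x + G k x).
Proof.
  intros HF HG k Hk x.
  apply is_derive_plus_R; [now apply HF | now apply HG].
Qed.

Lemma is_derive_mult_R (f g : R -> R) (x df dg : R) :
  is_derive f x df -> is_derive g x dg -> is_derive (fun y => f y * g y) x (df * g x + f x * dg).
Proof.
  intros Hf Hg; exact (is_derive_mult (K := R_AbsRing) f g x df dg Hf Hg Rmult_comm).
Qed.

Lemma is_derive_scal_R (f : R -> R) (c x df : R) :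
  is_derive f x df -> is_derive (fun y => c * f y) x (c * df).
Proof. intros Hf; exact (is_derive_scal f x c df Hf). Qed.

Lemma is_derive_affine (f : R -> R) (s a c x df : R) :
  is_derive f (s * (x - a) - c) df -> is_derive (fun y => f (s * (y - a) - c)) x (s * df).
Proof.
  intros H; apply (is_derive_comp (V := R_NormedModule) f (fun y => s * (y - a) - c) x df s H).
  auto_derive; [exact I | ring].
Qed.

Lemma chain_scale (n : nat) (F : nat -> R -> R) (A s a c : R) :
  chain n F -> chain n (fun k x => A * s ^ k * F k (s * (x - a) - c)).
Proof.
  intros H k Hk x; simpl.
  replace (A * (s * s ^ k) * F (S k) (s * (x - a) - c))
    with (A * s ^ k * (s * F (S k) (s * (x - a) - c))) by ring.
  apply is_derive_scal_R, is_derive_affine, H, Hk.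
Qed.

(* Integrating down from order [n]; the points [z] may depend on the order, which covers
   both Taylor expansion at a point and Rolle-type arguments. *)
Lemma chain_bound (n : nat) (F : nat -> R -> R) (p q W : R) :
  chain n F -> 0 <= W -> p <= q ->
  (forall k, (k < n)%nat -> exists z, p <= z <= q /\ Rabs (F k z) <= W * (q - p) ^ (n - k)) ->
  (forall x, p <= x <= q -> Rabs (F n x) <= W) ->
  forall k, (k <= n)%nat -> forall x, p <= x <= q ->
    Rabs (F k x) <= (INR n + 1) * W * (q - p) ^ (n - k).
Proof.
  intros HF HW Hpq Hz Hn.
  (* [j] counts the orders below the top. A step down adds the value at the point [z] to an
     increment from the mean value theorem; the former contributes one more multiple of [W], hence
     [INR j + 1]. *)
  assert (Key : forall j, (j <= n)%nat -> forall x, p <= x <= q ->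
    Rabs (F (n - j)%nat x) <= (INR j + 1) * W * (q - p) ^ j).
  { induction j as [| j IH]; intros Hj x Hx.
    - rewrite Nat.sub_0_r; simpl; specialize (Hn x Hx); lra.
    - destruct (Hz (n - S j)%nat ltac:(lia)) as [z [Hzpq Hzb]].
      replace (n - (n - S j))%nat with (S j) in Hzb by lia.
      assert (Hm : Rabs (F (n - S j)%nat x - F (n - S j)%nat z)
                   <= (INR j + 1) * W * (q - p) ^ j * Rabs (x - z)).
      { apply (mvt_abs _ (F (n - j)%nat) p q); try assumption.
        - intros y; replace (n - j)%nat with (S (n - S j)) by lia; apply HF; lia.
        - intros y Hy; apply IH; [lia | exact Hy]. }
      assert (Hxz : Rabs (x - z) <= q - p) by (apply Rabs_le; lra).
      assert (Hpos : 0 <= (INR j + 1) * W * (q - p) ^ j).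
      { apply Rmult_le_pos; [apply Rmult_le_pos; [pose proof (pos_INR j); lra | lra] |].
        apply pow_le; lra. }
      pose proof (Rmult_le_compat_l _ _ _ Hpos Hxz) as H1.
      replace (F (n - S j)%nat x) with (F (n - S j)%nat z + (F (n - S j)%nat x - F (n - S j)%nat z)) by ring.
      eapply Rle_trans; [apply Rabs_triang |].
      rewrite S_INR; simpl in *; lra. }
  intros k Hk x Hx.
  specialize (Key (n - k)%nat ltac:(lia) x Hx).
  replace (n - (n - k))%nat with k in Key by lia.
  eapply Rle_trans; [exact Key |].
  apply Rmult_le_compat_r; [apply pow_le; lra |].
  apply Rmult_le_compat_r; [exact HW |].
  apply Rplus_le_compat_r, le_INR; lia.
Qed.

(** * Rolle's theorem for several zeros *)

Fixpoint inc (x : R) (l : list R) : Prop :=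
  match l with nil => True | y :: t => x < y /\ inc y t end.

Lemma inc_weaken (x y : R) (l : list R) : x <= y -> inc y l -> inc x l.
Proof. destruct l; simpl; [trivial | intros h [h1 h2]; split; [lra | exact h2]]. Qed.

Lemma inc_insert (x z : R) (l : list R) :
  inc x l -> x < z -> ~ In z l -> exists l', inc x l' /\ Permutation (z :: l) l'.
Proof.
  revert x; induction l as [| y t IH]; intros x Hi Hxz Hn; simpl in *.
  - exists (z :: nil); split; [split; [exact Hxz | exact I] | reflexivity].
  - destruct Hi as [Hxy Hi].
    destruct (Rtotal_order z y) as [h | [h | h]].
    + exists (z :: y :: t); repeat split; auto.
    + exfalso; apply Hn; left; auto.
    + destruct (IH y Hi h) as [l' [H1 H2]]; [tauto |].
      exists (y :: l'); split; [split; assumption |].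
      rewrite perm_swap; now constructor.
Qed.

Lemma inc_sort (x : R) (l : list R) :
  NoDup l -> (forall y, In y l -> x < y) -> exists l', inc x l' /\ Permutation l l'.
Proof.
  induction 1 as [| z l Hn Hd IH]; intros H.
  - exists nil; split; [exact I | reflexivity].
  - destruct IH as [l' [H1 H2]]; [intros; apply H; now right |].
    destruct (inc_insert x z l' H1) as [l'' [H3 H4]]; [apply H; now left | |].
    + intros Hin; apply Hn; apply Permutation_in with l'; [now symmetry | exact Hin].
    + exists l''; split; [exact H3 |]; rewrite H2; exact H4.
Qed.

(** One zero of [g] is taken between each pair of neighbours. They come out sorted, which is what
    allows iteration; together with [x] there is one zero more of [f] than of [g]. *)
Lemma rolle_list (f g : R -> R) (p q : R) (l : list R) :
  (forall z, is_derive f z (g z)) ->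
  forall x, inc x l -> p <= x -> f x = 0 -> (forall y, In y l -> f y = 0 /\ y <= q) ->
  exists l', length l' = length l /\ inc x l' /\ forall y, In y l' -> g y = 0 /\ p <= y <= q.
Proof.
  intros Hd; induction l as [| y t IH]; intros x Hi Hp Hx Hl.
  - exists nil; simpl; tauto.
  - simpl in Hi; destruct Hi as [Hxy Hi].
    destruct (IH y Hi) as [l'' [H1 [H2 H3]]]; [lra | apply Hl; now left | intros; apply Hl; now right |].
    destruct (rolle f g x y Hd Hxy) as [z [Hz Hgz]].
    { rewrite Hx; symmetry; apply Hl; now left. }
    exists (z :: l''); repeat split.
    + simpl; now rewrite H1.
    + simpl; lra.
    + apply inc_weaken with y; [lra | exact H2].
    + destruct H as [<- | H]; [exact Hgz | now apply H3].
    + destruct H as [<- | H]; [lra | now apply H3].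
    + assert (y <= q) by (apply Hl; now left).
      destruct H as [<- | H]; [lra | now apply H3].
Qed.

Lemma rolle_chain (n : nat) : forall (F : nat -> R -> R) (p q x : R) (l : list R),
  chain n F -> inc x l -> p <= x <= q -> F 0%nat x = 0 -> length l = n ->
  (forall y, In y l -> F 0%nat y = 0 /\ y <= q) ->
  forall k, (k <= n)%nat -> exists z, p <= z <= q /\ F k z = 0.
Proof.
  induction n as [| n IH]; intros F p q x l HF Hi Hx Hx0 Hlen Hl k Hk.
  - replace k with 0%nat by lia; exists x; split; [exact Hx | exact Hx0].
  - destruct k as [| k]; [exists x; split; assumption |].
    destruct (rolle_list (F 0%nat) (F 1%nat) p q l) with (x := x) as [l' [H1 [H2 H3]]];
      try assumption; try lra.
    { intros z; apply HF; lia. }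
    destruct l' as [| y t]; [simpl in H1; lia |].
    simpl in H2.
    apply (IH (fun k => F (S k)) p q y t); try (simpl in H1; lia).
    + now apply chain_shift.
    + tauto.
    + apply H3; now left.
    + apply H3; now left.
    + intros z Hz; split; apply H3; now right.
Qed.

Lemma rolle_zeros (n : nat) (F : nat -> R -> R) (p q : R) (l : list R) :
  chain n F -> NoDup l -> length l = S n ->
  (forall y, In y l -> F 0%nat y = 0 /\ p <= y <= q) ->
  forall k, (k <= n)%nat -> exists z, p <= z <= q /\ F k z = 0.
Proof.
  intros HF Hd Hlen Hl.
  (* [inc] wants a strict lower bound, and the zeros may include [p]. *)
  destruct (inc_sort (p - 1) l Hd) as [l' [H1 H2]].
  { intros y Hy; apply Hl in Hy; lra. }
  rewrite (Permutation_length H2) in Hlen.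
  assert (Hl' : forall y, In y l' -> F 0%nat y = 0 /\ p <= y <= q).
  { intros y Hy; apply Hl, Permutation_in with l'; [now symmetry | exact Hy]. }
  destruct l' as [| x t]; [discriminate |].
  simpl in H1; apply (rolle_chain n F p q x t); try tauto.
  - apply Hl'; now left.
  - apply Hl'; now left.
  - simpl in Hlen; lia.
  - intros y Hy; split; apply Hl'; now right.
Qed.

(** * Truncated Taylor polynomials *)

(** With the factorials in the denominators, [c] is the jet at 0 and differentiation is the shift of
    [c]. *)
Definition pol (n : nat) (c : nat -> R) (y : R) : R :=
  sum_f_R0 (fun i => c i / INR (fact i) * y ^ i) n.

Lemma pol_0 (n : nat) (c : nat -> R) : pol n c 0 = c 0%nat.
Proof.
  unfold pol; induction n as [| n IH]; simpl; [field | rewrite IH; ring].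
Qed.

Lemma pol_derive (n : nat) (c : nat -> R) (a x : R) :
  is_derive (fun x => pol (S n) c (x - a)) x (pol n (fun i => c (S i)) (x - a)).
Proof.
  induction n as [| n IH].
  - unfold pol; simpl; auto_derive; [exact I | field].
  - apply (is_derive_ext (fun x => pol (S n) c (x - a)
       + c (S (S n)) / INR (fact (S (S n))) * (x - a) ^ S (S n))); [reflexivity |].
    change (pol (S n) (fun i => c (S i)) (x - a)) with
      (plus (pol n (fun i => c (S i)) (x - a))
        (c (S (S n)) / INR (fact (S n)) * (x - a) ^ (S n))).
    apply is_derive_plus_R; [exact IH |].
    replace (c (S (S n)) / INR (fact (S n)) * (x - a) ^ S n)
      with (c (S (S n)) / INR (fact (S (S n))) * (INR (S (S n)) * 1 * (x - a) ^ Nat.pred (S (S n)))).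
    + apply is_derive_scal_R, (is_derive_pow (fun x => x - a) (S (S n)) x 1).
      auto_derive; [exact I | ring].
    + change (fact (S (S n))) with (S (S n) * fact (S n))%nat.
      rewrite mult_INR; simpl Nat.pred; field.
      split; [apply INR_fact_neq_0 | now apply not_0_INR].
Qed.

(** The [k]-th derivative, for [k <= n], of the Taylor polynomial with jet [c] at [a], written as
    the Taylor polynomial of the shifted jet. *)
Definition taylor_chain (n : nat) (c : nat -> R) (a : R) (k : nat) (x : R) : R :=
  pol (n - k) (fun i => c (k + i)%nat) (x - a).

Lemma pol_ext (n : nat) (c c' : nat -> R) (y : R) :
  (forall i, (i <= n)%nat -> c i = c' i) -> pol n c y = pol n c' y.
Proof. intros H; apply sum_eq; intros i Hi; now rewrite H. Qed.

Lemma taylor_chain_chain (n : nat) (c : nat -> R) (a : R) : chain n (taylor_chain n c a).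
Proof.
  intros k Hk x; unfold taylor_chain.
  replace (n - k)%nat with (S (n - S k)) by lia.
  replace (pol (n - S k) (fun i => c (S k + i)%nat) (x - a))
    with (pol (n - S k) (fun i => c (k + S i)%nat) (x - a)).
  - apply (pol_derive (n - S k) (fun i => c (k + i)%nat)).
  - apply pol_ext; intros; f_equal; lia.
Qed.

Lemma taylor_chain_at (n : nat) (c : nat -> R) (a : R) (k : nat) :
  taylor_chain n c a k a = c k.
Proof.
  unfold taylor_chain; replace (a - a) with 0 by ring; rewrite pol_0; f_equal; lia.
Qed.

Lemma taylor_chain_top (n : nat) (c : nat -> R) (a x : R) : taylor_chain n c a n x = c n.
Proof.
  unfold taylor_chain; rewrite Nat.sub_diag; unfold pol; simpl.
  rewrite Nat.add_0_r; field.
Qed.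

Lemma pol_pos (n : nat) (y : R) : 0 <= y -> 0 <= pol n (fun _ => 1) y.
Proof.
  intros Hy; apply cond_pos_sum; intros i.
  apply Rmult_le_pos; [apply Rlt_le, Rdiv_lt_0_compat; [lra | apply INR_fact_lt_0] | now apply pow_le].
Qed.

(** The factor on the right is the truncated exponential series. It is monotone in degree and
    argument ([pol_one_mono]), so one constant measures the effect of a jet error in all orders. *)
Lemma pol_bound (n : nat) (c : nat -> R) (e y : R) :
  (forall i, (i <= n)%nat -> Rabs (c i) <= e) -> Rabs (pol n c y) <= e * pol n (fun _ => 1) (Rabs y).
Proof.
  intros H; unfold pol; rewrite scal_sum.
  eapply Rle_trans; [apply Rsum_abs |].
  apply sum_Rle; intros i Hi.
  rewrite Rabs_mult, <- RPow_abs; unfold Rdiv; rewrite Rabs_mult, (Rabs_pos_eq (/ INR (fact i))).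
  2: apply Rlt_le, Rinv_0_lt_compat, INR_fact_lt_0.
  replace (1 * / INR (fact i) * Rabs y ^ i * e) with (e * / INR (fact i) * Rabs y ^ i) by ring.
  apply Rmult_le_compat_r; [apply pow_le, Rabs_pos |].
  apply Rmult_le_compat_r; [apply Rlt_le, Rinv_0_lt_compat, INR_fact_lt_0 | now apply H].
Qed.

Lemma pol_minus (n : nat) (c c' : nat -> R) (y : R) :
  pol n c y - pol n c' y = pol n (fun i => c i - c' i) y.
Proof.
  unfold pol; rewrite <- minus_sum; apply sum_eq; intros; unfold Rdiv; ring.
Qed.

Lemma pol_one_mono (n n' : nat) (y y' : R) :
  (n <= n')%nat -> 0 <= y <= y' -> pol n (fun _ => 1) y <= pol n' (fun _ => 1) y'.
Proof.
  intros Hn Hy; apply Rle_trans with (pol n (fun _ => 1) y').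
  - apply sum_Rle; intros i _; apply Rmult_le_compat_l.
    + apply Rlt_le, Rdiv_lt_0_compat; [lra | apply INR_fact_lt_0].
    + now apply pow_incr.
  - induction Hn as [| n' _ IH]; [lra |].
    eapply Rle_trans; [exact IH |].
    unfold pol; simpl; rewrite <- (Rplus_0_r (sum_f_R0 _ n')) at 1.
    apply Rplus_le_compat_l, Rmult_le_pos; [| apply Rmult_le_pos; [lra | apply pow_le; lra]].
    apply Rlt_le, Rdiv_lt_0_compat; [lra | ].
    apply (INR_fact_lt_0 (S n')).
Qed.

(** * Moduli of continuity *)

(** Concavity enters as the monotonicity of [w t / t], written without division. In this form the
    properties pass easily from [w] to its square root, so the same lemmas serve before and after
    the correction. *)
Record modulus (w : R -> R) : Prop := {
  mod_zero : w 0 = 0;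
  mod_pos : forall t, 0 < t -> 0 < w t;
  mod_mono : forall s t, 0 <= s -> s <= t -> w s <= w t;
  mod_ratio : forall s t, 0 <= s -> s <= t -> s * w t <= t * w s;
  mod_lim : forall eps, 0 < eps -> exists delta, 0 < delta /\ forall t, 0 <= t -> t < delta -> w t < eps }.

Lemma mod_nonneg (w : R -> R) (t : R) : modulus w -> 0 <= t -> 0 <= w t.
Proof.
  intros Hw [h | <-]; [apply Rlt_le, (mod_pos w Hw), h | rewrite (mod_zero w Hw); lra].
Qed.

Lemma mod_mul (w : R -> R) (c t : R) : modulus w -> 1 <= c -> 0 <= t -> w (c * t) <= c * w t.
Proof.
  intros Hw Hc [h | <-].
  - pose proof (mod_ratio w Hw t (c * t)) as H.
    apply Rmult_le_reg_l with t; [exact h |].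
    replace (t * (c * w t)) with (c * t * w t) by ring; apply H; nra.
  - rewrite Rmult_0_r, (mod_zero w Hw); lra.
Qed.

Lemma modulus_of_continuity_modulus (w : R -> R) : modulus_of_continuity w -> modulus w.
Proof.
  intros [H0 [H1 [H2 [H3 H4]]]]; split.
  - exact H0.
  - intros t Ht; rewrite <- H0; apply H3; lra.
  - intros s t Hs [h | <-]; [apply Rlt_le, H3; assumption | lra].
  - intros s t Hs Hst.
    destruct (Rle_lt_or_eq_dec 0 t ltac:(lra)) as [h | h].
    + assert (Hl : 0 <= s / t <= 1).
      { split; [apply Rdiv_le_0_compat; lra |].
        apply Rmult_le_reg_r with t; [exact h |].
        unfold Rdiv; rewrite Rmult_assoc, Rinv_l; lra. }
      (* Concavity on the chord from 0 to [t], at the parameter [s / t]. *)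
      pose proof (H4 t 0 (s / t) ltac:(lra) (Rle_refl 0) Hl) as H.
      rewrite H0 in H; replace (s / t * t + (1 - s / t) * 0) with s in H by (field; lra).
      apply Rmult_le_compat_l with (r := t) in H; [| lra].
      replace (t * (s / t * w t + (1 - s / t) * 0)) with (s * w t) in H by (field; lra).
      exact H.
    + replace s with 0 by lra; rewrite <- h, H0; lra.
  - intros eps Heps; destruct (H2 0 (Rle_refl 0) eps Heps) as [d [Hd Hy]].
    exists d; split; [exact Hd |]; intros t Ht Htd.
    specialize (Hy t Ht); rewrite H0 in Hy.
    rewrite !Rminus_0_r in Hy; rewrite (Rabs_pos_eq t Ht), (Rabs_pos_eq (w t) (H1 t Ht)) in Hy; apply Hy, Htd.
Qed.

Lemma modulus_sqrt (w : R -> R) : modulus w -> modulus (fun t => sqrt (w t)).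
Proof.
  intros Hw; split.
  - rewrite (mod_zero w Hw); apply sqrt_0.
  - intros t Ht; apply sqrt_lt_R0, (mod_pos w Hw), Ht.
  - intros s t Hs Hst; apply sqrt_le_1_alt, (mod_mono w Hw); assumption.
  - intros s t Hs Hst.
    (* With [s] and [t] moved under the roots, the claim is the product of [s <= t] and
       [s * w t <= t * w s]. *)
    rewrite <- (sqrt_pow2 s Hs) at 1; rewrite <- (sqrt_pow2 t) at 2 by lra.
    rewrite <- !sqrt_mult_alt by (apply pow2_ge_0).
    apply sqrt_le_1_alt.
    pose proof (mod_ratio w Hw s t Hs Hst).
    pose proof (mod_nonneg w s Hw Hs); pose proof (mod_nonneg w t Hw ltac:(lra)).
    replace (s ^ 2 * w t) with (s * (s * w t)) by ring; replace (t ^ 2 * w s) with (t * (t * w s)) by ring.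
    apply Rmult_le_compat; [lra | apply Rmult_le_pos; lra | lra | lra].
  - intros eps Heps; destruct (mod_lim w Hw (eps * eps)) as [d [Hd H]]; [nra |].
    exists d; split; [exact Hd |]; intros t Ht Htd.
    rewrite <- (sqrt_square eps) by lra; apply sqrt_lt_1_alt; split; [now apply mod_nonneg | now apply H].
Qed.

Lemma holder_continuous (w : R -> R) (C : R) (F : R -> R) :
  modulus w -> 0 <= C -> (forall x y, Rabs (F x - F y) <= C * w (Rabs (x - y))) ->
  forall x, continuous F x.
Proof.
  intros Hw HC HF x; apply continuous_eps; intros eps Heps.
  destruct (mod_lim w Hw (eps / (C + 1))) as [d [Hd Hy]]; [apply Rdiv_lt_0_compat; lra |].
  exists d; split; [exact Hd |]; intros y Hyx.
  eapply Rle_lt_trans; [apply HF |].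
  specialize (Hy _ (Rabs_pos (y - x)) Hyx).
  apply Rmult_lt_compat_r with (r := C + 1) in Hy; [| lra].
  replace (eps / (C + 1) * (C + 1)) with eps in Hy by (field; lra).
  pose proof (mod_nonneg w _ Hw (Rabs_pos (y - x))); lra.
Qed.

Lemma chain_continuous (m : nat) (w : R -> R) (C : R) (F : nat -> R -> R) :
  modulus w -> 0 <= C -> chain m F -> (forall x y, Rabs (F m x - F m y) <= C * w (Rabs (x - y))) ->
  forall k, (k <= m)%nat -> forall x, continuous (F k) x.
Proof.
  intros Hw HC Hch HF k Hk x.
  destruct (Nat.eq_dec k m) as [-> | ne]; [now apply (holder_continuous w C) |].
  apply (is_derive_continuous _ x (F (S k) x)), Hch; lia.
Qed.

Lemma taylor_chain_continuous (n : nat) (c : nat -> R) (a : R) (k : nat) (x : R) :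
  continuous (taylor_chain n c a k) x.
Proof.
  unfold taylor_chain; destruct (n - k)%nat as [| j].
  - apply continuous_const.
  - eapply is_derive_continuous; apply pol_derive.
Qed.

(** * Closed sets of the line and their gaps *)

Definition gap (S : R -> Prop) (a b : R) : Prop :=
  S a /\ S b /\ a < b /\ forall y, a < y < b -> ~ S y.

Lemma closed_nbhd (S : R -> Prop) (x : R) :
  closed_set S -> ~ S x -> exists delta, 0 < delta /\ forall y, Rabs (y - x) < delta -> ~ S y.
Proof.
  intros H Hx; destruct (H x Hx) as [d Hd].
  exists d; split; [apply cond_pos | intros y Hy; apply Hd, Hy].
Qed.

Lemma closed_of_nbhd (S : R -> Prop) :
  (forall x, ~ S x -> exists delta, 0 < delta /\ forall y, Rabs (y - x) < delta -> ~ S y) -> closed_set S.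
Proof.
  intros H x Hx; destruct (H x Hx) as [d [Hd Hy]].
  exists (mkposreal d Hd); intros y Hb; apply Hy, Hb.
Qed.

Lemma closed_last (S : R -> Prop) (p x : R) :
  closed_set S -> S p -> p <= x -> exists z, S z /\ z <= x /\ forall y, S y -> y <= x -> y <= z.
Proof.
  intros HS Hp Hpx.
  destruct (completeness (fun y => S y /\ y <= x)) as [z [Hub Hlub]].
  - exists x; intros y [_ Hy]; exact Hy.
  - exists p; split; assumption.
  - exists z; repeat split.
    + apply NNPP; intros Hz; destruct (closed_nbhd S z HS Hz) as [d [Hd Hn]].
      assert (z <= z - d); [| lra].
      apply Hlub; intros y [Hy Hyx].
      destruct (Rle_dec y (z - d)) as [h | h]; [exact h | exfalso].
      apply (Hn y); [| exact Hy].
      assert (y <= z) by (apply Hub; split; assumption).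
      apply Rabs_def1; lra.
    + apply Hlub; intros y [_ Hy]; exact Hy.
    + intros y Hy Hyx; apply Hub; split; assumption.
Qed.

Lemma closed_opp (S : R -> Prop) : closed_set S -> closed_set (fun x => S (- x)).
Proof.
  intros HS; apply closed_of_nbhd; intros x Hx.
  destruct (closed_nbhd S (- x) HS Hx) as [d [Hd H]].
  exists d; split; [exact Hd |]; intros y Hy; apply H.
  rewrite <- Rabs_Ropp; replace (- (- y - - x)) with (y - x) by ring; exact Hy.
Qed.

(** Nearest neighbours in [S] on either side; the right one is obtained from [closed_last] for the
    reflected set. Off [S] they are the ends of the gap around [x], and on [S] both are [x]. *)
Lemma locate (S : R -> Prop) :
  closed_set S -> (forall x, exists y, S y /\ y <= x) -> (forall x, exists y, S y /\ x <= y) ->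
  exists lo hi : R -> R, forall x,
    S (lo x) /\ S (hi x) /\ lo x <= x <= hi x /\
    (forall y, S y -> y <= lo x \/ hi x <= y) /\ (S x -> lo x = x /\ hi x = x).
Proof.
  intros HS Hl Hh.
  assert (H : forall x, exists ab, S (fst ab) /\ S (snd ab) /\ fst ab <= x <= snd ab /\
    (forall y, S y -> y <= fst ab \/ snd ab <= y) /\ (S x -> fst ab = x /\ snd ab = x)).
  { intros x.
    destruct (Hl x) as [p [Hp Hpx]]; destruct (Hh x) as [q [Hq Hqx]].
    destruct (closed_last S p x HS Hp Hpx) as [a [Ha [Hax Ha']]].
    destruct (closed_last (fun x => S (- x)) (- q) (- x)) as [b [Hb [Hbx Hb']]].
    - now apply closed_opp.
    - now rewrite Ropp_involutive.
    - lra.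
    - exists (a, - b); simpl; split; [exact Ha |]; split; [exact Hb |]; split; [lra |]; split.
      + intros y Hy; destruct (Rle_dec y x) as [h | h]; [left; now apply Ha' | right].
        specialize (Hb' (- y)); rewrite Ropp_involutive in Hb'; specialize (Hb' Hy); lra.
      + intros Hx; specialize (Ha' x Hx (Rle_refl x)).
        specialize (Hb' (- x)); rewrite Ropp_involutive in Hb'; specialize (Hb' Hx (Rle_refl _)).
        split; lra. }
  destruct (choice _ H) as [f Hf].
  exists (fun x => fst (f x)), (fun x => snd (f x)); exact Hf.
Qed.

(* Extending [D] by its value at the left end of each gap gives a function on the line
   whose derivative vanishes identically. *)
Lemma constant_on_closed (S : R -> Prop) (D : R -> R) :
  closed_set S -> (forall x, exists y, S y /\ y <= x) -> (forall x, exists y, S y /\ x <= y) ->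
  (forall a, S a -> forall eps, 0 < eps -> exists delta, 0 < delta /\
     forall b, S b -> Rabs (b - a) < delta -> Rabs (D b - D a) <= eps * Rabs (b - a)) ->
  (forall a b, gap S a b -> D a = D b) ->
  forall x y, S x -> S y -> D x = D y.
Proof.
  intros HS Hl Hh Hloc Hgap.
  destruct (locate S HS Hl Hh) as [lo [hi Hlh]].
  assert (Elh : forall x, D (lo x) = D (hi x)).
  { intros x; destruct (Hlh x) as [h1 [h2 [h3 [h4 h5]]]].
    destruct (Req_dec (lo x) (hi x)) as [e | e]; [now rewrite e |].
    apply Hgap; repeat split; try assumption; [lra |].
    intros y Hy Sy; destruct (h4 y Sy); lra. }
  assert (HD : forall x, is_derive (fun z => D (lo z)) x 0).
  { intros x; apply is_derive_eps; intros eps Heps.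
    destruct (classic (S x)) as [Sx | Sx].
    - destruct (Hloc x Sx eps Heps) as [d [Hd Hb]].
      exists d; split; [exact Hd |]; intros y Hy.
      destruct (Hlh x) as [_ [_ [_ [_ h5]]]]; destruct (h5 Sx) as [-> _].
      destruct (Hlh y) as [k1 [k2 [k3 [k4 k5]]]].
      replace (D (lo y) - D x - 0 * (y - x)) with (D (lo y) - D x) by ring.
      (* For [y] to the right of [x], the left neighbour of [y] lies between them. For [y] to the
         left it may lie far away, and the right neighbour replaces it, with the same value of [D]
         by [Elh]. *)
      assert (Hz : exists z, S z /\ D (lo y) = D z /\ Rabs (z - x) <= Rabs (y - x)).
      { destruct (Rle_dec x y) as [h | h].
        - exists (lo y); repeat split; [exact k1 |].
          assert (x <= lo y).
          { destruct (k4 x Sx); [assumption |].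
            assert (x = y) by lra; subst y; destruct (k5 Sx); lra. }
          rewrite !Rabs_pos_eq; lra.
        - exists (hi y); repeat split; [exact k2 | apply Elh |].
          assert (hi y <= x) by (destruct (k4 x Sx); lra).
          rewrite (Rabs_left1 (hi y - x)), (Rabs_left1 (y - x)); lra. }
      destruct Hz as [z [Sz [-> Hz]]].
      eapply Rle_trans; [apply Hb; [exact Sz | lra] |].
      apply Rmult_le_compat_l; lra.
    - destruct (Hlh x) as [h1 [h2 [h3 [h4 _]]]].
      assert (lo x <> x) by (intros e; apply Sx; rewrite <- e; exact h1).
      assert (hi x <> x) by (intros e; apply Sx; rewrite <- e; exact h2).
      exists (Rmin (x - lo x) (hi x - x)); split; [apply Rmin_pos; lra |].
      intros y Hy.
      assert (lo x < y < hi x).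
      { pose proof (Rmin_l (x - lo x) (hi x - x)); pose proof (Rmin_r (x - lo x) (hi x - x)).
        apply Rabs_def2 in Hy; lra. }
      destruct (Hlh y) as [k1 [k2 [k3 [k4 _]]]].
      replace (lo y) with (lo x).
      + replace (D (lo x) - D (lo x) - 0 * (y - x)) with 0 by ring.
        rewrite Rabs_R0; apply Rmult_le_pos; [lra | apply Rabs_pos].
      + destruct (h4 (lo y) k1), (k4 (lo x) h1); lra. }
  intros x y Sx Sy.
  destruct (Hlh x) as [_ [_ [_ [_ hx]]]]; destruct (Hlh y) as [_ [_ [_ [_ hy]]]].
  destruct (hx Sx) as [ex _]; destruct (hy Sy) as [ey _].
  rewrite <- ex, <- ey.
  apply (const_interval (fun z => D (lo z)) (Rmin x y) (Rmax x y)).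
  - intros z _; apply HD.
  - split; [apply Rmin_l | apply Rmax_l].
  - split; [apply Rmin_r | apply Rmax_r].
Qed.

(* Only the top derivative is glued; integrating it [m] times reproduces the lower-order data
   because on [S] the successive errors have zero derivative and agree at both ends of a gap. *)
Lemma glue_chain (m : nat) (S : R -> Prop) (w : R -> R) (C p : R)
  (u : nat -> R -> R) (v : R -> R -> nat -> R -> R) :
  closed_set S -> (forall x, exists y, S y /\ y <= x) -> (forall x, exists y, S y /\ x <= y) ->
  modulus w -> 0 <= C -> S p -> (forall k, u k p = 0) ->
  (forall k, (k < m)%nat -> forall a, S a -> forall eps, 0 < eps -> exists delta, 0 < delta /\
     forall b, S b -> Rabs (b - a) < delta ->
     Rabs (u k b - u k a - u (Datatypes.S k) a * (b - a)) <= eps * Rabs (b - a)) ->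
  (forall a b, S a -> S b -> Rabs (u m b - u m a) <= C * w (Rabs (b - a))) ->
  (forall a b, gap S a b ->
     chain m (v a b) /\
     (forall k, (k <= m)%nat -> v a b k a = u k a /\ v a b k b = u k b) /\
     (forall x y, a <= x <= b -> a <= y <= b ->
        Rabs (v a b m x - v a b m y) <= C * w (Rabs (x - y)))) ->
  exists F : nat -> R -> R,
    chain m F /\
    (forall k x, (k <= m)%nat -> S x -> F k x = u k x) /\
    (forall a b, gap S a b -> forall k x, (k <= m)%nat -> a <= x <= b -> F k x = v a b k x) /\
    (forall x y, Rabs (F m x - F m y) <= 3 * C * w (Rabs (x - y))).
Proof.
  intros HS Hl Hh Hw HC Sp Hup Hloc Hum Hv.
  destruct (locate S HS Hl Hh) as [lo [hi Hlh]].
  set (V := fun x => if excluded_middle_informative (S x) then u m x else v (lo x) (hi x) m x).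
  assert (VS : forall x, S x -> V x = u m x).
  { intros x Sx; unfold V; destruct (excluded_middle_informative (S x)); tauto. }
  assert (Vgap : forall a b, gap S a b -> forall x, a <= x <= b -> V x = v a b m x).
  { intros a b Hg x Hx; pose proof (Hv a b Hg) as [_ [Hend _]].
    destruct (Hend m (le_n m)) as [e1 e2].
    destruct Hg as [Sa [Sb [Hab Hn]]].
    destruct (Req_dec x a) as [-> | na]; [rewrite VS by assumption; now symmetry |].
    destruct (Req_dec x b) as [-> | nb]; [rewrite VS by assumption; now symmetry |].
    unfold V; destruct (excluded_middle_informative (S x)) as [Sx | Sx].
    - exfalso; apply (Hn x); [lra | exact Sx].
    - destruct (Hlh x) as [h1 [h2 [h3 [h4 _]]]].
      replace (lo x) with a; [replace (hi x) with b; [reflexivity |] |].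
      + destruct (h4 a Sa), (h4 b Sb); try lra.
        destruct (Req_dec (hi x) b); [lra | exfalso; apply (Hn (hi x)); [lra | exact h2]].
      + destruct (h4 a Sa), (h4 b Sb); try lra.
        destruct (Req_dec (lo x) a); [lra | exfalso; apply (Hn (lo x)); [lra | exact h1]]. }
  assert (Hg : forall x, ~ S x -> gap S (lo x) (hi x)).
  { intros x Sx; destruct (Hlh x) as [h1 [h2 [h3 [h4 _]]]].
    assert (lo x <> x) by (intros e; apply Sx; rewrite <- e; exact h1).
    repeat split; try assumption; [lra |].
    intros y Hy Sy; destruct (h4 y Sy); lra. }
  assert (Hends : forall x, Rabs (V x - V (lo x)) <= C * w (x - lo x) /\
                            Rabs (V (hi x) - V x) <= C * w (hi x - x)).
  { intros x; destruct (Hlh x) as [h1 [h2 [h3 [h4 h5]]]].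
    destruct (classic (S x)) as [Sx | Sx].
    - destruct (h5 Sx) as [-> ->].
      replace (V x - V x) with 0 by ring; replace (x - x) with 0 by ring.
      rewrite Rabs_R0, (mod_zero w Hw); lra.
    - pose proof (Hg x Sx) as Hgx; destruct (Hv _ _ Hgx) as [_ [_ Hosc]].
      rewrite !(Vgap _ _ Hgx) by lra.
      split; (eapply Rle_trans; [apply Hosc; lra |]); rewrite Rabs_pos_eq; lra. }
  assert (Vlt : forall x y, x < y -> Rabs (V y - V x) <= 3 * C * w (y - x)).
  { intros x y Hxy.
    destruct (Hlh x) as [h1 [h2 [h3 [h4 h5]]]]; destruct (Hlh y) as [k1 [k2 [k3 [k4 k5]]]].
    (* Either points of [S] separate [x] and [y], and the increment splits at [hi x] and [lo y] into
       three pieces, whence the factor 3, or [x] and [y] lie in the same gap. *)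
    destruct (Rle_dec (hi x) (lo y)) as [h | h].
    - destruct (Hends x) as [_ E1]; destruct (Hends y) as [E2 _].
      pose proof (Hum (hi x) (lo y) h2 k1) as E3; rewrite <- !VS in E3 by assumption.
      rewrite (Rabs_pos_eq (lo y - hi x)) in E3 by lra.
      replace (V y - V x) with ((V y - V (lo y)) + (V (lo y) - V (hi x)) + (V (hi x) - V x)) by ring.
      eapply Rle_trans; [apply Rabs_triang |].
      eapply Rle_trans; [apply Rplus_le_compat_r, Rabs_triang |].
      pose proof (Rmult_le_compat_l C _ _ HC (mod_mono w Hw (hi x - x) (y - x) ltac:(lra) ltac:(lra))).
      pose proof (Rmult_le_compat_l C _ _ HC (mod_mono w Hw (y - lo y) (y - x) ltac:(lra) ltac:(lra))).
      pose proof (Rmult_le_compat_l C _ _ HC (mod_mono w Hw (lo y - hi x) (y - x) ltac:(lra) ltac:(lra))).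
      lra.
    - assert (hi y <= hi x) by (destruct (k4 (hi x) h2); lra).
      assert (lo y <= lo x) by (destruct (h4 (lo y) k1); lra).
      assert (Sx : ~ S x) by (intros Sx; destruct (h5 Sx); lra).
      assert (e1 : lo y = lo x) by (destruct (k4 (lo x) h1); lra).
      assert (e2 : hi y = hi x) by (destruct (h4 (hi y) k2); lra).
      pose proof (Hg x Sx) as Hgx; destruct (Hv _ _ Hgx) as [_ [_ Hosc]].
      rewrite !(Vgap _ _ Hgx) by lra.
      eapply Rle_trans; [apply Hosc; lra |].
      rewrite Rabs_pos_eq by lra.
      pose proof (Rmult_le_pos _ _ HC (mod_nonneg w (y - x) Hw ltac:(lra))); lra. }
  assert (VH : forall x y, Rabs (V x - V y) <= 3 * C * w (Rabs (x - y))).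
  { intros x y; destruct (Rtotal_order x y) as [h | [<- | h]].
    - rewrite Rabs_minus_sym, (Rabs_minus_sym x), (Rabs_pos_eq (y - x)) by lra; now apply Vlt.
    - replace (V x - V x) with 0 by ring; replace (x - x) with 0 by ring.
      rewrite Rabs_R0, (mod_zero w Hw); lra.
    - rewrite (Rabs_pos_eq (x - y)) by lra; now apply Vlt. }
  assert (Vc : forall x, continuous V x) by (apply (holder_continuous w (3 * C)); [exact Hw | lra | exact VH]).
  (* Iterated primitives of [V], all based at [p]: since [u k p = 0] for every [k], the constants of
     integration are zero. *)
  set (G := fix G (j : nat) : R -> R :=
    match j with O => V | Datatypes.S j => fun x => RInt (G j) p x end).
  assert (Gc : forall j x, continuous (G j) x).
  { induction j as [| j IH]; [exact Vc |].
    intros x; apply (is_derive_continuous _ x (G j x)), is_derive_prim, IH. }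
  assert (Gd : forall j x, is_derive (G (Datatypes.S j)) x (G j x)).
  { intros j x; apply (is_derive_prim (G j) p x), Gc. }
  assert (Key : forall j, (j <= m)%nat ->
    (forall x, S x -> G j x = u (m - j)%nat x) /\
    (forall a b, gap S a b -> forall x, a <= x <= b -> G j x = v a b (m - j)%nat x)).
  { induction j as [| j IH]; intros Hj.
    - rewrite Nat.sub_0_r; split; [exact VS | exact Vgap].
    - destruct (IH ltac:(lia)) as [IH1 IH2]; clear IH.
      set (k := (m - Datatypes.S j)%nat) in *.
      replace (m - j)%nat with (Datatypes.S k) in * by lia.
      assert (Hconst : forall a b, gap S a b -> forall x, a <= x <= b ->
        G (Datatypes.S j) x - v a b k x = G (Datatypes.S j) a - v a b k a).
      { intros a b Hgab x Hx.
        destruct (Hv a b Hgab) as [Hch _].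
        apply (const_interval (fun x => G (Datatypes.S j) x - v a b k x) a b); [| exact Hx | lra].
        intros z Hz; replace 0 with (G j z - v a b (Datatypes.S k) z).
        - apply is_derive_minus_R; [apply Gd | apply Hch; lia].
        - rewrite (IH2 a b Hgab z Hz); ring. }
      assert (HDS : forall x, S x -> G (Datatypes.S j) x - u k x = 0).
      { intros x Sx.
        replace 0 with (G (Datatypes.S j) p - u k p).
        2: { rewrite Hup; simpl; rewrite RInt_point; unfold zero; simpl; ring. }
        apply (constant_on_closed S (fun x => G (Datatypes.S j) x - u k x)); try assumption.
        - intros a Sa eps Heps.
          destruct (is_derive_eps_inv _ _ _ (Gd j a) (eps / 2)) as [d1 [Hd1 H1]]; [lra |].
          destruct (Hloc k ltac:(lia) a Sa (eps / 2)) as [d2 [Hd2 H2]]; [lra |].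
          exists (Rmin d1 d2); split; [now apply Rmin_pos |].
          intros b Sb Hb.
          specialize (H1 b (Rlt_le_trans _ _ _ Hb (Rmin_l _ _))).
          specialize (H2 b Sb (Rlt_le_trans _ _ _ Hb (Rmin_r _ _))).
          rewrite (IH1 a Sa) in H1.
          replace (G (Datatypes.S j) b - u k b - (G (Datatypes.S j) a - u k a)) with
            ((G (Datatypes.S j) b - G (Datatypes.S j) a - u (Datatypes.S k) a * (b - a))
             - (u k b - u k a - u (Datatypes.S k) a * (b - a))) by ring.
          eapply Rle_trans; [apply Rabs_triang |]; rewrite Rabs_Ropp; lra.
        - intros a b Hgab.
          pose proof (Hconst a b Hgab b) as E.
          destruct (Hv a b Hgab) as [_ [Hend _]]; destruct (Hend k ltac:(lia)) as [e1 e2].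
          rewrite e1, e2 in E; symmetry; apply E; destruct Hgab; lra. }
      split.
      + intros x Sx; specialize (HDS x Sx); lra.
      + intros a b Hgab x Hx; specialize (Hconst a b Hgab x Hx).
        destruct (Hv a b Hgab) as [_ [Hend _]]; destruct (Hend k ltac:(lia)) as [e1 _].
        rewrite e1 in Hconst; specialize (HDS a (proj1 Hgab)); lra. }
  exists (fun k => G (m - k)%nat); split; [| split; [| split]].
  - intros k Hk x; replace (m - k)%nat with (Datatypes.S (m - Datatypes.S k)) by lia; apply Gd.
  - intros k x Hk Sx; destruct (Key (m - k)%nat ltac:(lia)) as [K1 _].
    rewrite K1 by assumption; f_equal; lia.
  - intros a b Hgab k x Hk Hx; destruct (Key (m - k)%nat ltac:(lia)) as [_ K2].
    rewrite (K2 a b) by assumption; f_equal; lia.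
  - rewrite Nat.sub_diag; exact VH.
Qed.

(** * From interpolants to a jet *)

Definition node_list (m : nat) (K : R -> Prop) (L : list R) : Prop :=
  NoDup L /\ length L = (m + 2)%nat /\ forall x, In x L -> K x.

(* [D L k] is the [k]-th derivative of a function interpolating [gam] on [L]. *)
Definition interpolants (m : nat) (K : R -> Prop) (w : R -> R) (C : R) (gam : R -> R)
  (D : list R -> nat -> R -> R) : Prop :=
  forall L, node_list m K L ->
    chain m (D L) /\ (forall x y, Rabs (D L m x - D L m y) <= C * w (Rabs (x - y))) /\
    forall x, In x L -> D L 0%nat x = gam x.

Definition accum (K : R -> Prop) (a : R) : Prop :=
  forall eps, 0 < eps -> exists y, K y /\ y <> a /\ Rabs (y - a) < eps.

Definition cluster (K : R -> Prop) (a delta : R) (n : nat) (l : list R) : Prop :=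
  NoDup l /\ length l = n /\ forall x, In x l -> K x /\ x <> a /\ Rabs (x - a) < delta.

Lemma separated_list (e : R) (l : list R) :
  exists delta, 0 < delta /\ forall s, In s l -> s <> e -> delta <= Rabs (s - e).
Proof.
  induction l as [| s l [d [Hd IH]]].
  - exists 1; split; [lra | intros s []].
  - destruct (Req_dec s e) as [-> | ne].
    + exists d; split; [exact Hd |]; intros t [<- | Ht] ne; [tauto | now apply IH].
    + exists (Rmin d (Rabs (s - e))); split.
      * apply Rmin_pos; [exact Hd | apply Rabs_pos_lt; lra].
      * intros t [<- | Ht] nt; [apply Rmin_r |].
        eapply Rle_trans; [apply Rmin_l | now apply IH].
Qed.

(** Each new point is chosen closer to [a] than every earlier point and every point to be avoided
    (other than [a]), which makes it different from all of them. *)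
Lemma cluster_exists (K : R -> Prop) (a : R) :
  accum K a -> forall (n : nat) (delta : R) (avoid : list R), 0 < delta ->
  exists l, cluster K a delta n l /\ forall x, In x l -> ~ In x avoid.
Proof.
  intros HK n; induction n as [| n IH]; intros d avoid Hd.
  - exists nil; repeat split; try constructor; simpl; tauto.
  - destruct (IH d avoid Hd) as [l [[H1 [H2 H3]] H4]].
    destruct (separated_list a (avoid ++ l)) as [e [He Hs]].
    destruct (HK (Rmin d e) (Rmin_pos _ _ Hd He)) as [y [Ky [Hya Hy]]].
    assert (Hn : ~ In y (avoid ++ l)).
    { intros Hin; specialize (Hs y Hin Hya); pose proof (Rmin_r d e); lra. }
    exists (y :: l); repeat split.
    + constructor; [intros h; apply Hn, in_or_app; now right | exact H1].
    + simpl; now rewrite H2.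
    + destruct H as [<- | H]; [exact Ky | now apply H3].
    + destruct H as [<- | H]; [exact Hya | now apply H3].
    + destruct H as [<- | H]; [pose proof (Rmin_l d e); lra | now apply H3].
    + intros x [<- | Hx]; [| now apply H4].
      intros h; apply Hn, in_or_app; now left.
Qed.

Lemma interpolants_share (m : nat) (K : R -> Prop) (w : R -> R) (C : R) (gam : R -> R)
  (D : list R -> nat -> R -> R) (L L' Z : list R) (p q : R) :
  interpolants m K w C gam D -> modulus w -> 0 <= C -> p <= q ->
  node_list m K L -> node_list m K L' ->
  NoDup Z -> length Z = S m -> incl Z L -> incl Z L' -> (forall z, In z Z -> p <= z <= q) ->
  forall k, (k <= m)%nat -> forall x, p <= x <= q ->
    Rabs (D L k x - D L' k x) <= (INR m + 1) * (2 * C * w (q - p)) * (q - p) ^ (m - k).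
Proof.
  intros HD Hw HC Hpq HL HL' HZ HZl HZL HZL' HZpq.
  destruct (HD L HL) as [c1 [o1 e1]]; destruct (HD L' HL') as [c2 [o2 e2]].
  pose proof (chain_minus m _ _ c1 c2) as Hch.
  assert (Hz : forall k, (k <= m)%nat -> exists z, p <= z <= q /\ D L k z - D L' k z = 0).
  { apply (rolle_zeros m (fun k x => D L k x - D L' k x) p q Z); try assumption.
    intros y Hy; split; [| now apply HZpq].
    rewrite e1, e2; [ring | now apply HZL' | now apply HZL]. }
  assert (Hw0 : 0 <= w (q - p)) by (apply mod_nonneg; [exact Hw | lra]).
  apply (chain_bound m (fun k x => D L k x - D L' k x) p q); try assumption.
  - apply Rmult_le_pos; lra.
  - intros k Hk; destruct (Hz k ltac:(lia)) as [z [Hzpq Ez]].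
    exists z; split; [exact Hzpq |]; rewrite Ez, Rabs_R0.
    apply Rmult_le_pos; [apply Rmult_le_pos; lra | apply pow_le; lra].
  - intros x Hx; destruct (Hz m (le_n m)) as [z [Hzpq Ez]].
    (* At the Rolle point [z] the two top derivatives agree, so their difference at [x] is at most
       the sum of two oscillations; this is the factor 2. *)
    replace (D L m x - D L' m x) with ((D L m x - D L m z) - (D L' m x - D L' m z)) by lra.
    assert (Hxz : Rabs (x - z) <= q - p) by (apply Rabs_le; lra).
    pose proof (Rmult_le_compat_l C _ _ HC (mod_mono w Hw _ _ (Rabs_pos (x - z)) Hxz)).
    specialize (o1 x z); specialize (o2 x z).
    eapply Rle_trans; [apply Rabs_triang |]; rewrite Rabs_Ropp; lra.
Qed.

(** The path is [Z ++ a :: A], [(b :: Z) ++ A], [(b :: Z) ++ B], [Z ++ b :: B]. The last two lists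
    have the same elements, but [D] depends on the list, so even a reordering has to be paid for
    with [interpolants_share]. Hence two such bounds for each exchanged point. *)
Lemma interpolants_exchange_steps (m : nat) (K : R -> Prop) (w : R -> R) (C : R) (gam : R -> R)
  (D : list R -> nat -> R -> R) (p q : R) :
  interpolants m K w C gam D -> modulus w -> 0 <= C -> p <= q ->
  forall A B Z, length A = length B ->
  node_list m K (Z ++ A) -> node_list m K (Z ++ B) -> (forall x, In x A -> ~ In x B) ->
  (forall x, In x (Z ++ A) \/ In x (Z ++ B) -> p <= x <= q) ->
  forall k, (k <= m)%nat -> forall x, p <= x <= q ->
    Rabs (D (Z ++ A) k x - D (Z ++ B) k x)
      <= INR (length A) * (2 * ((INR m + 1) * (2 * C * w (q - p)) * (q - p) ^ (m - k))).
Proof.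
  intros HD Hw HC Hpq A; induction A as [| a A IH]; intros B Z Hlen HA HB Hdis Hin k Hk x Hx.
  - destruct B; [| discriminate].
    rewrite Rminus_diag, Rabs_R0; simpl; lra.
  - destruct B as [| b B]; [discriminate |]; simpl in Hlen.
    destruct HA as [A1 [A2 A3]]; destruct HB as [B1 [B2 B3]].
    assert (PA : Permutation (a :: Z ++ A) (Z ++ a :: A)) by apply Permutation_middle.
    assert (PB : Permutation (b :: Z ++ B) (Z ++ b :: B)) by apply Permutation_middle.
    assert (NA : NoDup (a :: Z ++ A)) by (apply Permutation_NoDup with (2 := A1); now symmetry).
    assert (NB : NoDup (b :: Z ++ B)) by (apply Permutation_NoDup with (2 := B1); now symmetry).
    inversion NA as [| ? ? NA1 NA2]; subst; inversion NB as [| ? ? NB1 NB2]; subst.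
    assert (V1 : node_list m K ((b :: Z) ++ A)).
    { split; [| split].
      - simpl; constructor; [| exact NA2].
        intros h; apply in_app_or in h; destruct h as [h | h].
        + apply NB1, in_or_app; now left.
        + apply (Hdis b); [now right | now left].
      - rewrite <- A2, !length_app; simpl; lia.
      - intros y [<- | Hy].
        + apply B3, in_or_app; right; now left.
        + apply A3, in_app_iff; apply in_app_or in Hy; simpl; tauto. }
    assert (V2 : node_list m K ((b :: Z) ++ B)).
    { split; [exact NB | split].
      - rewrite <- B2, !length_app; simpl; lia.
      - intros y Hy; apply B3; apply Permutation_in with (1 := PB); exact Hy. }
    assert (I1 : Rabs (D (Z ++ a :: A) k x - D ((b :: Z) ++ A) k x)
       <= (INR m + 1) * (2 * C * w (q - p)) * (q - p) ^ (m - k)).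
    { apply (interpolants_share m K w C gam D) with (Z := Z ++ A); try assumption.
      - split; [| split]; assumption.
      - rewrite length_app in *; simpl in A2; lia.
      - intros y Hy; apply Permutation_in with (1 := PA); now right.
      - intros y Hy; now right.
      - intros y Hy; apply Hin; left; apply Permutation_in with (1 := PA); now right. }
    assert (I2 : Rabs (D ((b :: Z) ++ B) k x - D (Z ++ b :: B) k x)
       <= (INR m + 1) * (2 * C * w (q - p)) * (q - p) ^ (m - k)).
    { apply (interpolants_share m K w C gam D) with (Z := Z ++ B); try assumption.
      - split; [| split]; assumption.
      - rewrite length_app in *; simpl in B2; lia.
      - intros y Hy; now right.
      - intros y Hy; apply Permutation_in with (1 := PB); now right.
      - intros y Hy; apply Hin; right; apply Permutation_in with (1 := PB); now right. }
    assert (I3 := IH B (b :: Z) ltac:(lia) V1 V2).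
    assert (I4 : Rabs (D ((b :: Z) ++ A) k x - D ((b :: Z) ++ B) k x)
       <= INR (length A) * (2 * ((INR m + 1) * (2 * C * w (q - p)) * (q - p) ^ (m - k)))).
    { apply I3; try assumption.
      - intros y Hy h; apply (Hdis y); now right.
      - intros y [[<- | Hy] | [<- | Hy]].
        + apply Hin; right; apply in_or_app; right; now left.
        + apply Hin; left; apply Permutation_in with (1 := PA); now right.
        + apply Hin; right; apply in_or_app; right; now left.
        + apply Hin; right; apply Permutation_in with (1 := PB); now right. }
    replace (D (Z ++ a :: A) k x - D (Z ++ b :: B) k x) with
      ((D (Z ++ a :: A) k x - D ((b :: Z) ++ A) k x) + (D ((b :: Z) ++ A) k x - D ((b :: Z) ++ B) k x)
       + (D ((b :: Z) ++ B) k x - D (Z ++ b :: B) k x)) by ring.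
    eapply Rle_trans; [apply Rabs_triang |].
    eapply Rle_trans; [apply Rplus_le_compat_r, Rabs_triang |].
    simpl length; rewrite S_INR; lra.
Qed.

(** At most [m + 2] exchanges, each with two uses of [interpolants_share]. *)
Definition exch_const (m : nat) (C : R) : R := INR (m + 2) * (2 * ((INR m + 1) * (2 * C))).

Lemma exch_const_nonneg (m : nat) (C : R) : 0 <= C -> 0 <= exch_const m C.
Proof.
  intros HC; unfold exch_const; pose proof (pos_INR (m + 2)); pose proof (pos_INR m).
  apply Rmult_le_pos; [assumption |]; apply Rmult_le_pos; [lra |]; apply Rmult_le_pos; lra.
Qed.

Lemma interpolants_exchange (m : nat) (K : R -> Prop) (w : R -> R) (C : R) (gam : R -> R)
  (D : list R -> nat -> R -> R) (p q : R) (A B Z : list R) :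
  interpolants m K w C gam D -> modulus w -> 0 <= C -> p <= q ->
  length A = length B ->
  node_list m K (Z ++ A) -> node_list m K (Z ++ B) -> (forall x, In x A -> ~ In x B) ->
  (forall x, In x (Z ++ A) \/ In x (Z ++ B) -> p <= x <= q) ->
  forall k, (k <= m)%nat -> forall x, p <= x <= q ->
    Rabs (D (Z ++ A) k x - D (Z ++ B) k x) <= exch_const m C * w (q - p) * (q - p) ^ (m - k).
Proof.
  intros HD Hw HC Hpq Hlen HA HB Hdis Hin k Hk x Hx.
  eapply Rle_trans.
  - apply (interpolants_exchange_steps m K w C gam D p q); assumption.
  - unfold exch_const.
    assert (Hl : INR (length A) <= INR (m + 2)).
    { apply le_INR; destruct HA as [_ [<- _]]; rewrite length_app; lia. }
    replace (INR (m + 2) * (2 * ((INR m + 1) * (2 * C))) * w (q - p) * (q - p) ^ (m - k))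
      with (INR (m + 2) * (2 * ((INR m + 1) * (2 * C * w (q - p)) * (q - p) ^ (m - k)))) by ring.
    apply Rmult_le_compat_r; [| exact Hl].
    apply Rmult_le_pos; [lra |].
    pose proof (pos_INR m); pose proof (mod_nonneg w (q - p) Hw ltac:(lra)).
    apply Rmult_le_pos; [apply Rmult_le_pos; [lra |] | apply pow_le; lra].
    apply Rmult_le_pos; lra.
Qed.

Lemma cluster_node_list (m : nat) (K : R -> Prop) (a delta : R) (l : list R) :
  K a -> cluster K a delta (S m) l -> node_list m K (a :: l).
Proof.
  intros Ka [H1 [H2 H3]]; split; [| split].
  - constructor; [| exact H1]; intros h; apply H3 in h; tauto.
  - simpl; lia.
  - intros x [<- | Hx]; [exact Ka | now apply H3].
Qed.

(** [U] is the limit of the jets at [a] of interpolants on shrinking clusters, with a rate. Here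
    [2 * delta] is the width of the window around [a], and [delta <= 1 / 2] keeps its powers below
    1, so that one rate serves all orders. *)
Definition is_jet (m : nat) (K : R -> Prop) (w : R -> R) (C a : R)
  (D : list R -> nat -> R -> R) (U : nat -> R) : Prop :=
  forall delta, 0 < delta <= 1 / 2 -> forall l, cluster K a delta (S m) l ->
  forall k, (k <= m)%nat -> Rabs (D (a :: l) k a - U k) <= C * w (2 * delta).

Lemma jet_exists (m : nat) (K : R -> Prop) (w : R -> R) (C a : R) (gam : R -> R)
  (D : list R -> nat -> R -> R) :
  interpolants m K w C gam D -> modulus w -> 0 <= C -> K a -> accum K a ->
  exists U, U 0%nat = gam a /\ is_jet m K w (2 * exch_const m C) a D U.
Proof.
  intros HD Hw HC Ka Hacc.
  pose proof (exch_const_nonneg m C HC) as HX; set (X := exch_const m C) in *.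
  assert (Pair : forall d, 0 < d <= 1 / 2 -> forall l l', cluster K a d (S m) l -> cluster K a d (S m) l' ->
    forall k, (k <= m)%nat -> Rabs (D (a :: l) k a - D (a :: l') k a) <= 2 * X * w (2 * d)).
  { intros d Hd l l' Hl Hl' k Hk.
    (* Exchange requires disjoint clusters, while [l] and [l'] may overlap; both are compared with a
       third one that avoids them, which doubles the constant. *)
    destruct (cluster_exists K a Hacc (S m) d (l ++ l') ltac:(lra)) as [l2 [Hl2 Hav]].
    assert (One : forall l1, cluster K a d (S m) l1 -> (forall x, In x l1 -> In x (l ++ l')) ->
      Rabs (D (a :: l1) k a - D (a :: l2) k a) <= X * w (2 * d)).
    { intros l1 Hl1 Hinc.
      eapply Rle_trans.
      - apply (interpolants_exchange m K w C gam D (a - d) (a + d) l1 l2 (a :: nil)); try assumption; try lra.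
        + destruct Hl1 as [_ [-> _]], Hl2 as [_ [-> _]]; reflexivity.
        + now apply (cluster_node_list m K a d).
        + now apply (cluster_node_list m K a d).
        + intros x h1 h2; apply (Hav x h2); now apply Hinc.
        + simpl; intros x [[<- | Hx] | [<- | Hx]]; try lra.
          * apply Hl1 in Hx; destruct Hx as [_ [_ Hx]]; apply Rabs_def2 in Hx; lra.
          * apply Hl2 in Hx; destruct Hx as [_ [_ Hx]]; apply Rabs_def2 in Hx; lra.
      - fold X; replace (a + d - (a - d)) with (2 * d) by ring.
        rewrite <- (Rmult_1_r (X * w (2 * d))) at 2.
        apply Rmult_le_compat_l.
        + apply Rmult_le_pos; [exact HX | apply mod_nonneg; [exact Hw | lra]].
        + apply pow_le_one; lra. }
    pose proof (One l Hl (fun x h => in_or_app _ _ _ (or_introl h))) as O1.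
    pose proof (One l' Hl' (fun x h => in_or_app _ _ _ (or_intror h))) as O2.
    replace (D (a :: l) k a - D (a :: l') k a) with
      ((D (a :: l) k a - D (a :: l2) k a) - (D (a :: l') k a - D (a :: l2) k a)) by ring.
    eapply Rle_trans; [apply Rabs_triang |]; rewrite Rabs_Ropp; lra. }
  set (r := fun n : nat => / (INR n + 2)).
  assert (Hr : forall n, 0 < r n <= 1 / 2).
  { intros n; unfold r; pose proof (pos_INR n); split; [apply Rinv_0_lt_compat; lra |].
    replace (1 / 2) with (/ 2) by lra; apply Rinv_le_contravar; lra. }
  assert (Hrd : forall d, 0 < d -> exists N, forall n, (N <= n)%nat -> r n <= d).
  { intros d Hd; destruct (INR_unbounded (/ d)) as [N HN]; exists N; intros n Hn.
    unfold r; rewrite <- (Rinv_inv d); apply Rinv_le_contravar; [now apply Rinv_0_lt_compat |].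
    apply le_INR in Hn; lra. }
  assert (Hmono : forall d d' l, d <= d' -> cluster K a d (S m) l -> cluster K a d' (S m) l).
  { intros d d' l Hdd [H1 [H2 H3]]; repeat split; try assumption; destruct (H3 x H) as [? [? ?]]; try assumption; lra. }
  destruct (choice (fun n l => cluster K a (r n) (S m) l)) as [l Hl].
  { intros n; destruct (cluster_exists K a Hacc (S m) (r n) nil) as [l [Hl _]]; [apply Hr | now exists l]. }
  assert (Hcv : forall k, exists U, (k <= m)%nat -> Un_cv (fun n => D (a :: l n) k a) U).
  { intros k; destruct (Compare_dec.le_dec k m) as [Hk | Hk]; [| exists 0; tauto].
    destruct (Rcomplete.R_complete (fun n => D (a :: l n) k a)) as [U HU]; [| exists U; intros _; exact HU].
    intros eps Heps.
    destruct (mod_lim w Hw (eps / (2 * X + 1))) as [d [Hd Hwd]]; [apply Rdiv_lt_0_compat; lra |].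
    destruct (Hrd (Rmin (1 / 2) (d / 4))) as [N HN]; [apply Rmin_pos; lra |].
    exists N; intros n n' Hn Hn'; unfold Rdist.
    set (d' := Rmin (1 / 2) (d / 4)) in *.
    assert (Hd' : 0 < d' <= 1 / 2) by (split; [apply Rmin_pos; lra | apply Rmin_l]).
    assert (Hd2 : d' <= d / 4) by apply Rmin_r.
    eapply Rle_lt_trans.
    - apply (Pair d' Hd' (l n) (l n')); [| | exact Hk]; eapply Hmono; [| apply Hl | | apply Hl]; now apply HN.
    - specialize (Hwd (2 * d') ltac:(lra) ltac:(lra)).
      apply Rmult_lt_compat_r with (r := 2 * X + 1) in Hwd; [| lra].
      replace (eps / (2 * X + 1) * (2 * X + 1)) with eps in Hwd by (field; lra).
      pose proof (mod_nonneg w (2 * d') Hw ltac:(lra)); lra. }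
  destruct (choice _ Hcv) as [U HU].
  (* In order 0 all interpolants have the value [gam a], so it is inserted directly instead of the
     limit. *)
  exists (fun k => match k with O => gam a | S _ => U k end); split; [reflexivity |].
  intros d Hd l0 Hl0 k Hk.
  destruct k as [| k].
  - destruct (HD (a :: l0)) as [_ [_ e]]; [now apply (cluster_node_list m K a d) |].
    rewrite e by now left.
    rewrite Rminus_diag, Rabs_R0.
    apply Rmult_le_pos; [lra | apply mod_nonneg; [exact Hw | lra]].
  - apply le_epsilon; intros eps Heps.
    destruct (HU (S k) Hk eps Heps) as [N1 HN1]; destruct (Hrd d) as [N2 HN2]; [lra |].
    set (n := max N1 N2).
    specialize (HN1 n ltac:(lia)); specialize (HN2 n ltac:(lia)).
    pose proof (Pair d Hd l0 (l n) Hl0 (Hmono _ _ _ HN2 (Hl n)) (S k) Hk) as HP.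
    unfold Rdist in HN1.
    replace (D (a :: l0) (S k) a - U (S k)) with
      ((D (a :: l0) (S k) a - D (a :: l n) (S k) a) + (D (a :: l n) (S k) a - U (S k))) by ring.
    eapply Rle_trans; [apply Rabs_triang |]; lra.
Qed.

Lemma jet_small (w : R -> R) (X eps r : R) :
  modulus w -> 0 <= X -> 0 < eps -> 0 < r ->
  exists delta, 0 < delta <= 1 / 2 /\ delta <= r /\ X * w (2 * delta) <= eps.
Proof.
  intros Hw HX Heps Hr.
  destruct (mod_lim w Hw (eps / (X + 1))) as [d [Hd Hwd]]; [apply Rdiv_lt_0_compat; lra |].
  exists (Rmin (1 / 2) (Rmin r (d / 4))).
  assert (0 < Rmin (1 / 2) (Rmin r (d / 4))) by (repeat apply Rmin_pos; lra).
  pose proof (Rmin_l (1 / 2) (Rmin r (d / 4))); pose proof (Rmin_r (1 / 2) (Rmin r (d / 4))).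
  pose proof (Rmin_l r (d / 4)); pose proof (Rmin_r r (d / 4)).
  set (e := Rmin (1 / 2) (Rmin r (d / 4))) in *.
  repeat split; try lra.
  specialize (Hwd (2 * e) ltac:(lra) ltac:(lra)).
  apply Rmult_lt_compat_r with (r := X + 1) in Hwd; [| lra].
  replace (eps / (X + 1) * (X + 1)) with eps in Hwd by (field; lra).
  pose proof (mod_nonneg w (2 * e) Hw ltac:(lra)); lra.
Qed.

(** Four errors add up: the jet error at [b], the exchange of a cluster at [a] for one at [b], the
    Taylor remainder of the interpolant at [a], and the jet error at [a] carried to [b] by its
    Taylor polynomial. The first and last vanish as the clusters shrink; the other two have the
    required size. *)
Lemma jets_whitney (m : nat) (K : R -> Prop) (w : R -> R) (C a b : R) (gam : R -> R)
  (D : list R -> nat -> R -> R) (U V : nat -> R) :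
  interpolants m K w C gam D -> modulus w -> 0 <= C ->
  K a -> accum K a -> K b -> accum K b -> a <> b ->
  is_jet m K w (2 * exch_const m C) a D U -> is_jet m K w (2 * exch_const m C) b D V ->
  forall k, (k <= m)%nat ->
  Rabs (V k - taylor_chain m U a k b)
    <= (exch_const m C + (INR m + 1) * C) * 3 ^ S m * w (Rabs (b - a)) * Rabs (b - a) ^ (m - k).
Proof.
  intros HD Hw HC Ka Aa Kb Ab Hab HU HV k Hk.
  pose proof (exch_const_nonneg m C HC) as HX; set (X := exch_const m C) in *.
  set (L := Rabs (b - a)).
  assert (HL : 0 < L) by (apply Rabs_pos_lt; lra).
  (* A window of length [3 * L], large enough for clusters of radius at most [L / 2]. That radius
     also makes the two clusters disjoint. *)
  set (p := Rmin a b - L); set (q := Rmax a b + L).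
  assert (Hpq : q - p = 3 * L).
  { unfold p, q, L, Rmin, Rmax, Rabs; destruct (Rle_dec a b), (Rcase_abs (b - a)); lra. }
  assert (Ha : p + L <= a <= q - L) by (unfold p, q; pose proof (Rmin_l a b); pose proof (Rmax_l a b); lra).
  assert (Hb : p + L <= b <= q - L) by (unfold p, q; pose proof (Rmin_r a b); pose proof (Rmax_r a b); lra).
  set (P := pol m (fun _ => 1) L).
  assert (HP : 0 <= P) by (apply pol_pos; lra).
  assert (Hfin : (X + (INR m + 1) * C) * w (3 * L) * (3 * L) ^ (m - k)
     <= (X + (INR m + 1) * C) * 3 ^ S m * w L * L ^ (m - k)).
  { pose proof (pos_INR m).
    assert (H0 : 0 <= X + (INR m + 1) * C) by (apply Rplus_le_le_0_compat; [lra | apply Rmult_le_pos; lra]).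
    rewrite !Rmult_assoc; apply Rmult_le_compat_l; [exact H0 |].
    pose proof (mod_mul w 3 L Hw ltac:(lra) ltac:(lra)) as H1.
    rewrite Rpow_mult_distr.
    assert (H3 : 3 ^ (m - k) <= 3 ^ m) by (apply Rle_pow; [lra | lia]).
    pose proof (pow_lt 3 (m - k) ltac:(lra)); pose proof (pow_lt L (m - k) HL).
    pose proof (mod_nonneg w (3 * L) Hw ltac:(lra)); pose proof (mod_nonneg w L Hw ltac:(lra)).
    replace (3 ^ S m * (w L * L ^ (m - k))) with ((3 * w L) * (3 ^ m * L ^ (m - k))) by (simpl; ring).
    apply Rmult_le_compat; [lra | apply Rmult_le_pos; lra | lra |].
    apply Rmult_le_compat_r; lra. }
  eapply Rle_trans; [| exact Hfin].
  apply le_epsilon; intros eta Heta.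
  (* The jet error counts once at [b] and [P] times through the Taylor polynomial at [a], for a
     total of [eta]. *)
  destruct (jet_small w (2 * X) (eta / (1 + P)) (L / 2) Hw ltac:(lra)) as [d [Hd [HdL Hwd]]];
    [apply Rdiv_lt_0_compat; lra | lra |].
  destruct (cluster_exists K a Aa (S m) d nil ltac:(lra)) as [la [Hla _]].
  destruct (cluster_exists K b Ab (S m) d nil ltac:(lra)) as [lb [Hlb _]].
  pose proof (cluster_node_list m K a d la Ka Hla) as Na.
  pose proof (cluster_node_list m K b d lb Kb Hlb) as Nb.
  assert (Ia : forall x, In x (a :: la) -> Rabs (x - a) < d).
  { intros x [<- | Hx]; [rewrite Rminus_diag, Rabs_R0; lra | now apply Hla]. }
  assert (Ib : forall x, In x (b :: lb) -> Rabs (x - b) < d).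
  { intros x [<- | Hx]; [rewrite Rminus_diag, Rabs_R0; lra | now apply Hlb]. }
  assert (E1 : Rabs (D (a :: la) k b - D (b :: lb) k b) <= X * w (q - p) * (q - p) ^ (m - k)).
  { apply (interpolants_exchange m K w C gam D p q (a :: la) (b :: lb) nil); try assumption; try lra.
    - destruct Na as [_ [-> _]], Nb as [_ [-> _]]; reflexivity.
    - intros x h1 h2; apply Ia in h1; apply Ib in h2.
      assert (L < d + d); [| lra].
      unfold L; replace (b - a) with ((x - a) - (x - b)) by ring.
      eapply Rle_lt_trans; [apply Rabs_triang |]; rewrite Rabs_Ropp; lra.
    - simpl app; intros x [h | h].
      + apply Ia, Rabs_def2 in h; lra.
      + apply Ib, Rabs_def2 in h; lra. }
  destruct (HD _ Na) as [ca [oa _]].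
  assert (E2 : Rabs (D (a :: la) k b - taylor_chain m (fun i => D (a :: la) i a) a k b)
    <= (INR m + 1) * (C * w (q - p)) * (q - p) ^ (m - k)).
  { pose proof (mod_nonneg w (q - p) Hw ltac:(lra)) as Hwpq.
    apply (chain_bound m (fun k x => D (a :: la) k x - taylor_chain m (fun i => D (a :: la) i a) a k x) p q);
      try lra; try assumption.
    - apply chain_minus; [exact ca | apply taylor_chain_chain].
    - apply Rmult_le_pos; lra.
    - intros j Hj; exists a; split; [lra |].
      rewrite taylor_chain_at, Rminus_diag, Rabs_R0.
      apply Rmult_le_pos; [apply Rmult_le_pos; lra | apply pow_le; lra].
    - intros x Hx; rewrite taylor_chain_top.
      eapply Rle_trans; [apply oa |]; apply Rmult_le_compat_l; [exact HC |].
      apply (mod_mono w Hw); [apply Rabs_pos | apply Rabs_le; lra]. }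
  assert (E3 : Rabs (taylor_chain m (fun i => D (a :: la) i a) a k b - taylor_chain m U a k b)
    <= eta / (1 + P) * P).
  { unfold taylor_chain; rewrite pol_minus.
    eapply Rle_trans; [apply pol_bound with (e := eta / (1 + P)) |].
    - intros i Hi; eapply Rle_trans; [| exact Hwd]; apply (HU d Hd la Hla); lia.
    - fold L; apply Rmult_le_compat_l; [apply Rlt_le, Rdiv_lt_0_compat; lra |].
      apply pol_one_mono; [lia | lra]. }
  assert (E4 : Rabs (V k - D (b :: lb) k b) <= eta / (1 + P)).
  { rewrite Rabs_minus_sym; eapply Rle_trans; [| exact Hwd]; now apply (HV d Hd lb Hlb). }
  replace (V k - taylor_chain m U a k b) with
    ((V k - D (b :: lb) k b) + - (D (a :: la) k b - D (b :: lb) k b)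
     + (D (a :: la) k b - taylor_chain m (fun i => D (a :: la) i a) a k b)
     + (taylor_chain m (fun i => D (a :: la) i a) a k b - taylor_chain m U a k b)) by ring.
  eapply Rle_trans; [apply Rabs_triang |].
  eapply Rle_trans; [apply Rplus_le_compat_r, Rabs_triang |].
  eapply Rle_trans; [apply Rplus_le_compat_r, Rplus_le_compat_r, Rabs_triang |].
  rewrite Rabs_Ropp.
  assert (Heq : eta / (1 + P) + eta / (1 + P) * P = eta) by (field; lra).
  rewrite Hpq in E1, E2; lra.
Qed.

(** The nodes [a :: l] are [m + 1] points shared with the cluster interpolant on [a :: y :: l],
    whose jet at [a] is close to [U]. The one remaining node is free and is placed at [b], however
    far away. *)
Lemma jet_far_point (m : nat) (K : R -> Prop) (w : R -> R) (C a b : R) (gam : R -> R)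
  (D : list R -> nat -> R -> R) (U : nat -> R) (eps : R) :
  interpolants m K w C gam D -> modulus w -> 0 <= C ->
  K a -> accum K a -> K b -> a <> b ->
  is_jet m K w (2 * exch_const m C) a D U -> 0 < eps ->
  exists delta, 0 < delta /\ forall l, cluster K a delta m l ->
    node_list m K (b :: a :: l) /\
    forall k, (k <= m)%nat -> Rabs (D (b :: a :: l) k a - U k) <= eps.
Proof.
  intros HD Hw HC Ka Aa Kb Hab HU Heps.
  pose proof (exch_const_nonneg m C HC) as HX; set (X := exch_const m C) in *.
  assert (HL : 0 < Rabs (b - a)) by (apply Rabs_pos_lt; lra).
  pose proof (pos_INR m).
  assert (HY : 0 <= (INR m + 1) * (2 * C)) by (apply Rmult_le_pos; lra).
  destruct (jet_small w (2 * X + (INR m + 1) * (2 * C)) eps (Rabs (b - a) / 2) Hw ltac:(lra) Heps) as [d [Hd [HdL Hwd]]];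
    [lra |].
  exists d; split; [lra |]; intros l Hl.
  destruct (cluster_exists K a Aa 1 d l ltac:(lra)) as [ly [[Hy1 [Hy2 Hy3]] Hav]].
  destruct ly as [| y [| ? ?]]; try discriminate.
  specialize (Hy3 y (or_introl eq_refl)); specialize (Hav y (or_introl eq_refl)).
  assert (Hyl : cluster K a d (S m) (y :: l)).
  { destruct Hl as [l1 [l2 l3]]; split; [| split].
    - now constructor.
    - simpl; now rewrite l2.
    - intros x [<- | Hx]; [exact Hy3 | now apply l3]. }
  pose proof (cluster_node_list m K a d _ Ka Hyl) as N2.
  destruct Hl as [l1 [l2 l3]].
  assert (Nal : NoDup (a :: l)).
  { constructor; [| exact l1]; intros h; apply l3 in h; tauto. }
  assert (N1 : node_list m K (b :: a :: l)).
  { split; [| split].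
    - constructor; [| exact Nal].
      intros [h | h]; [lra |]; apply l3 in h; lra.
    - simpl; lia.
    - intros x [<- | [<- | Hx]]; [exact Kb | exact Ka | now apply l3]. }
  split; [exact N1 |]; intros k Hk.
  assert (E1 : Rabs (D (b :: a :: l) k a - D (a :: y :: l) k a) <= (INR m + 1) * (2 * C * w (2 * d))).
  { eapply Rle_trans.
    - apply (interpolants_share m K w C gam D _ _ (a :: l) (a - d) (a + d)); try assumption; try lra.
      + simpl; now rewrite l2.
      + intros x Hx; now right.
      + intros x [<- | Hx]; [now left | right; now right].
      + intros x [<- | Hx]; [lra |].
        apply l3 in Hx; destruct Hx as [_ [_ Hx]]; apply Rabs_def2 in Hx; lra.
    - replace (a + d - (a - d)) with (2 * d) by ring.
      pose proof (mod_nonneg w (2 * d) Hw ltac:(lra)).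
      rewrite <- (Rmult_1_r ((INR m + 1) * (2 * C * w (2 * d)))) at 2.
      apply Rmult_le_compat_l.
      + apply Rmult_le_pos; [lra | apply Rmult_le_pos; lra].
      + apply pow_le_one; lra. }
  pose proof (HU d Hd _ Hyl k Hk) as E2; fold X in E2.
  replace (D (b :: a :: l) k a - U k) with
    ((D (b :: a :: l) k a - D (a :: y :: l) k a) + (D (a :: y :: l) k a - U k)) by ring.
  eapply Rle_trans; [apply Rabs_triang |]; lra.
Qed.

(** * Bumps and Hermite interpolation *)

Inductive poly : (R -> R) -> Prop :=
| poly_const c : poly (fun _ => c)
| poly_id : poly (fun x => x)
| poly_add P Q : poly P -> poly Q -> poly (fun x => P x + Q x)
| poly_mul P Q : poly P -> poly Q -> poly (fun x => P x * Q x).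

Lemma poly_derive (P : R -> R) : poly P -> exists P', poly P' /\ forall x, is_derive P x (P' x).
Proof.
  induction 1 as [c | | P Q HP [P' [HP' DP]] HQ [Q' [HQ' DQ]] | P Q HP [P' [HP' DP]] HQ [Q' [HQ' DQ]]].
  - exists (fun _ => 0); split; [constructor |]; intros x; apply (is_derive_const (K := R_AbsRing) (V := R_NormedModule)).
  - exists (fun _ => 1); split; [constructor |]; intros x; apply (is_derive_id (K := R_AbsRing)).
  - exists (fun x => P' x + Q' x); split; [now constructor |]; intros x.
    now apply is_derive_plus_R.
  - exists (fun x => P' x * Q x + P x * Q' x); split; [repeat (constructor; try assumption) |].
    intros x; now apply is_derive_mult_R.
Qed.

Definition pospow (n : nat) (y : R) : R := Rmax 0 y ^ n.

(** Only the square needs an estimate, with error at most [(z - y) ^ 2]. Higher powers follow from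
    the product rule, because multiplying a positive power of the positive part by [z] raises the
    exponent. *)
Lemma pospow_derive (n : nat) (y : R) :
  is_derive (pospow (S (S n))) y (INR (S (S n)) * pospow (S n) y).
Proof.
  revert y; induction n as [| n IH]; intros y.
  - apply is_derive_eps; intros eps Heps; exists eps; split; [exact Heps |]; intros z Hz.
    apply Rle_trans with (Rabs (z - y) * Rabs (z - y)).
    + rewrite <- Rabs_mult, (Rabs_pos_eq ((z - y) * (z - y))) by apply Rle_0_sqr.
      unfold pospow; simpl; unfold Rmax.
      destruct (Rle_dec 0 z) as [hz | hz], (Rle_dec 0 y) as [hy | hy];
        try apply Rnot_le_lt in hz; try apply Rnot_le_lt in hy; simpl; apply Rabs_le; split;
        pose proof (Rle_0_sqr z); pose proof (Rle_0_sqr y); pose proof (Rle_0_sqr (z - y)); unfold Rsqr in *; nra.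
    + apply Rmult_le_compat_r; [apply Rabs_pos | lra].
  - assert (E : forall k z, z * pospow (S k) z = pospow (S (S k)) z).
    { intros k z; unfold pospow, Rmax; simpl; destruct (Rle_dec 0 z); ring. }
    apply (is_derive_ext (fun z => z * pospow (S (S n)) z)); [intros; apply E |].
    replace (INR (S (S (S n))) * pospow (S (S n)) y)
      with (1 * pospow (S (S n)) y + y * (INR (S (S n)) * pospow (S n) y)).
    + apply (is_derive_mult_R (fun z => z)); [apply (is_derive_id (K := R_AbsRing)) | apply IH].
    + rewrite (S_INR (S (S n))), <- (E n y); ring.
Qed.

(** A form preserved by differentiation at the cost of one exponent. Finite smoothness is enough
    here, so a power of the positive part of [x * (1 - x)] replaces an exponential bump. *)
Definition bumpish (n : nat) (f : R -> R) : Prop :=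
  exists Q, poly Q /\ forall x, f x = pospow n (x * (1 - x)) * Q x.

Lemma bumpish_derive (n : nat) (f : R -> R) :
  bumpish (S (S n)) f -> exists g, bumpish (S n) g /\ forall x, is_derive f x (g x).
Proof.
  intros [Q [HQ Hf]]; destruct (poly_derive Q HQ) as [Q' [HQ' DQ]].
  exists (fun x => pospow (S n) (x * (1 - x)) * (INR (S (S n)) * (1 + -2 * x) * Q x + x * (1 + -1 * x) * Q' x)).
  split.
  - eexists; split; [| intros x; reflexivity].
    repeat (constructor; try assumption).
  - intros x; apply (is_derive_ext (fun x => pospow (S (S n)) (x * (1 - x)) * Q x)); [intros; now rewrite Hf |].
    replace (pospow (S n) (x * (1 - x)) * (INR (S (S n)) * (1 + -2 * x) * Q x + x * (1 + -1 * x) * Q' x))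
      with ((1 - 2 * x) * (INR (S (S n)) * pospow (S n) (x * (1 - x))) * Q x
            + pospow (S (S n)) (x * (1 - x)) * Q' x).
    + apply (is_derive_mult_R (fun x => pospow (S (S n)) (x * (1 - x))) Q); [| apply DQ].
      apply (is_derive_comp (V := R_NormedModule) (pospow (S (S n))) (fun x => x * (1 - x)) x
        (INR (S (S n)) * pospow (S n) (x * (1 - x))) (1 - 2 * x)).
      * apply (pospow_derive n (x * (1 - x))).
      * auto_derive; [exact I | ring].
    + assert (E : pospow (S (S n)) (x * (1 - x)) = x * (1 - x) * pospow (S n) (x * (1 - x))).
      { unfold pospow, Rmax; simpl; destruct (Rle_dec 0 (x * (1 - x))); ring. }
      rewrite E; ring.
Qed.

Lemma bumpish_chain (n : nat) : forall f, bumpish (S (S n)) f ->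
  exists F, F 0%nat = f /\ chain n F /\ forall k, (k <= n)%nat -> bumpish (S (S (n - k))) (F k).
Proof.
  induction n as [| n IH]; intros f Hf.
  - exists (fun _ => f); split; [reflexivity | split]; [intros k Hk; lia |].
    intros k Hk; exact Hf.
  - destruct (bumpish_derive (S n) f Hf) as [g [Hg Dg]].
    destruct (IH g Hg) as [G [G0 [G1 G2]]].
    exists (fun k => match k with O => f | S k => G k end); split; [reflexivity | split].
    + intros [| k] Hk x; [rewrite G0; apply Dg | apply G1; lia].
    + intros [| k] Hk; [exact Hf | apply G2; lia].
Qed.

Lemma bump_exists (n : nat) : exists beta : nat -> R -> R,
  chain n beta /\ (forall k x, (k <= n)%nat -> continuous (beta k) x) /\
  (forall k x, (k <= n)%nat -> x <= 0 \/ 1 <= x -> beta k x = 0) /\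
  (forall x, 0 < x < 1 -> 0 < beta 0%nat x).
Proof.
  destruct (bumpish_chain n (fun x => pospow (S (S n)) (x * (1 - x)) * 1)) as [F [F0 [F1 F2]]].
  { exists (fun _ => 1); split; [constructor | reflexivity]. }
  exists F; split; [exact F1 | split; [| split]].
  - intros k x Hk; destruct (bumpish_derive _ _ (F2 k Hk)) as [g [_ Dg]].
    now apply (is_derive_continuous _ x (g x)).
  - intros k x Hk Hx; destruct (F2 k Hk) as [Q [_ ->]].
    unfold pospow; rewrite Rmax_left by (destruct Hx; nra); simpl; ring.
  - intros x Hx; rewrite F0, Rmult_1_r; apply pow_lt.
    rewrite Rmax_right; nra.
Qed.

Lemma fin_bound (n : nat) (P : nat -> R -> Prop) :
  (forall j B B', B <= B' -> P j B -> P j B') -> (forall j, (j <= n)%nat -> exists B, P j B) ->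
  exists B, 0 <= B /\ forall j, (j <= n)%nat -> P j B.
Proof.
  intros Hm; induction n as [| n IH]; intros H.
  - destruct (H 0%nat (le_n _)) as [B HB]; exists (Rmax 0 B); split; [apply Rmax_l |].
    intros j Hj; replace j with 0%nat by lia; apply (Hm 0%nat B); [apply Rmax_r | exact HB].
  - destruct IH as [B [HB0 HB]]; [intros; apply H; lia |].
    destruct (H (S n) (le_n _)) as [B' HB']; exists (Rmax B B'); split.
    + eapply Rle_trans; [exact HB0 | apply Rmax_l].
    + intros j Hj; destruct (Nat.eq_dec j (S n)) as [-> | ne].
      * apply (Hm _ B'); [apply Rmax_r | exact HB'].
      * apply (Hm _ B); [apply Rmax_l | apply HB; lia].
Qed.

Lemma bump_bound (n : nat) (beta : nat -> R -> R) :
  (forall k x, (k <= n)%nat -> continuous (beta k) x) ->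
  (forall k x, (k <= n)%nat -> x <= 0 \/ 1 <= x -> beta k x = 0) ->
  exists B, 0 <= B /\ forall k, (k <= n)%nat -> forall x, Rabs (beta k x) <= B.
Proof.
  intros Hc H0; apply (fin_bound n (fun k B => forall x, Rabs (beta k x) <= B)).
  - intros j B B' HB H x; specialize (H x); lra.
  - intros k Hk; destruct (continuous_bounded (beta k) 0 1) as [B [HB HBx]]; [lra | intros; now apply Hc |].
    exists B; intros x.
    destruct (Rle_dec x 0); [rewrite H0, Rabs_R0; auto |].
    destruct (Rle_dec 1 x); [rewrite H0, Rabs_R0; auto |].
    apply HBx; lra.
Qed.

(** For [j = 0], a primitive of a bump of integral 1. For [S j], a primitive of the function for
    [j], minus a multiple of the former to cancel its value at 1. The extra order with continuous
    top derivative makes the order [n] Lipschitz on the unit interval. *)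
Lemma hermite_exists (n : nat) : forall j, (j <= n)%nat -> exists F : nat -> R -> R,
  chain (S n) F /\ (forall x, continuous (F (S n)) x) /\
  forall k, (k <= n)%nat -> F k 0 = 0 /\ F k 1 = if Nat.eq_dec j k then 1 else 0.
Proof.
  assert (Hb : forall n, exists b : nat -> R -> R, chain n b /\ (forall k x, (k <= n)%nat -> continuous (b k) x) /\
    (forall k, (k <= n)%nat -> b k 0 = 0 /\ b k 1 = 0) /\ RInt (b 0%nat) 0 1 = 1).
  { clear n; intros n; destruct (bump_exists n) as [b [b1 [b2 [b3 b4]]]].
    assert (Hpos : 0 < RInt (b 0%nat) 0 1).
    { apply RInt_gt_0; [lra | exact b4 | intros x _; apply b2; lia]. }
    exists (fun k x => / RInt (b 0%nat) 0 1 * b k x); split; [| split; [| split]].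
    - intros k Hk x; apply is_derive_scal_R, b1, Hk.
    - intros k x Hk; apply continuous_scal_R, b2, Hk.
    - intros k Hk; rewrite !b3 by (try assumption; lra); split; ring.
    - assert (Hex : ex_RInt (b 0%nat) 0 1) by (apply continuous_ex_RInt; intros; apply b2; lia).
      pose proof (RInt_scal (V := R_CompleteNormedModule) (b 0%nat) 0 1 (/ RInt (b 0%nat) 0 1) Hex) as E.
      unfold scal in E; simpl in E; unfold mult in E; simpl in E.
      rewrite E; apply Rinv_l; lra. }
  assert (H0 : forall n, exists F : nat -> R -> R,
    chain (S n) F /\ (forall x, continuous (F (S n)) x) /\
    forall k, (k <= n)%nat -> F k 0 = 0 /\ F k 1 = if Nat.eq_dec 0 k then 1 else 0).
  { clear n; intros n; destruct (Hb n) as [b [b1 [b2 [b3 b4]]]].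
    exists (fun k => match k with O => fun x => RInt (b 0%nat) 0 x | S k => b k end); split; [| split].
    - intros [| k] Hk x; [apply is_derive_prim; intros; apply b2; lia | apply b1; lia].
    - intros x; apply b2; lia.
    - intros [| k] Hk; simpl.
      + rewrite RInt_point; split; [reflexivity | exact b4].
      + apply b3; lia. }
  induction n as [| n IH]; intros j Hj.
  - replace j with 0%nat by lia; apply H0.
  - destruct j as [| j]; [apply H0 |].
    destruct (IH j ltac:(lia)) as [F [F1 [F2 F3]]].
    destruct (Hb (S n)) as [b [b1 [b2 [b3 b4]]]].
    assert (Fc : forall x, continuous (F 0%nat) x).
    { intros x; apply (is_derive_continuous _ x (F 1%nat x)), F1; lia. }
    set (c := RInt (F 0%nat) 0 1).
    exists (fun k => match k with O => fun x => RInt (F 0%nat) 0 x - c * RInt (b 0%nat) 0 x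
                             | S k => fun x => F k x - c * b k x end); split; [| split].
    + intros [| k] Hk x.
      * apply is_derive_minus_R; [now apply is_derive_prim |].
        apply is_derive_scal_R, is_derive_prim; intros; apply b2; lia.
      * apply is_derive_minus_R; [apply F1; lia |].
        apply is_derive_scal_R, b1; lia.
    + intros x; apply continuous_minus_R; [apply F2 |].
      apply continuous_scal_R, b2; lia.
    + intros [| k] Hk.
      * rewrite !RInt_point, b4; unfold zero; simpl; split; [ring | unfold c; ring].
      * destruct (F3 k ltac:(lia)) as [-> ->]; destruct (b3 k ltac:(lia)) as [-> ->].
        split; [ring |].
        destruct (Nat.eq_dec j k), (Nat.eq_dec (S j) (S k)); try lia; ring.
Qed.

Lemma hermite_family (m : nat) : exists (eta : nat -> nat -> R -> R) (B : R), 0 <= B /\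
  forall j, (j <= m)%nat -> chain (S m) (eta j) /\
    (forall k, (k <= m)%nat -> eta j k 0 = 0 /\ eta j k 1 = if Nat.eq_dec j k then 1 else 0) /\
    forall x, 0 <= x <= 1 -> Rabs (eta j (S m) x) <= B.
Proof.
  destruct (choice (fun j F => (j <= m)%nat -> chain (S m) F /\ (forall x, continuous (F (S m)) x) /\
    forall k, (k <= m)%nat -> F k 0 = 0 /\ F k 1 = if Nat.eq_dec j k then 1 else 0)) as [eta Heta].
  { intros j; destruct (Compare_dec.le_dec j m) as [h | h].
    - destruct (hermite_exists m j h) as [F HF]; exists F; intros _; exact HF.
    - exists (fun _ _ => 0); tauto. }
  destruct (fin_bound m (fun j B => forall x, 0 <= x <= 1 -> Rabs (eta j (S m) x) <= B)) as [B [HB0 HB]].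
  - intros j B B' HB H x Hx; specialize (H x Hx); lra.
  - intros j Hj; destruct (Heta j Hj) as [_ [Hc _]].
    destruct (continuous_bounded _ 0 1 Rle_0_1 Hc) as [B [_ HB]]; now exists B.
  - exists eta, B; split; [exact HB0 |]; intros j Hj.
    destruct (Heta j Hj) as [h1 [_ h3]]; split; [exact h1 | split; [exact h3 | now apply HB]].
Qed.

Lemma sum_single (f : nat -> R) (n k : nat) :
  (k <= n)%nat -> (forall j, (j <= n)%nat -> j <> k -> f j = 0) -> sum_f_R0 f n = f k.
Proof.
  induction n as [| n IH]; intros Hk H.
  - now replace k with 0%nat by lia.
  - simpl; destruct (Nat.eq_dec k (S n)) as [-> | ne].
    + rewrite (sum_eq _ (fun _ => 0)) by (intros; apply H; lia).
      rewrite sum_cte; ring.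
    + rewrite IH by (try lia; intros; apply H; lia).
      rewrite (H (S n)) by lia; ring.
Qed.

Lemma chain_sum (n : nat) (F : nat -> nat -> R -> R) (N : nat) :
  (forall j, (j <= N)%nat -> chain n (F j)) -> chain n (fun k x => sum_f_R0 (fun j => F j k x) N).
Proof.
  induction N as [| N IH]; intros H.
  - intros k Hk x; apply (H 0%nat); [lia | exact Hk].
  - apply (chain_plus n (fun k x => sum_f_R0 (fun j => F j k x) N) (F (S N))).
    + apply IH; intros; apply H; lia.
    + apply H; lia.
Qed.

(** This converts Lipschitz into [w]-bounds inside a gap: a profile rescaled to length [L]
    oscillates like [w L * (d / L)]. *)
Lemma mod_scaled (w : R -> R) (L d : R) :
  modulus w -> 0 < L -> 0 <= d <= L -> w L * (d / L) <= w d.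
Proof.
  intros Hw HL Hd; pose proof (mod_ratio w Hw d L ltac:(lra) ltac:(lra)).
  apply Rmult_le_reg_l with L; [exact HL |].
  replace (L * (w L * (d / L))) with (d * w L) by (field; lra); lra.
Qed.

Lemma hermite_fill (m : nat) : exists Ch, 0 <= Ch /\
  forall (w : R -> R) (a b C : R) (U V : nat -> R), modulus w -> a < b -> 0 <= C ->
  (forall k, (k <= m)%nat -> Rabs (V k - taylor_chain m U a k b) <= C * w (b - a) * (b - a) ^ (m - k)) ->
  exists v, chain m v /\ (forall k, (k <= m)%nat -> v k a = U k /\ v k b = V k) /\
    forall x y, a <= x <= b -> a <= y <= b -> Rabs (v m x - v m y) <= Ch * C * w (Rabs (x - y)).
Proof.
  destruct (hermite_family m) as [eta [B [HB Heta]]].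
  exists (B * INR (S m)); split; [apply Rmult_le_pos; [exact HB | apply pos_INR] |].
  intros w a b C U V Hw Hab HC HV.
  set (L := b - a) in *; assert (HL : 0 < L) by (unfold L; lra).
  set (e := fun j => V j - taylor_chain m U a j b).
  (* The Taylor polynomial at [a] misses the jet at [b] by [e j] in order [j]; the rescaled [eta j]
     with amplitude [e j * L ^ j] repairs that order alone. In order [m] the polynomial is constant,
     so only the repairs oscillate. *)
  exists (fun k x => taylor_chain m U a k x
     + sum_f_R0 (fun j => e j * L ^ j * (/ L) ^ k * eta j k (/ L * (x - a) - 0)) m).
  split; [| split].
  - apply chain_plus; [apply taylor_chain_chain |].
    apply (chain_sum m (fun j k x => e j * L ^ j * (/ L) ^ k * eta j k (/ L * (x - a) - 0))).
    intros j Hj; apply chain_scale, (chain_le (S m)); [lia | now apply Heta].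
  - intros k Hk; split.
    + rewrite taylor_chain_at, (sum_eq _ (fun _ => 0)).
      * rewrite sum_cte; ring.
      * intros j Hj; replace (/ L * (a - a) - 0) with 0 by ring.
        destruct (Heta j Hj) as [_ [h _]]; destruct (h k Hk) as [-> _]; ring.
    + rewrite (sum_single _ m k Hk).
      * replace (/ L * (b - a) - 0) with 1 by (unfold L in *; field; lra).
        destruct (Heta k Hk) as [_ [h _]]; destruct (h k Hk) as [_ ->].
        destruct (Nat.eq_dec k k); [| lia].
        replace (e k * L ^ k * (/ L) ^ k * 1) with (e k * (L ^ k * (/ L) ^ k)) by ring.
        rewrite <- Rpow_mult_distr, Rinv_r, pow1 by lra; unfold e; ring.
      * intros j Hj ne; replace (/ L * (b - a) - 0) with 1 by (unfold L in *; field; lra).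
        destruct (Heta j Hj) as [_ [h _]]; destruct (h k Hk) as [_ ->].
        destruct (Nat.eq_dec j k); [lia | ring].
  - intros x y Hx Hy; rewrite !taylor_chain_top.
    match goal with |- Rabs (_ + ?s1 - (_ + ?s2)) <= _ => replace (U m + s1 - (U m + s2)) with (s1 - s2) by ring end.
    rewrite <- minus_sum.
    eapply Rle_trans; [apply Rsum_abs |].
    set (t := Rabs (x - y)).
    assert (Ht : 0 <= t <= L) by (split; [apply Rabs_pos | apply Rabs_le; unfold L; lra]).
    apply Rle_trans with (sum_f_R0 (fun _ => B * C * w t) m); [| rewrite sum_cte; lra].
    apply sum_Rle; intros j Hj.
    destruct (Heta j Hj) as [h1 [_ h3]].
    rewrite <- Rmult_minus_distr_l, Rabs_mult.
    assert (E1 : Rabs (eta j m (/ L * (x - a) - 0) - eta j m (/ L * (y - a) - 0)) <= B * (t / L)).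
    { assert (Hin : forall z, a <= z <= b -> 0 <= / L * (z - a) - 0 <= 1).
      { intros z Hz; split.
        - rewrite Rminus_0_r; apply Rmult_le_pos; [apply Rlt_le, Rinv_0_lt_compat; lra | lra].
        - apply Rmult_le_reg_l with L; [exact HL |].
          replace (L * (/ L * (z - a) - 0)) with (z - a) by (field; lra); unfold L; lra. }
      eapply Rle_trans.
      - apply (mvt_abs (eta j m) (eta j (S m)) 0 1 B); [intros z; apply h1; lia | exact h3 | now apply Hin | now apply Hin].
      - replace (/ L * (x - a) - 0 - (/ L * (y - a) - 0)) with ((x - y) / L) by (field; lra).
        unfold Rdiv; rewrite Rabs_mult, (Rabs_pos_eq (/ L)) by (apply Rlt_le, Rinv_0_lt_compat; lra).
        apply Rle_refl. }
    assert (E2 : Rabs (e j * L ^ j * (/ L) ^ m) <= C * w L).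
    { rewrite !Rabs_mult, (Rabs_pos_eq (L ^ j)), (Rabs_pos_eq ((/ L) ^ m)).
      2: apply pow_le, Rlt_le, Rinv_0_lt_compat; lra.
      2: apply pow_le; lra.
      specialize (HV j Hj); fold (e j) in HV.
      assert (Hp : 0 <= L ^ j * (/ L) ^ m).
      { apply Rmult_le_pos; apply pow_le; [lra | apply Rlt_le, Rinv_0_lt_compat; lra]. }
      rewrite Rmult_assoc; eapply Rle_trans; [apply Rmult_le_compat_r; [exact Hp | exact HV] |].
      right; replace (C * w L * L ^ (m - j) * (L ^ j * (/ L) ^ m))
        with (C * w L * (L ^ (m - j) * L ^ j * (/ L) ^ m)) by ring.
      rewrite <- pow_add; replace (m - j + j)%nat with m by lia.
      rewrite <- Rpow_mult_distr, Rinv_r, pow1 by lra; ring. }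
    pose proof (mod_scaled w L t Hw HL Ht) as E3.
    apply Rle_trans with (C * w L * (B * (t / L))).
    + apply Rmult_le_compat; [apply Rabs_pos | apply Rabs_pos | exact E2 | exact E1].
    + replace (C * w L * (B * (t / L))) with (B * C * (w L * (t / L))) by ring.
      apply Rmult_le_compat_l; [apply Rmult_le_pos; assumption | exact E3].
Qed.

(** * Whitney extension *)

Lemma closed_union_list (S : R -> Prop) (l : list R) :
  closed_set S -> closed_set (fun x => S x \/ In x l).
Proof.
  intros HS; apply closed_of_nbhd; intros x Hx.
  destruct (closed_nbhd S x HS) as [d [Hd H1]]; [tauto |].
  destruct (separated_list x l) as [e [He H2]].
  exists (Rmin d e); split; [now apply Rmin_pos |]; intros y Hy.
  pose proof (Rmin_l d e); pose proof (Rmin_r d e).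
  intros [Sy | Hl]; [apply (H1 y); [lra | exact Sy] |].
  specialize (H2 y Hl ltac:(intros ->; tauto)); lra.
Qed.

Lemma separated_union (S : R -> Prop) (l : list R) : closed_set S ->
  exists delta, 0 < delta /\ forall a b, S a \/ In a l -> S b \/ In b l -> a <> b ->
    ~ (S a /\ S b) -> delta <= Rabs (a - b).
Proof.
  intros HS.
  assert (H : forall l', exists delta, 0 < delta /\ forall a b, S a \/ In a l -> In b l' -> ~ S b -> a <> b ->
    delta <= Rabs (a - b)).
  { induction l' as [| e l' [d [Hd IH]]].
    - exists 1; split; [lra | intros a b _ []].
    - destruct (classic (S e)) as [Se | Se].
      + exists d; split; [exact Hd |]; intros a b Ha [<- | Hb] Sb ne; [tauto | now apply IH].
      + destruct (closed_nbhd S e HS Se) as [d1 [Hd1 H1]].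
        destruct (separated_list e l) as [d2 [Hd2 H2]].
        exists (Rmin d (Rmin d1 d2)); split; [repeat apply Rmin_pos; assumption |].
        pose proof (Rmin_l d (Rmin d1 d2)); pose proof (Rmin_r d (Rmin d1 d2)).
        pose proof (Rmin_l d1 d2); pose proof (Rmin_r d1 d2).
        intros a b Ha [<- | Hb] Sb ne; [| specialize (IH a b Ha Hb Sb ne); lra].
        destruct Ha as [Sa | Hl].
        * destruct (Rlt_dec (Rabs (a - e)) d1) as [h | h]; [exfalso; now apply (H1 a) | lra].
        * specialize (H2 a Hl ne); lra. }
  destruct (H l) as [d [Hd Hs]]; exists d; split; [exact Hd |].
  intros a b Ha Hb ne Hn.
  destruct (classic (S b)) as [Sb | Sb].
  - rewrite Rabs_minus_sym; apply Hs; try tauto; lra.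
  - apply Hs; tauto.
Qed.

Lemma list_bound (g : R -> R) (l : list R) : exists B, 0 <= B /\ forall x, In x l -> Rabs (g x) <= B.
Proof.
  induction l as [| y l [B [HB IH]]].
  - exists 0; split; [lra | intros x []].
  - exists (Rmax B (Rabs (g y))); split; [eapply Rle_trans; [exact HB | apply Rmax_l] |].
    intros x [<- | Hx]; [apply Rmax_r |].
    eapply Rle_trans; [now apply IH | apply Rmax_l].
Qed.

Lemma pow_lower (d L : R) (j n : nat) : 0 < d -> d <= L -> (j <= n)%nat -> Rmin 1 d ^ n <= L ^ j.
Proof.
  intros Hd HL Hj.
  assert (H0 : 0 < Rmin 1 d) by (apply Rmin_pos; lra).
  pose proof (Rmin_l 1 d); pose proof (Rmin_r 1 d).
  apply Rle_trans with (Rmin 1 d ^ j).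
  - replace n with (j + (n - j))%nat by lia; rewrite pow_add.
    rewrite <- (Rmult_1_r (Rmin 1 d ^ j)) at 2.
    apply Rmult_le_compat_l; [apply pow_le; lra |].
    apply pow_le_one; lra.
  - apply pow_incr; lra.
Qed.

Definition whitney (m : nat) (w : R -> R) (C : R) (S : R -> Prop) (u : nat -> R -> R) : Prop :=
  forall a b k, S a -> S b -> (k <= m)%nat ->
    Rabs (u k b - taylor_chain m (fun i => u i a) a k b) <= C * w (Rabs (b - a)) * Rabs (b - a) ^ (m - k).

Lemma whitney_bounded (m : nat) (w : R -> R) (C : R) (S : R -> Prop) (u : nat -> R -> R) (p q : R) :
  modulus w -> 0 <= C -> (forall x, S x -> p <= x <= q) -> whitney m w C S u ->
  exists B, 0 <= B /\ forall k, (k <= m)%nat -> forall x, S x -> Rabs (u k x) <= B.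
Proof.
  intros Hw HC Hpq HW.
  destruct (classic (exists a, S a)) as [[a Sa] | Hn].
  2: { exists 0; split; [lra |]; intros k _ x Sx; exfalso; apply Hn; now exists x. }
  apply (fin_bound m (fun k B => forall x, S x -> Rabs (u k x) <= B)).
  - intros j B B' HB H x Sx; specialize (H x Sx); lra.
  - intros k Hk.
    destruct (fin_bound m (fun i A => Rabs (u i a) <= A)) as [A [HA0 HA]].
    { intros; lra. }
    { intros j _; exists (Rabs (u j a)); lra. }
    pose proof (Hpq a Sa).
    exists (C * w (q - p) * (q - p) ^ (m - k) + A * pol m (fun _ => 1) (q - p)); intros x Sx.
    specialize (HW a x k Sa Sx Hk); pose proof (Hpq x Sx).
    assert (Hax : Rabs (x - a) <= q - p) by (apply Rabs_le; lra).
    replace (u k x) with ((u k x - taylor_chain m (fun i => u i a) a k x) + taylor_chain m (fun i => u i a) a k x) by ring.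
    eapply Rle_trans; [apply Rabs_triang |]; apply Rplus_le_compat.
    + eapply Rle_trans; [exact HW |].
      apply Rmult_le_compat; [| apply pow_le, Rabs_pos | | apply pow_incr; split; [apply Rabs_pos | exact Hax]].
      * apply Rmult_le_pos; [exact HC | apply mod_nonneg; [exact Hw | apply Rabs_pos]].
      * apply Rmult_le_compat_l; [exact HC |]; apply (mod_mono w Hw); [apply Rabs_pos | exact Hax].
    + unfold taylor_chain; eapply Rle_trans; [apply pol_bound with (e := A); intros; apply HA; lia |].
      apply Rmult_le_compat_l; [exact HA0 |].
      apply pol_one_mono; [lia | split; [apply Rabs_pos | exact Hax]].
Qed.

(** A pair that is not contained in [S] has distance at least some [d > 0] or coincides. At such
    distances the right side is bounded below while the jets are bounded, so the jets on [l] can be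
    arbitrary. *)
Lemma whitney_add_points (m : nat) (w : R -> R) (C : R) (S : R -> Prop) (l : list R)
  (u : nat -> R -> R) (p q : R) :
  modulus w -> 0 <= C -> closed_set S ->
  (forall x, S x -> p <= x <= q) -> (forall x, In x l -> p <= x <= q) -> whitney m w C S u ->
  exists C', 0 <= C' /\ whitney m w C' (fun x => S x \/ In x l) u.
Proof.
  intros Hw HC HS Spq lpq HW.
  destruct (whitney_bounded m w C S u p q Hw HC Spq HW) as [B1 [HB1 Hb1]].
  destruct (fin_bound m (fun k B => forall x, In x l -> Rabs (u k x) <= B)) as [B2 [HB2 Hb2]].
  { intros j B B' HB H x Sx; specialize (H x Sx); lra. }
  { intros k _; destruct (list_bound (u k) l) as [B [_ HB]]; now exists B. }
  destruct (separated_union S l HS) as [d [Hd Hsep]].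
  set (B := B1 + B2).
  assert (HB : forall k x, (k <= m)%nat -> S x \/ In x l -> Rabs (u k x) <= B).
  { intros k x Hk [h | h]; [specialize (Hb1 k Hk x h) | specialize (Hb2 k Hk x h)]; unfold B; lra. }
  set (P := pol m (fun _ => 1) (Rmax 0 (q - p))).
  assert (HP : 0 <= P) by (apply pol_pos, Rmax_l).
  (* A lower bound for [w L * L ^ (m - k)], uniform in [k <= m], when [L >= d]. *)
  set (c := w d * Rmin 1 d ^ m).
  assert (Hc : 0 < c).
  { apply Rmult_lt_0_compat; [now apply (mod_pos w Hw) | apply pow_lt, Rmin_pos; lra]. }
  assert (HBP : 0 <= B + B * P) by (unfold B; apply Rplus_le_le_0_compat; [lra | apply Rmult_le_pos; lra]).
  assert (Hq : 0 <= (B + B * P) / c) by (apply Rdiv_le_0_compat; assumption).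
  exists (C + (B + B * P) / c); split; [lra |].
  intros a b k Ha Hb Hk.
  assert (Hpos : 0 <= w (Rabs (b - a)) * Rabs (b - a) ^ (m - k)).
  { apply Rmult_le_pos; [apply mod_nonneg; [exact Hw | apply Rabs_pos] | apply pow_le, Rabs_pos]. }
  rewrite Rmult_assoc, Rmult_plus_distr_r.
  destruct (Req_dec a b) as [<- | ne].
  { rewrite taylor_chain_at, (Rminus_diag (u k a)), Rabs_R0.
    apply Rplus_le_le_0_compat; apply Rmult_le_pos; assumption. }
  destruct (classic (S a /\ S b)) as [[Sa Sb] | Hn].
  { specialize (HW a b k Sa Sb Hk); rewrite Rmult_assoc in HW.
    pose proof (Rmult_le_pos _ _ Hq Hpos); lra. }
  specialize (Hsep a b Ha Hb ne Hn); rewrite Rabs_minus_sym in Hsep.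
  assert (Hlow : c <= w (Rabs (b - a)) * Rabs (b - a) ^ (m - k)).
  { apply Rmult_le_compat; [apply mod_nonneg; [exact Hw | lra] | apply pow_le, Rlt_le, Rmin_pos; lra | |].
    - apply (mod_mono w Hw); lra.
    - apply pow_lower; [exact Hd | exact Hsep | lia]. }
  assert (Hup : Rabs (u k b - taylor_chain m (fun i => u i a) a k b) <= B + B * P).
  { eapply Rle_trans; [apply Rabs_triang |]; rewrite Rabs_Ropp; apply Rplus_le_compat; [now apply HB |].
    unfold taylor_chain; eapply Rle_trans; [apply pol_bound with (e := B); intros; apply HB; [lia | exact Ha] |].
    apply Rmult_le_compat_l; [unfold B; lra |].
    apply pol_one_mono; [lia | split; [apply Rabs_pos |]].
    eapply Rle_trans; [| apply Rmax_r].
    assert (Hin : forall x, S x \/ In x l -> p <= x <= q) by (intros x [h | h]; [now apply Spq | now apply lpq]).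
    pose proof (Hin a Ha); pose proof (Hin b Hb); apply Rabs_le; lra. }
  apply Rle_trans with ((B + B * P) / c * c); [replace ((B + B * P) / c * c) with (B + B * P) by (field; lra); exact Hup |].
  apply Rle_trans with ((B + B * P) / c * (w (Rabs (b - a)) * Rabs (b - a) ^ (m - k))).
  - apply Rmult_le_compat_l; assumption.
  - pose proof (Rmult_le_pos _ _ HC Hpos); lra.
Qed.

(** The half lines, on which all data vanish, turn a bounded set into one that is unbounded on both
    sides, as gluing requires; with [p] and [q] in [S], all gaps have their ends in [S]. *)
Definition outer (p q : R) (S : R -> Prop) (x : R) : Prop := x <= p \/ q <= x \/ S x.

Lemma outer_closed (p q : R) (S : R -> Prop) : closed_set S -> closed_set (outer p q S).
Proof.
  intros HS; apply closed_of_nbhd; intros x Hx; unfold outer in *.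
  destruct (closed_nbhd S x HS) as [d [Hd H]]; [tauto |].
  assert (p < x < q) by (split; apply Rnot_le_lt; tauto).
  exists (Rmin d (Rmin (x - p) (q - x))); split; [repeat apply Rmin_pos; lra |].
  intros y Hy.
  pose proof (Rmin_l d (Rmin (x - p) (q - x))); pose proof (Rmin_r d (Rmin (x - p) (q - x))).
  pose proof (Rmin_l (x - p) (q - x)); pose proof (Rmin_r (x - p) (q - x)).
  intros [h | [h | h]].
  - apply Rabs_def2 in Hy; lra.
  - apply Rabs_def2 in Hy; lra.
  - apply (H y); [lra | exact h].
Qed.

Lemma outer_below (p q : R) (S : R -> Prop) (x : R) : exists y, outer p q S y /\ y <= x.
Proof. exists (Rmin p x); split; [left; apply Rmin_l | apply Rmin_r]. Qed.

Lemma outer_above (p q : R) (S : R -> Prop) (x : R) : exists y, outer p q S y /\ x <= y.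
Proof. exists (Rmax q x); split; [right; left; apply Rmax_l | apply Rmax_r]. Qed.

Lemma outer_gap (p q a b : R) (S : R -> Prop) :
  S p -> S q -> gap (outer p q S) a b -> S a /\ S b /\ p <= a /\ a < b /\ b <= q.
Proof.
  intros Sp Sq [Ha [Hb [Hab Hn]]].
  assert (Hpa : p <= a).
  { apply Rnot_lt_le; intros h.
    assert (a < Rmin p b) by (now apply Rmin_glb_lt).
    pose proof (Rmin_l p b); pose proof (Rmin_r p b).
    apply (Hn ((a + Rmin p b) / 2)); [lra | left; lra]. }
  assert (Hbq : b <= q).
  { apply Rnot_lt_le; intros h.
    assert (Rmax a q < b) by (now apply Rmax_lub_lt).
    pose proof (Rmax_l a q); pose proof (Rmax_r a q).
    apply (Hn ((b + Rmax a q) / 2)); [lra | right; left; lra]. }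
  repeat split; try assumption.
  - destruct Ha as [h | [h | h]]; [replace a with p by lra; exact Sp | lra | exact h].
  - destruct Hb as [h | [h | h]]; [lra | replace b with q by lra; exact Sq | exact h].
Qed.

Definition clamp (p q x : R) : R := Rmax p (Rmin q x).

Lemma clamp_mono (p q x y : R) : x <= y -> 0 <= clamp p q y - clamp p q x <= y - x.
Proof.
  intros Hxy; unfold clamp, Rmax, Rmin; destruct (Rle_dec q x), (Rle_dec q y);
    repeat (match goal with |- context [Rle_dec ?s ?t] => destruct (Rle_dec s t) end); lra.
Qed.

(** Data that are constant on the half lines factor through the projection to [[p, q]]. As the
    projection does not increase distances, estimates on [S] pass to the outer set. *)
Lemma outer_clamp (A : Type) (D : R -> A) (p q : R) (S : R -> Prop) :
  p < q -> S p -> S q -> (forall x, x <= p -> D x = D p) -> (forall x, q <= x -> D x = D q) ->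
  forall x, outer p q S x -> S (clamp p q x) /\ D (clamp p q x) = D x.
Proof.
  intros Hpq Sp Sq Dp Dq x Hx; unfold outer, clamp in *.
  destruct (Rle_dec x p) as [h1 | h1]; [| destruct (Rle_dec q x) as [h2 | h2]].
  - rewrite Rmin_right, Rmax_left, (Dp x h1) by lra; tauto.
  - rewrite Rmin_left, Rmax_right, (Dq x h2) by lra; tauto.
  - rewrite Rmin_right, Rmax_right by lra; tauto.
Qed.

Lemma whitney_extension (m : nat) (w : R -> R) (C : R) (S : R -> Prop) (u : nat -> R -> R) (p q : R) :
  modulus w -> 0 <= C -> closed_set S -> p < q ->
  (forall x, S x -> p <= x <= q) -> S p -> S q ->
  (forall k x, x <= p \/ q <= x -> u k x = 0) -> whitney m w C S u ->
  exists (F : nat -> R -> R) (C' : R), 0 <= C' /\ chain m F /\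
    (forall k x, (k <= m)%nat -> outer p q S x -> F k x = u k x) /\
    (forall x y, Rabs (F m x - F m y) <= C' * w (Rabs (x - y))).
Proof.
  intros Hw HC HS Hpq Spq Sp Sq Hu0 HW.
  destruct (hermite_fill m) as [Ch [HCh Hfill]].
  set (O := outer p q S).
  destruct (choice (fun (ab : R * R) v => gap O (fst ab) (snd ab) ->
     chain m v /\
     (forall k, (k <= m)%nat -> v k (fst ab) = u k (fst ab) /\ v k (snd ab) = u k (snd ab)) /\
     (forall x y, fst ab <= x <= snd ab -> fst ab <= y <= snd ab ->
        Rabs (v m x - v m y) <= Ch * C * w (Rabs (x - y))))) as [v Hv].
  { intros [a b]; simpl; destruct (classic (gap O a b)) as [Hg | Hg].
    2: { exists (fun _ _ => 0); tauto. }
    destruct (outer_gap p q a b S Sp Sq Hg) as [Sa [Sb [_ [Hab _]]]].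
    destruct (Hfill w a b C (fun i => u i a) (fun i => u i b) Hw Hab HC) as [v Hv].
    - intros k Hk; specialize (HW a b k Sa Sb Hk); rewrite (Rabs_pos_eq (b - a)) in HW by lra; exact HW.
    - exists v; intros _; exact Hv. }
  assert (Hcl : forall x, O x -> S (clamp p q x) /\ u m (clamp p q x) = u m x).
  { apply outer_clamp; try assumption; intros x Hx; rewrite !Hu0; auto; lra. }
  (* One constant for both uses: [Ch * C] for the fillings of gaps and [C] for the jets on [S]. *)
  assert (HB : 0 <= (Ch + 1) * C) by (apply Rmult_le_pos; lra).
  destruct (glue_chain m O w ((Ch + 1) * C) p u (fun a b => v (a, b))) as [F [F1 [F2 [_ F4]]]]; try assumption.
  - now apply outer_closed.
  - apply outer_below.
  - apply outer_above.
  - left; lra.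
  - intros k; apply Hu0; left; lra.
  - intros k Hk a Oa eps Heps.
    destruct (Rlt_dec a p) as [h1 | h1].
    { exists (p - a); split; [lra |]; intros b _ Hb; apply Rabs_def2 in Hb.
      rewrite !Hu0 by (left; lra).
      replace (0 - 0 - 0 * (b - a)) with 0 by ring; rewrite Rabs_R0.
      apply Rmult_le_pos; [lra | apply Rabs_pos]. }
    destruct (Rlt_dec q a) as [h2 | h2].
    { exists (a - q); split; [lra |]; intros b _ Hb; apply Rabs_def2 in Hb.
      rewrite !Hu0 by (right; lra).
      replace (0 - 0 - 0 * (b - a)) with 0 by ring; rewrite Rabs_R0.
      apply Rmult_le_pos; [lra | apply Rabs_pos]. }
    assert (Sa : S a).
    { destruct Oa as [h | [h | h]]; [replace a with p by lra | replace a with q by lra |]; assumption. }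
    (* A nearby point beyond an end of [[p, q]] occurs only when [a] is that end, where the jet is
       zero and the estimate trivial. *)
    assert (Hend : exists e, 0 < e /\ forall b, Rabs (b - a) < e ->
      (b < p -> a = p) /\ (q < b -> a = q)).
    { destruct (Req_dec a p) as [-> | np]; [exists (q - p) |]; [| destruct (Req_dec a q) as [-> | nq]; [exists (q - p) |]].
      - split; [lra |]; intros b Hb; apply Rabs_def2 in Hb; split; lra.
      - split; [lra |]; intros b Hb; apply Rabs_def2 in Hb; split; lra.
      - exists (Rmin (a - p) (q - a)); split; [apply Rmin_pos; lra |].
        intros b Hb; pose proof (Rmin_l (a - p) (q - a)); pose proof (Rmin_r (a - p) (q - a)).
        apply Rabs_def2 in Hb; split; lra. }
    destruct Hend as [e [He Hend]].
    pose proof (taylor_chain_chain m (fun i => u i a) a k Hk a) as HT.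
    rewrite taylor_chain_at in HT.
    destruct (is_derive_eps_inv _ _ _ HT (eps / 2)) as [d1 [Hd1 H1]]; [lra |].
    destruct (mod_lim w Hw (eps / 2 / (C + 1))) as [d2 [Hd2 H2]].
    { apply Rdiv_lt_0_compat; lra. }
    exists (Rmin (Rmin e 1) (Rmin d1 d2)); split; [repeat apply Rmin_pos; lra |].
    intros b Ob Hb.
    pose proof (Rmin_l (Rmin e 1) (Rmin d1 d2)); pose proof (Rmin_r (Rmin e 1) (Rmin d1 d2)).
    pose proof (Rmin_l e 1); pose proof (Rmin_r e 1); pose proof (Rmin_l d1 d2); pose proof (Rmin_r d1 d2).
    destruct (Hend b) as [E1 E2]; [lra |].
    destruct (Rlt_dec b p) as [k1 | k1].
    { rewrite (E1 k1), !Hu0 by (left; lra).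
      replace (0 - 0 - 0 * (b - p)) with 0 by ring; rewrite Rabs_R0.
      apply Rmult_le_pos; [lra | apply Rabs_pos]. }
    destruct (Rlt_dec q b) as [k2 | k2].
    { rewrite (E2 k2), !Hu0 by (right; lra).
      replace (0 - 0 - 0 * (b - q)) with 0 by ring; rewrite Rabs_R0.
      apply Rmult_le_pos; [lra | apply Rabs_pos]. }
    assert (Sb : S b).
    { destruct Ob as [h | [h | h]]; [replace b with p by lra | replace b with q by lra |]; assumption. }
    specialize (H1 b ltac:(lra)); rewrite taylor_chain_at in H1.
    specialize (H2 _ (Rabs_pos (b - a)) ltac:(lra)).
    specialize (HW a b k Sa Sb ltac:(lia)).
    replace (u k b - u k a - u (Datatypes.S k) a * (b - a)) with
      ((u k b - taylor_chain m (fun i => u i a) a k b)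
       + (taylor_chain m (fun i => u i a) a k b - u k a - u (Datatypes.S k) a * (b - a))) by ring.
    eapply Rle_trans; [apply Rabs_triang |].
    assert (Hrem : C * w (Rabs (b - a)) * Rabs (b - a) ^ (m - k) <= eps / 2 * Rabs (b - a)).
    { pose proof (Rabs_pos (b - a)).
      assert (Hcw : C * w (Rabs (b - a)) <= eps / 2).
      { apply Rmult_lt_compat_r with (r := C + 1) in H2; [| lra].
        replace (eps / 2 / (C + 1) * (C + 1)) with (eps / 2) in H2 by (field; lra).
        pose proof (mod_nonneg w (Rabs (b - a)) Hw ltac:(lra)); lra. }
      replace (m - k)%nat with (Datatypes.S (m - Datatypes.S k)) by lia.
      apply Rmult_le_compat; [| apply pow_le; lra | exact Hcw |].
      - apply Rmult_le_pos; [exact HC | apply mod_nonneg; [exact Hw | lra]].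
      - simpl; apply Rle_trans with (Rabs (b - a) * 1); [| lra].
        apply Rmult_le_compat_l; [lra |]; apply pow_le_one; lra. }
    lra.
  - intros a b Oa Ob.
    destruct (Hcl a Oa) as [Sa <-]; destruct (Hcl b Ob) as [Sb <-].
    pose proof (HW _ _ m Sa Sb (le_n m)) as H; rewrite taylor_chain_top, Nat.sub_diag in H.
    eapply Rle_trans; [exact H |]; simpl; rewrite Rmult_1_r.
    assert (Hlip : Rabs (clamp p q b - clamp p q a) <= Rabs (b - a)).
    { destruct (Rle_dec a b) as [hab | hab].
      - pose proof (clamp_mono p q a b hab); rewrite !Rabs_pos_eq; lra.
      - pose proof (clamp_mono p q b a ltac:(lra)); rewrite !Rabs_left1; lra. }
    pose proof (mod_mono w Hw _ _ (Rabs_pos _) Hlip).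
    pose proof (mod_nonneg w _ Hw (Rabs_pos (clamp p q b - clamp p q a))).
    apply Rmult_le_compat; [exact HC | assumption | | assumption].
    pose proof (Rmult_le_pos _ _ HCh HC); lra.
  - intros a b Hg; destruct (Hv (a, b) Hg) as [v1 [v2 v3]]; split; [exact v1 | split; [exact v2 |]].
    intros x y Hx Hy; eapply Rle_trans; [now apply v3 |].
    apply Rmult_le_compat_r; [apply mod_nonneg; [exact Hw | apply Rabs_pos] | simpl; lra].
  - exists F, (3 * ((Ch + 1) * C)); split; [lra |]; split; [exact F1 | split; [exact F2 | exact F4]].
Qed.

(** * The lifting defect *)

Lemma Rabs_le_sum (x y B1 B2 : R) : Rabs x <= B1 -> Rabs y <= B2 -> Rabs (x + y) <= B1 + B2.
Proof. intros; eapply Rle_trans; [apply Rabs_triang | lra]. Qed.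

Lemma Rabs_le_prod (x y B1 B2 : R) : Rabs x <= B1 -> Rabs y <= B2 -> Rabs (x * y) <= B1 * B2.
Proof. intros; rewrite Rabs_mult; apply Rmult_le_compat; auto using Rabs_pos. Qed.

(* The boundary terms of [A] are exactly what makes every term of the derivative below
   contain a factor of size [rho * L]. *)
Lemma area_comparison (f g T S f1 g1 T1 S1 : R -> R) (a b rho Mf Mg : R) :
  a < b ->
  (forall x, is_derive f x (f1 x)) -> (forall x, is_derive g x (g1 x)) ->
  (forall x, is_derive T x (T1 x)) -> (forall x, is_derive S x (S1 x)) ->
  (forall x, continuous f1 x) -> (forall x, continuous g1 x) ->
  (forall x, continuous T1 x) -> (forall x, continuous S1 x) ->
  f a = T a -> g a = S a ->
  (forall x, a <= x <= b -> Rabs (f x - T x) <= rho * (b - a)) ->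
  (forall x, a <= x <= b -> Rabs (g x - S x) <= rho * (b - a)) ->
  (forall x, a <= x <= b -> Rabs (f1 x - T1 x) <= rho) ->
  (forall x, a <= x <= b -> Rabs (g1 x - S1 x) <= rho) ->
  (forall x, a <= x <= b -> Rabs (f1 x) <= Mf) -> (forall x, a <= x <= b -> Rabs (g1 x) <= Mg) ->
  Rabs (2 * RInt (fun x => T1 x * S x - S1 x * T x) a b - 2 * RInt (fun x => f1 x * g x - g1 x * f x) a b
        - 2 * T a * (g b - S b) + 2 * S a * (f b - T b))
    <= 4 * rho * (b - a) ^ 2 * (Mf + Mg + 3 * rho).
Proof.
  intros Hab Df Dg DT DS Cf1 Cg1 CT1 CS1 Efa Ega Hr Hs Hr1 Hs1 HMf HMg.
  set (L := b - a) in *; assert (HL : 0 < L) by (unfold L; lra).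
  assert (Hc : forall u v : R -> R, (forall x, is_derive u x (v x)) -> forall x, continuous u x).
  { intros u v H x; now apply (is_derive_continuous u x (v x)). }
  assert (C1 : forall x, continuous (fun x => T1 x * S x - S1 x * T x) x).
  { intros x; apply continuous_minus_R; apply continuous_mult_R; eauto. }
  assert (C2 : forall x, continuous (fun x => f1 x * g x - g1 x * f x) x).
  { intros x; apply continuous_minus_R; apply continuous_mult_R; eauto. }
  assert (HT1 : forall x, a <= x <= b -> Rabs (T1 x) <= Mf + rho).
  { intros x Hx; replace (T1 x) with (f1 x + - (f1 x - T1 x)) by ring.
    apply Rabs_le_sum; [now apply HMf | rewrite Rabs_Ropp; now apply Hr1]. }
  assert (HS1 : forall x, a <= x <= b -> Rabs (S1 x) <= Mg + rho).
  { intros x Hx; replace (S1 x) with (g1 x + - (g1 x - S1 x)) by ring.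
    apply Rabs_le_sum; [now apply HMg | rewrite Rabs_Ropp; now apply Hs1]. }
  assert (Inc : forall (u v : R -> R) B, (forall x, is_derive u x (v x)) -> (forall x, a <= x <= b -> Rabs (v x) <= B) ->
    forall x, a <= x <= b -> Rabs (u x - u a) <= B * L).
  { intros u v B Hu Hv x Hx.
    eapply Rle_trans; [apply (mvt_abs u v a b B a x Hu Hv); lra |].
    assert (0 <= B) by (eapply Rle_trans; [apply Rabs_pos | apply (Hv a); lra]).
    apply Rmult_le_compat_l; [assumption |]; apply Rabs_le; unfold L; lra. }
  pose proof (Inc T T1 _ DT HT1) as HTa; pose proof (Inc S S1 _ DS HS1) as HSa.
  set (W := fun x => 2 * RInt (fun x => T1 x * S x - S1 x * T x) a x
     - 2 * RInt (fun x => f1 x * g x - g1 x * f x) a x - 2 * T a * (g x - S x) + 2 * S a * (f x - T x)).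
  (* In the last two products the boundary terms have replaced [T] and [S] by their increments from
     [a], which supply the missing factor [L]. *)
  set (W' := fun x => 2 * (S1 x * (f x - T x) + - (T1 x * (g x - S x))
     + ((g1 x - S1 x) * (f x - T x) + - ((f1 x - T1 x) * (g x - S x)))
     + ((g1 x - S1 x) * (T x - T a) + - ((f1 x - T1 x) * (S x - S a))))).
  assert (DW : forall x, is_derive W x (W' x)).
  { intros x; unfold W.
    apply is_derive_ext_val with (2 * (T1 x * S x - S1 x * T x) - 2 * (f1 x * g x - g1 x * f x)
      - 2 * T a * (g1 x - S1 x) + 2 * S a * (f1 x - T1 x)); [unfold W'; ring |].
    apply is_derive_plus_R; [apply is_derive_minus_R; [apply is_derive_minus_R |] |]; apply is_derive_scal_R.
    - now apply (is_derive_prim (fun x => T1 x * S x - S1 x * T x)).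
    - now apply (is_derive_prim (fun x => f1 x * g x - g1 x * f x)).
    - now apply is_derive_minus_R.
    - now apply is_derive_minus_R. }
  assert (HW' : forall x, a <= x <= b -> Rabs (W' x) <= 4 * rho * L * (Mf + Mg + 3 * rho)).
  { intros x Hx; unfold W'; rewrite Rabs_mult, (Rabs_pos_eq 2) by lra.
    apply Rle_trans with (2 * ((Mg + rho) * (rho * L) + (Mf + rho) * (rho * L)
      + (rho * (rho * L) + rho * (rho * L)) + (rho * ((Mf + rho) * L) + rho * ((Mg + rho) * L)))).
    - apply Rmult_le_compat_l; [lra |].
      repeat apply Rabs_le_sum; try rewrite Rabs_Ropp; apply Rabs_le_prod; auto.
    - right; ring. }
  pose proof (mvt_abs W W' a b _ a b DW HW' ltac:(lra) ltac:(lra)) as HWb.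
  assert (EWa : W a = 0).
  { unfold W; rewrite !RInt_point, Efa, Ega; unfold zero; simpl; ring. }
  rewrite EWa, Rminus_0_r in HWb.
  rewrite (Rabs_pos_eq (b - a)) in HWb by lra.
  eapply Rle_trans; [exact HWb |]; right; unfold L; ring.
Qed.

Lemma taylor_eq (m : nat) (phi : R -> R) (a x : R) :
  taylor m phi a x = taylor_chain m (fun k => Derive_n phi k a) a 0 x.
Proof. unfold taylor, taylor_chain, pol; now rewrite Nat.sub_0_r. Qed.

Lemma taylor_derive (m : nat) (phi : R -> R) (a x : R) : (0 < m)%nat ->
  Derive (taylor m phi a) x = taylor_chain m (fun k => Derive_n phi k a) a 1 x.
Proof.
  intros Hm; apply is_derive_unique.
  apply (is_derive_ext (taylor_chain m (fun k => Derive_n phi k a) a 0)); [intros; symmetry; apply taylor_eq |].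
  now apply taylor_chain_chain.
Qed.

(** [D] stands for the prescribed third coordinate minus the lift. The last two factors are [V] with
    the integral replaced by bounds for the derivatives; quantifying over all bounds avoids naming
    suprema. *)
Definition defect_le (m : nat) (w : R -> R) (C : R) (S : R -> Prop) (f1 g1 D : R -> R) : Prop :=
  forall a b Mf Mg, S a -> S b -> a < b ->
    (forall x, a <= x <= b -> Rabs (f1 x) <= Mf) -> (forall x, a <= x <= b -> Rabs (g1 x) <= Mg) ->
    Rabs (D b - D a) <= C * w (b - a) * (b - a) ^ m * ((b - a) ^ m + (b - a) * Mf + (b - a) * Mg).

(** The curve [G] and the pair [(f, g)] agree at both ends and have nearly equal jets at [a]. So the
    Taylor polynomials in [A] and [V] also approximate [f] and [g], and [area_comparison] exchanges
    the polynomial area for that of [(f, g)]. *)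
Lemma defect_pair (m : nat) (w : R -> R) (M Om c : R) :
  (0 < m)%nat -> modulus w -> 0 < M -> 0 <= Om -> 0 <= c ->
  exists Cd, 0 <= Cd /\
  forall (G : curve) (f g : nat -> R -> R) (a b Mf Mg : R),
    a < b -> w (b - a) <= Om -> chain m f -> chain m g ->
    (forall x y, Rabs (f m x - f m y) <= c * w (Rabs (x - y))) ->
    (forall x y, Rabs (g m x - g m y) <= c * w (Rabs (x - y))) ->
    (forall k, (k <= m)%nat -> Rabs (f k a - Derive_n (cf G) k a) <= w (b - a) * (b - a) ^ (m - k)) ->
    (forall k, (k <= m)%nat -> Rabs (g k a - Derive_n (cg G) k a) <= w (b - a) * (b - a) ^ (m - k)) ->
    f 0%nat a = cf G a -> f 0%nat b = cf G b -> g 0%nat a = cg G a -> g 0%nat b = cg G b ->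
    Rabs (A_fun m G a b / V_fun m G a b) <= M * w (b - a) ->
    (forall x, a <= x <= b -> Rabs (f 1%nat x) <= Mf) -> (forall x, a <= x <= b -> Rabs (g 1%nat x) <= Mg) ->
    Rabs (ch G b - ch G a - 2 * RInt (fun x => f 1%nat x * g 0%nat x - g 1%nat x * f 0%nat x) a b)
      <= Cd * w (b - a) * (b - a) ^ m * ((b - a) ^ m + (b - a) * Mf + (b - a) * Mg).
Proof.
  intros Hm Hw HM HOm Hc.
  set (c1 := (INR m + 1) * (1 + c)).
  assert (Hc1 : 0 <= c1) by (pose proof (pos_INR m); apply Rmult_le_pos; lra).
  exists (M * (1 + 2 * c1 * Om) + 4 * c1 + 12 * (c1 * c1 * Om)).
  assert (Hco : 0 <= c1 * Om) by (apply Rmult_le_pos; assumption).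
  assert (Hcco : 0 <= c1 * c1 * Om) by (rewrite Rmult_assoc; apply Rmult_le_pos; assumption).
  split.
  { assert (0 <= M * (1 + 2 * c1 * Om)) by (apply Rmult_le_pos; lra); lra. }
  intros G f g a b Mf Mg Hab HwOm Cf Cg Of Og Jf Jg Efa Efb Ega Egb HAV HMf HMg.
  set (L := b - a) in *; assert (HL : 0 < L) by (unfold L; lra).
  assert (Hw0 : 0 < w L) by now apply (mod_pos w Hw).
  set (cT := fun k => Derive_n (cf G) k a) in *; set (cS := fun k => Derive_n (cg G) k a) in *.
  (* The size of the first-order Taylor remainder; [rho * L] is that of the remainder itself. *)
  set (rho := c1 * w L * L ^ (m - 1)).
  assert (Hrho : 0 <= rho).
  { apply Rmult_le_pos; [apply Rmult_le_pos; lra | apply pow_le; lra]. }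
  assert (Rem : forall (F : nat -> R -> R) (cc : nat -> R), chain m F ->
    (forall x y, Rabs (F m x - F m y) <= c * w (Rabs (x - y))) ->
    (forall k, (k <= m)%nat -> Rabs (F k a - cc k) <= w L * L ^ (m - k)) ->
    forall k, (k <= m)%nat -> forall x, a <= x <= b ->
      Rabs (F k x - taylor_chain m cc a k x) <= c1 * w L * L ^ (m - k)).
  { intros F cc CF OF JF k Hk x Hx.
    replace (c1 * w L * L ^ (m - k)) with ((INR m + 1) * ((1 + c) * w L) * (b - a) ^ (m - k)) by (unfold c1, L; ring).
    apply (chain_bound m (fun k x => F k x - taylor_chain m cc a k x) a b); try assumption; try lra.
    - apply chain_minus; [exact CF | apply taylor_chain_chain].
    - apply Rmult_le_pos; lra.
    - intros j Hj; exists a; split; [lra |]; rewrite taylor_chain_at.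
      eapply Rle_trans; [apply JF; lia |]; fold L.
      apply Rmult_le_compat_r; [apply pow_le; lra |].
      pose proof (Rmult_le_pos c (w L) Hc ltac:(lra)); lra.
    - intros y Hy; rewrite taylor_chain_top.
      replace (F m y - cc m) with ((F m y - F m a) + (F m a - cc m)) by ring.
      replace ((1 + c) * w L) with (c * w L + w L) by ring.
      apply Rabs_le_sum.
      + eapply Rle_trans; [apply OF |]; apply Rmult_le_compat_l; [exact Hc |].
        apply (mod_mono w Hw); [apply Rabs_pos | apply Rabs_le; unfold L; lra].
      + specialize (JF m (le_n m)); rewrite Nat.sub_diag in JF; simpl in JF; lra. }
  pose proof (Rem f cT Cf Of Jf) as Rf; pose proof (Rem g cS Cg Og Jg) as Rg.
  assert (HrL : forall r, Rabs r <= c1 * w L * L ^ (m - 0) -> Rabs r <= rho * L).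
  { intros r Hr; eapply Rle_trans; [exact Hr |]; right; unfold rho.
    replace (m - 0)%nat with (Datatypes.S (m - 1)) by lia; simpl; ring. }
  pose proof (area_comparison (f 0%nat) (g 0%nat) (taylor_chain m cT a 0) (taylor_chain m cS a 0)
    (f 1%nat) (g 1%nat) (taylor_chain m cT a 1) (taylor_chain m cS a 1) a b rho Mf Mg Hab) as HC.
  assert (HC' := HC (fun x => Cf 0%nat Hm x) (fun x => Cg 0%nat Hm x)
    (fun x => taylor_chain_chain m cT a 0%nat Hm x) (fun x => taylor_chain_chain m cS a 0%nat Hm x)
    (chain_continuous m w c f Hw Hc Cf Of 1%nat Hm) (chain_continuous m w c g Hw Hc Cg Og 1%nat Hm)
    (taylor_chain_continuous m cT a 1%nat) (taylor_chain_continuous m cS a 1%nat)); clear HC.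
  rewrite !taylor_chain_at in HC'.
  specialize (HC' Efa Ega).
  specialize (HC' (fun x Hx => HrL _ (Rf 0%nat (Nat.le_0_l m) x Hx))).
  specialize (HC' (fun x Hx => HrL _ (Rg 0%nat (Nat.le_0_l m) x Hx))).
  specialize (HC' (fun x Hx => Rf 1%nat Hm x Hx)).
  specialize (HC' (fun x Hx => Rg 1%nat Hm x Hx)).
  specialize (HC' HMf HMg).
  set (P := RInt (fun x => f 1%nat x * g 0%nat x - g 1%nat x * f 0%nat x) a b) in *.
  assert (EA : A_fun m G a b = ch G b - ch G a
     - 2 * RInt (fun x => taylor_chain m cT a 1 x * taylor_chain m cS a 0 x
                          - taylor_chain m cS a 1 x * taylor_chain m cT a 0 x) a b
     + 2 * cT 0%nat * (g 0%nat b - taylor_chain m cS a 0 b) - 2 * cS 0%nat * (f 0%nat b - taylor_chain m cT a 0 b)).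
  { unfold A_fun; rewrite Efb, Egb, !taylor_eq.
    rewrite (RInt_ext _ (fun x => taylor_chain m cT a 1 x * taylor_chain m cS a 0 x
                          - taylor_chain m cS a 1 x * taylor_chain m cT a 0 x)); [reflexivity |].
    intros x _; now rewrite !taylor_derive, !taylor_eq by assumption. }
  assert (HV : 0 < V_fun m G a b <= L ^ (2 * m) + L ^ m * (L * (Mf + Mg + 2 * rho))).
  { unfold V_fun; fold L.
    assert (Hp : 0 < L ^ (2 * m)) by now apply pow_lt.
    assert (Hpm : 0 < L ^ m) by now apply pow_lt.
    set (I := RInt _ a b).
    assert (EI : I = RInt (fun x => Rabs (taylor_chain m cT a 1 x) + Rabs (taylor_chain m cS a 1 x)) a b).
    { apply RInt_ext; intros x _; now rewrite !taylor_derive by assumption. }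
    assert (HI : forall x, continuous (fun x => Rabs (taylor_chain m cT a 1 x) + Rabs (taylor_chain m cS a 1 x)) x).
    { intros x; apply continuous_plus_R; apply (continuous_comp _ Rabs); try apply continuous_Rabs; apply taylor_chain_continuous. }
    assert (HI0 : 0 <= I).
    { rewrite EI; apply RInt_ge_0; [lra | now apply continuous_ex_RInt |].
      intros x _; apply Rplus_le_le_0_compat; apply Rabs_pos. }
    assert (HI1 : I <= L * (Mf + Mg + 2 * rho)).
    { rewrite EI; eapply Rle_trans; [apply Rle_abs |].
      apply abs_RInt_le_const; [lra | now apply continuous_ex_RInt |].
      intros x Hx.
      rewrite Rabs_pos_eq by (apply Rplus_le_le_0_compat; apply Rabs_pos).
      replace (Mf + Mg + 2 * rho) with ((Mf + rho) + (Mg + rho)) by ring.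
      apply Rplus_le_compat.
      - replace (taylor_chain m cT a 1 x) with (f 1%nat x + - (f 1%nat x - taylor_chain m cT a 1 x)) by ring.
        apply Rabs_le_sum; [now apply HMf | rewrite Rabs_Ropp; apply (Rf 1%nat Hm x Hx)].
      - replace (taylor_chain m cS a 1 x) with (g 1%nat x + - (g 1%nat x - taylor_chain m cS a 1 x)) by ring.
        apply Rabs_le_sum; [now apply HMg | rewrite Rabs_Ropp; apply (Rg 1%nat Hm x Hx)]. }
    split.
    - pose proof (Rmult_le_pos _ _ (Rlt_le _ _ Hpm) HI0); lra.
    - apply Rplus_le_compat_l, Rmult_le_compat_l; lra. }
  assert (HA : Rabs (A_fun m G a b) <= M * w L * (L ^ (2 * m) + L ^ m * (L * (Mf + Mg + 2 * rho)))).
  { unfold Rdiv in HAV; rewrite Rabs_mult, Rabs_inv, (Rabs_pos_eq (V_fun m G a b)) in HAV by lra.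
    apply Rmult_le_compat_r with (r := V_fun m G a b) in HAV; [| lra].
    rewrite Rmult_assoc, Rinv_l, Rmult_1_r in HAV by lra.
    eapply Rle_trans; [exact HAV |]; apply Rmult_le_compat_l; [apply Rmult_le_pos; lra | lra]. }
  assert (HMf0 : 0 <= Mf) by (eapply Rle_trans; [apply Rabs_pos | apply (HMf a); lra]).
  assert (HMg0 : 0 <= Mg) by (eapply Rle_trans; [apply Rabs_pos | apply (HMg a); lra]).
  match type of HC' with Rabs ?X <= _ =>
    replace (ch G b - ch G a - 2 * P) with (A_fun m G a b + X) by (rewrite EA; ring) end.
  eapply Rle_trans; [apply Rabs_le_sum; [exact HA | exact HC'] |].
  fold L.
  assert (EL : L ^ m = L * L ^ (m - 1)).
  { replace m with (Datatypes.S (m - 1)) at 1 by lia; reflexivity. }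
  assert (E2 : L ^ (2 * m) = L ^ m * L ^ m) by (rewrite <- pow_add; f_equal; lia).
  rewrite E2.
  assert (ErL : rho * L = c1 * w L * L ^ m) by (unfold rho; rewrite EL; ring).
  replace (4 * rho * L ^ 2 * (Mf + Mg + 3 * rho))
    with (4 * (rho * L) * (L * Mf + L * Mg) + 12 * (rho * L) * (rho * L)) by ring.
  replace (M * w L * (L ^ m * L ^ m + L ^ m * (L * (Mf + Mg + 2 * rho))))
    with (M * w L * L ^ m * (L ^ m + (L * Mf + L * Mg) + 2 * (rho * L))) by ring.
  rewrite ErL.
  set (N := L * Mf + L * Mg).
  assert (HN : 0 <= N) by (apply Rplus_le_le_0_compat; apply Rmult_le_pos; lra).
  set (q := L ^ m); assert (Hq : 0 < q) by now apply pow_lt.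
  replace (q + L * Mf + L * Mg) with (q + N) by (unfold N; ring).
  set (x := w L * q).
  assert (Hx : 0 <= x) by (apply Rmult_le_pos; lra).
  assert (HxO : x <= Om * q) by (apply Rmult_le_compat_r; lra).
  replace (M * w L * q * (q + N + 2 * (c1 * w L * q)) + (4 * (c1 * w L * q) * N + 12 * (c1 * w L * q) * (c1 * w L * q)))
    with (x * (M * (q + N) + 2 * M * c1 * x + 4 * c1 * N + 12 * (c1 * c1) * x)) by (unfold x; ring).
  replace ((M * (1 + 2 * c1 * Om) + 4 * c1 + 12 * (c1 * c1 * Om)) * w L * q * (q + N))
    with (x * ((M * (1 + 2 * c1 * Om) + 4 * c1 + 12 * (c1 * c1 * Om)) * (q + N))) by (unfold x; ring).
  apply Rmult_le_compat_l; [exact Hx |].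
  (* The terms quadratic in [w L] are reduced to linear ones by bounding one factor by [Om]. *)
  assert (I1 : 2 * M * c1 * x <= 2 * M * c1 * Om * (q + N)).
  { apply Rle_trans with (2 * M * c1 * (Om * (q + N))); [| right; ring].
    apply Rmult_le_compat_l; [apply Rmult_le_pos; lra |].
    eapply Rle_trans; [exact HxO |]; apply Rmult_le_compat_l; lra. }
  assert (I2 : 12 * (c1 * c1) * x <= 12 * (c1 * c1) * Om * (q + N)).
  { apply Rle_trans with (12 * (c1 * c1) * (Om * (q + N))); [| right; ring].
    apply Rmult_le_compat_l; [pose proof (Rmult_le_pos _ _ Hc1 Hc1); lra |].
    eapply Rle_trans; [exact HxO |]; apply Rmult_le_compat_l; lra. }
  assert (I3 : 4 * c1 * N <= 4 * c1 * (q + N)) by (apply Rmult_le_compat_l; lra).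
  lra.
Qed.

(** As in [whitney_add_points]: [D] is bounded on [S] by the estimate from one base point, and the
    right side is bounded below for pairs that are not contained in [S]. *)
Lemma defect_add_points (m : nat) (w : R -> R) (C : R) (S : R -> Prop) (l : list R)
  (f1 g1 D : R -> R) (p q : R) :
  modulus w -> 0 <= C -> closed_set S -> p < q ->
  (forall x, S x -> p <= x <= q) -> (forall x, In x l -> p <= x <= q) ->
  (forall x, continuous f1 x) -> (forall x, continuous g1 x) ->
  defect_le m w C S f1 g1 D ->
  exists C', 0 <= C' /\ defect_le m w C' (fun x => S x \/ In x l) f1 g1 D.
Proof.
  intros Hw HC HS Hpq Spq lpq Cf Cg HD.
  destruct (continuous_bounded f1 p q ltac:(lra) Cf) as [Bf [HBf0 HBf]].
  destruct (continuous_bounded g1 p q ltac:(lra) Cg) as [Bg [HBg0 HBg]].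
  assert (HB1 : exists B1, 0 <= B1 /\ forall x, S x -> Rabs (D x) <= B1).
  { destruct (classic (exists a, S a)) as [[a Sa] | Hn].
    2: { exists 0; split; [lra |]; intros x Sx; exfalso; apply Hn; now exists x. }
    set (L := q - p).
    set (B := C * w L * L ^ m * (L ^ m + L * Bf + L * Bg)).
    assert (HB : forall x y, S x -> S y -> x < y -> Rabs (D y - D x) <= B).
    { intros x y Sx Sy Hxy; pose proof (Spq x Sx); pose proof (Spq y Sy).
      eapply Rle_trans; [apply (HD x y Bf Bg Sx Sy Hxy); intros; [apply HBf | apply HBg]; lra |].
      assert (H1 : 0 <= y - x <= L) by (unfold L; lra).
      assert (H2 : (y - x) ^ m <= L ^ m) by (apply pow_incr; lra).
      assert (H3 : 0 <= (y - x) ^ m) by (apply pow_le; lra).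
      pose proof (mod_nonneg w (y - x) Hw ltac:(lra)).
      unfold B; repeat apply Rmult_le_compat; repeat apply Rplus_le_le_0_compat; repeat apply Rmult_le_pos;
        try assumption; try lra.
      - apply (mod_mono w Hw); lra.
      - repeat apply Rplus_le_compat; try apply Rmult_le_compat_r; lra. }
    assert (HB0 : 0 <= B).
    { unfold B; repeat apply Rmult_le_pos; repeat apply Rplus_le_le_0_compat; repeat apply Rmult_le_pos; try assumption;
        try apply pow_le; try (apply mod_nonneg; [exact Hw |]); unfold L; lra. }
    exists (Rabs (D a) + B); split; [pose proof (Rabs_pos (D a)); lra |]; intros x Sx.
    replace (D x) with (D a + (D x - D a)) by ring; apply Rabs_le_sum; [lra |].
    destruct (Rtotal_order a x) as [h | [<- | h]].
    - now apply HB.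
    - rewrite Rminus_diag, Rabs_R0; exact HB0.
    - rewrite Rabs_minus_sym; now apply HB. }
  destruct HB1 as [B1 [HB1 Hb1]].
  destruct (list_bound D l) as [B2 [HB2 Hb2]].
  destruct (separated_union S l HS) as [d [Hd Hsep]].
  set (e := Rmin 1 d ^ m).
  assert (He : 0 < e) by (apply pow_lt, Rmin_pos; lra).
  assert (Hwd : 0 < w d) by now apply (mod_pos w Hw).
  (* Lower bounds for [w L], for [L ^ m] and for the bracket, which is at least [L ^ m]. *)
  set (c := w d * e * e).
  assert (Hc : 0 < c) by (unfold c; repeat apply Rmult_lt_0_compat; assumption).
  set (B := 2 * (B1 + B2)).
  assert (Hq : 0 <= B / c) by (apply Rdiv_le_0_compat; unfold B; lra).
  exists (C + B / c); split; [lra |].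
  intros a b Mf Mg Ha Hb Hab HMf HMg.
  assert (HMf0 : 0 <= Mf) by (eapply Rle_trans; [apply Rabs_pos | apply (HMf a); lra]).
  assert (HMg0 : 0 <= Mg) by (eapply Rle_trans; [apply Rabs_pos | apply (HMg a); lra]).
  set (L := b - a); assert (HL : 0 < L) by (unfold L; lra).
  assert (HLM : 0 <= L * Mf /\ 0 <= L * Mg) by (split; apply Rmult_le_pos; lra).
  assert (Hpm : 0 < L ^ m) by now apply pow_lt.
  pose proof (mod_nonneg w L Hw ltac:(lra)) as HwL.
  assert (Hpos : 0 <= w L * L ^ m * (L ^ m + L * Mf + L * Mg)).
  { repeat apply Rmult_le_pos; lra. }
  replace ((C + B / c) * w L * L ^ m * (L ^ m + L * Mf + L * Mg)) with
    (C * (w L * L ^ m * (L ^ m + L * Mf + L * Mg)) + B / c * (w L * L ^ m * (L ^ m + L * Mf + L * Mg))) by ring.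
  destruct (classic (S a /\ S b)) as [[Sa Sb] | Hn].
  - pose proof (Rmult_le_pos _ _ Hq Hpos).
    specialize (HD a b Mf Mg Sa Sb Hab HMf HMg); fold L in HD; lra.
  - specialize (Hsep a b Ha Hb ltac:(lra) Hn).
    rewrite Rabs_minus_sym, Rabs_pos_eq in Hsep by lra; fold L in Hsep.
    pose proof (Rmult_le_pos _ _ HC Hpos).
    assert (HDB : forall x, S x \/ In x l -> Rabs (D x) <= B1 + B2).
    { intros x [h | h]; [specialize (Hb1 x h) | specialize (Hb2 x h)]; lra. }
    assert (Hup : Rabs (D b - D a) <= B).
    { eapply Rle_trans; [apply Rabs_triang |]; rewrite Rabs_Ropp.
      pose proof (HDB a Ha); pose proof (HDB b Hb); unfold B; lra. }
    assert (Hlow : c <= w L * L ^ m * (L ^ m + L * Mf + L * Mg)).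
    { pose proof (pow_lower d L m m Hd Hsep (le_n m)) as Hpl; fold e in Hpl.
      pose proof (mod_mono w Hw d L ltac:(lra) Hsep).
      unfold c; repeat apply Rmult_le_compat; try lra.
      apply Rmult_le_pos; lra. }
    apply Rmult_le_compat_l with (r := B / c) in Hlow; [| exact Hq].
    replace (B / c * c) with B in Hlow by (field; lra); lra.
Qed.

(** * Correcting the lift inside a gap *)

(* Pairing off the points keeps them separated after each application of the mean value theorem. *)
Lemma sparse_small (n : nat) (sigma : R) : 0 < sigma -> exists c, 0 <= c /\
  forall (u : nat -> R -> R) (p q W delta : R) (x : nat -> R), chain n u -> p < q -> 0 <= W -> 0 <= delta ->
  (forall y z, p <= y <= q -> p <= z <= q -> Rabs (u n y - u n z) <= W) ->
  (forall i, (i < 2 ^ n)%nat -> p <= x i <= q /\ Rabs (u 0%nat (x i)) <= delta) ->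
  (forall i, (S i < 2 ^ n)%nat -> sigma * (q - p) <= x (S i) - x i) ->
  forall y, p <= y <= q -> Rabs (u 0%nat y) <= c * (delta + W * (q - p) ^ n).
Proof.
  intros Hs; induction n as [| n [c [Hc IH]]].
  - exists 1; split; [lra |]; intros u p q W d x _ Hpq HW Hd Ho Hx _ y Hy.
    destruct (Hx 0%nat) as [H1 H2]; [simpl; lia |].
    replace (u 0%nat y) with (u 0%nat (x 0%nat) + (u 0%nat y - u 0%nat (x 0%nat))) by ring.
    specialize (Ho y (x 0%nat) Hy H1); simpl.
    eapply Rle_trans; [apply Rabs_le_sum; eassumption | lra].
  - assert (Hcs : 0 <= 2 * c / sigma) by (apply Rdiv_le_0_compat; lra).
    (* The 1 is for the value at [x 0]. The rest is the bound for the derivative, small by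
       [2 * d / (sigma * L)] at one point of each pair, integrated over a length at most [L]. *)
    exists (1 + 2 * c / sigma + c); split; [lra |].
    intros u p q W d x Hu Hpq HW Hd Ho Hx Hsep y Hy.
    set (L := q - p) in *; assert (HL : 0 < L) by (unfold L; lra).
    assert (Hz : forall i, exists z, (i < 2 ^ n)%nat ->
      x (2 * i)%nat <= z <= x (2 * i + 1)%nat /\ Rabs (u 1%nat z) <= 2 * d / (sigma * L)).
    { intros i; destruct (Compare_dec.lt_dec i (2 ^ n)) as [Hi | Hi]; [| exists 0; tauto].
      assert (H2n : (2 ^ S n = 2 * 2 ^ n)%nat) by reflexivity.
      pose proof (Hsep (2 * i)%nat ltac:(lia)) as Hsi.
      replace (S (2 * i)) with (2 * i + 1)%nat in Hsi by lia.
      assert (HsL : 0 < sigma * L) by now apply Rmult_lt_0_compat.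
      destruct (mvt_point (u 0%nat) (u 1%nat) (x (2 * i)%nat) (x (2 * i + 1)%nat)) as [z [Hz Ez]].
      { intros t; apply Hu; lia. }
      rewrite Rmin_left, Rmax_right in Hz by lra.
      exists z; intros _; split; [exact Hz |].
      destruct (Hx (2 * i)%nat ltac:(lia)) as [_ B1]; destruct (Hx (2 * i + 1)%nat ltac:(lia)) as [_ B2].
      assert (B3 : Rabs (u 1%nat z) * (x (2 * i + 1)%nat - x (2 * i)%nat) <= 2 * d).
      { rewrite <- (Rabs_pos_eq (x (2 * i + 1)%nat - x (2 * i)%nat)) by lra.
        rewrite <- Rabs_mult, <- Ez.
        eapply Rle_trans; [apply Rabs_triang |]; rewrite Rabs_Ropp; lra. }
      apply Rmult_le_reg_r with (sigma * L); [exact HsL |].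
      replace (2 * d / (sigma * L) * (sigma * L)) with (2 * d) by (field; split; lra).
      eapply Rle_trans; [| exact B3]; apply Rmult_le_compat_l; [apply Rabs_pos | exact Hsi]. }
    destruct (choice _ Hz) as [z Hz'].
    assert (H2n : (2 ^ S n = 2 * 2 ^ n)%nat) by reflexivity.
    assert (HsL : 0 < sigma * L) by now apply Rmult_lt_0_compat.
    assert (Hu1 : forall t, p <= t <= q -> Rabs (u 1%nat t) <= c * (2 * d / (sigma * L) + W * L ^ n)).
    { apply (IH (fun k => u (S k)) p q W (2 * d / (sigma * L)) z); try assumption.
      - now apply chain_shift.
      - apply Rdiv_le_0_compat; lra.
      - intros i Hi; destruct (Hz' i Hi) as [Hzi Bi].
        destruct (Hx (2 * i)%nat ltac:(lia)) as [P1 _]; destruct (Hx (2 * i + 1)%nat ltac:(lia)) as [P2 _].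
        split; [lra | exact Bi].
      - intros i Hi; destruct (Hz' i ltac:(lia)) as [Hzi _]; destruct (Hz' (S i) Hi) as [Hzs _].
        pose proof (Hsep (2 * i + 1)%nat ltac:(lia)) as H.
        replace (S (2 * i + 1)) with (2 * S i)%nat in H by lia; fold L; lra. }
    destruct (Hx 0%nat) as [P0 B0]; [apply Nat.neq_0_lt_0, Nat.pow_nonzero; lia |].
    replace (u 0%nat y) with (u 0%nat (x 0%nat) + (u 0%nat y - u 0%nat (x 0%nat))) by ring.
    eapply Rle_trans; [apply Rabs_le_sum; [exact B0 |] |].
    + eapply Rle_trans; [apply (mvt_abs (u 0%nat) (u 1%nat) p q (c * (2 * d / (sigma * L) + W * L ^ n)) (x 0%nat) y) |];
        [intros t; apply Hu; lia | exact Hu1 | exact P0 | exact Hy |].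
      apply Rmult_le_compat_l with (r2 := L).
      * eapply Rle_trans; [apply Rabs_pos | apply (Hu1 y Hy)].
      * apply Rabs_le; unfold L; lra.
    + replace (c * (2 * d / (sigma * L) + W * L ^ n) * L) with (2 * c / sigma * d + c * (W * L ^ S n))
        by (simpl; field; split; lra).
      assert (0 <= W * L ^ S n) by (apply Rmult_le_pos; [exact HW | apply pow_le; lra]).
      pose proof (Rmult_le_pos _ _ Hcs Hd); pose proof (Rmult_le_pos _ _ Hc Hd).
      pose proof (Rmult_le_pos _ _ Hcs H); lra.
Qed.

Lemma argmax_abs (J : nat -> R) (n : nat) : exists i, (i <= n)%nat /\ forall j, (j <= n)%nat -> Rabs (J j) <= Rabs (J i).
Proof.
  induction n as [| n [i [Hi H]]].
  - exists 0%nat; split; [lia |]; intros j Hj; replace j with 0%nat by lia; lra.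
  - destruct (Rle_dec (Rabs (J i)) (Rabs (J (S n)))) as [h | h].
    + exists (S n); split; [lia |]; intros j Hj.
      destruct (Nat.eq_dec j (S n)) as [-> | ne]; [lra |].
      eapply Rle_trans; [apply H; lia | exact h].
    + exists i; split; [lia |]; intros j Hj.
      destruct (Nat.eq_dec j (S n)) as [-> | ne]; [lra | apply H; lia].
Qed.

(** The root is chosen with [ell * t >= 0]. The linear term then helps, and the size of [t] is
    bounded independently of [ell]. *)
Lemma quadratic_root (kap ell e : R) : 0 < kap -> 0 <= e ->
  exists t, kap * t ^ 2 + ell * t = e /\ kap * t ^ 2 <= e.
Proof.
  intros Hk He.
  assert (Pos : forall ell, 0 <= ell -> exists t, 0 <= t /\ kap * t ^ 2 + ell * t = e).
  { clear ell; intros ell Hl.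
    set (D := ell ^ 2 + 4 * kap * e).
    assert (HD : ell ^ 2 <= D) by (unfold D; assert (0 <= kap * e) by (apply Rmult_le_pos; lra); lra).
    assert (Hs : ell <= sqrt D).
    { rewrite <- (sqrt_pow2 ell Hl); now apply sqrt_le_1_alt. }
    assert (Es : sqrt D * sqrt D = D) by (apply sqrt_sqrt; pose proof (pow2_ge_0 ell); lra).
    exists ((sqrt D - ell) / (2 * kap)); split; [apply Rdiv_le_0_compat; lra |].
    replace (kap * ((sqrt D - ell) / (2 * kap)) ^ 2 + ell * ((sqrt D - ell) / (2 * kap)))
      with ((sqrt D * sqrt D - ell ^ 2) / (4 * kap)) by (field; lra).
    rewrite Es; unfold D; field; lra. }
  destruct (Rle_dec 0 ell) as [h | h].
  - destruct (Pos ell h) as [t [Ht E]]; exists t; split; [exact E |].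
    pose proof (Rmult_le_pos _ _ h Ht); lra.
  - destruct (Pos (- ell)) as [t [Ht E]]; [lra |]; exists (- t); split; [rewrite <- E; ring |].
    replace (kap * (- t) ^ 2) with (kap * t ^ 2) by ring.
    assert (0 <= - ell * t) by (apply Rmult_le_pos; lra); lra.
Qed.

(** Integration by parts: [W] is the difference of the two sides over [[a, x]] with the boundary
    terms included, so its derivative vanishes identically. The boundary terms disappear at [a] and
    [b]. *)
Lemma area_perturbation (f g f1 g1 ph ps ph1 ps1 : R -> R) (a b : R) :
  (forall x, is_derive f x (f1 x)) -> (forall x, is_derive g x (g1 x)) ->
  (forall x, is_derive ph x (ph1 x)) -> (forall x, is_derive ps x (ps1 x)) ->
  (forall x, continuous f1 x) -> (forall x, continuous g1 x) ->
  (forall x, continuous ph1 x) -> (forall x, continuous ps1 x) ->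
  ph a = 0 -> ph b = 0 -> ps a = 0 -> ps b = 0 ->
  2 * RInt (fun x => (f1 x + ph1 x) * (g x + ps x) - (g1 x + ps1 x) * (f x + ph x)) a b =
  2 * RInt (fun x => f1 x * g x - g1 x * f x) a b
  + 4 * (RInt (fun x => f1 x * ps x) a b - RInt (fun x => g1 x * ph x) a b + RInt (fun x => ph1 x * ps x) a b).
Proof.
  intros Df Dg Dph Dps Cf Cg Cph Cps E1 E2 E3 E4.
  assert (Hc : forall u v : R -> R, (forall x, is_derive u x (v x)) -> forall x, continuous u x).
  { intros u v H x; now apply (is_derive_continuous u x (v x)). }
  set (W := fun x => 2 * RInt (fun x => (f1 x + ph1 x) * (g x + ps x) - (g1 x + ps1 x) * (f x + ph x)) a x
    - 2 * RInt (fun x => f1 x * g x - g1 x * f x) a x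
    - 4 * (RInt (fun x => f1 x * ps x) a x - RInt (fun x => g1 x * ph x) a x + RInt (fun x => ph1 x * ps x) a x)
    - 2 * (ph x * g x - ps x * f x - ph x * ps x)).
  assert (DW : forall x, is_derive W x 0).
  { intros x; unfold W.
    apply is_derive_ext_val with
      (2 * ((f1 x + ph1 x) * (g x + ps x) - (g1 x + ps1 x) * (f x + ph x))
       - 2 * (f1 x * g x - g1 x * f x) - 4 * (f1 x * ps x - g1 x * ph x + ph1 x * ps x)
       - 2 * ((ph1 x * g x + ph x * g1 x) - (ps1 x * f x + ps x * f1 x) - (ph1 x * ps x + ph x * ps1 x))); [ring |].
    apply is_derive_minus_R; [apply is_derive_minus_R; [apply is_derive_minus_R |] |]; apply is_derive_scal_R.
    - apply (is_derive_prim (fun x => (f1 x + ph1 x) * (g x + ps x) - (g1 x + ps1 x) * (f x + ph x))).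
      intros y; apply continuous_minus_R; apply continuous_mult_R; apply continuous_plus_R; eauto.
    - apply (is_derive_prim (fun x => f1 x * g x - g1 x * f x)).
      intros y; apply continuous_minus_R; apply continuous_mult_R; eauto.
    - apply is_derive_plus_R; [apply is_derive_minus_R |].
      + apply (is_derive_prim (fun x => f1 x * ps x)); intros y; apply continuous_mult_R; eauto.
      + apply (is_derive_prim (fun x => g1 x * ph x)); intros y; apply continuous_mult_R; eauto.
      + apply (is_derive_prim (fun x => ph1 x * ps x)); intros y; apply continuous_mult_R; eauto.
    - apply is_derive_minus_R; [apply is_derive_minus_R |]; now apply is_derive_mult_R. }
  assert (EW : W a = W b).
  { apply (const_interval W (Rmin a b) (Rmax a b)); [intros; apply DW | |];
      split; auto using Rmin_l, Rmin_r, Rmax_l, Rmax_r. }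
  unfold W in EW; rewrite !RInt_point, E1, E2, E3, E4 in EW; unfold zero in EW; simpl in EW; lra.
Qed.

(** Bumps in every second cell of length [1 / s], so that their supports are [1 / s] apart; this is
    the separation that [sparse_small] needs. *)
Definition wave (beta : nat -> R -> R) (s a : R) (i k : nat) (x : R) : R :=
  s ^ k * beta k (s * (x - a) - 2 * INR i).

(** The weighted mean value theorem for integrals, by Rolle applied to a combination of the
    primitives [P] of the product and [Q] of the bump; the bump is positive inside its cell and can
    be cancelled. *)
Lemma wave_mean_value (beta : nat -> R -> R) (u : R -> R) (s a b : R) (i : nat) :
  (forall x, continuous (beta 0%nat) x) -> (forall x, x <= 0 \/ 1 <= x -> beta 0%nat x = 0) ->
  (forall x, 0 < x < 1 -> 0 < beta 0%nat x) -> (forall x, continuous u x) ->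
  0 < s -> (2 * INR i + 1) <= s * (b - a) ->
  exists x, a + 2 * INR i / s < x < a + (2 * INR i + 1) / s /\
    u x * (RInt (beta 0%nat) 0 1 / s) = RInt (fun x => u x * wave beta s a i 0 x) a b.
Proof.
  intros Cb B0 Bp Cu Hs Hb.
  set (e := wave beta s a i 0).
  assert (Ce : forall x, continuous e x).
  { intros x; unfold e, wave; simpl.
    apply continuous_scal_R.
    apply (continuous_comp (fun x => s * (x - a) - 2 * INR i) (beta 0%nat)); [| apply Cb].
    eapply is_derive_continuous; auto_derive; [exact I | reflexivity]. }
  pose proof (pos_INR i) as Hi.
  set (c := a + 2 * INR i / s); set (d := a + (2 * INR i + 1) / s).
  assert (Hac : a <= c) by (unfold c; assert (0 <= 2 * INR i / s) by (apply Rdiv_le_0_compat; lra); lra).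
  assert (Hcd : c < d).
  { unfold c, d; apply Rplus_lt_compat_l; unfold Rdiv; apply Rmult_lt_compat_r; [now apply Rinv_0_lt_compat | lra]. }
  assert (Hdb : d <= b).
  { apply Rmult_le_reg_l with s; [exact Hs |].
    replace (s * d) with (s * a + (2 * INR i + 1)) by (unfold d; field; lra); lra. }
  assert (Ez : forall x, x <= c \/ d <= x -> e x = 0).
  { intros x Hx; unfold e, wave; rewrite B0; [ring |].
    destruct Hx as [h | h]; [left | right].
    - apply Rmult_le_compat_l with (r := s) in h; [| lra].
      replace (s * c) with (s * a + 2 * INR i) in h by (unfold c; field; lra); lra.
    - apply Rmult_le_compat_l with (r := s) in h; [| lra].
      replace (s * d) with (s * a + (2 * INR i + 1)) in h by (unfold d; field; lra); lra. }
  assert (Ep : forall x, c < x < d -> 0 < e x).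
  { intros x Hx; unfold e, wave; rewrite Rmult_1_l; apply Bp; destruct Hx as [h1 h2].
    apply Rmult_lt_compat_l with (r := s) in h1; [| lra].
    apply Rmult_lt_compat_l with (r := s) in h2; [| lra].
    replace (s * c) with (s * a + 2 * INR i) in h1 by (unfold c; field; lra).
    replace (s * d) with (s * a + (2 * INR i + 1)) in h2 by (unfold d; field; lra).
    lra. }
  set (P := fun x => RInt (fun x => u x * e x) a x).
  assert (DP : forall x, is_derive P x (u x * e x)).
  { intros x; apply (is_derive_prim (fun x => u x * e x)); intros y; now apply continuous_mult_R. }
  assert (Pc : P c = 0).
  { transitivity (P a); [| unfold P; now rewrite RInt_point].
    apply (const_interval P a c); try lra; intros z Hz.
    apply is_derive_ext_val with (2 := DP z); rewrite Ez by (left; lra); ring. }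
  assert (Pd : P d = P b).
  { apply (const_interval P d b); try lra; intros z Hz.
    apply is_derive_ext_val with (2 := DP z); rewrite Ez by (right; lra); ring. }
  set (Q := fun x => / s * RInt (beta 0%nat) 0 (s * (x - a) - 2 * INR i)).
  assert (DQ : forall x, is_derive Q x (e x)).
  { intros x; apply is_derive_ext_val with (/ s * (s * beta 0%nat (s * (x - a) - 2 * INR i))).
    - unfold e, wave; simpl; field; lra.
    - apply is_derive_scal_R, (is_derive_affine (fun y => RInt (beta 0%nat) 0 y)); now apply is_derive_prim. }
  assert (Qc : Q c = 0).
  { unfold Q, c; replace (s * (a + 2 * INR i / s - a) - 2 * INR i) with 0 by (field; lra).
    rewrite RInt_point; unfold zero; simpl; ring. }
  assert (Qd : Q d = RInt (beta 0%nat) 0 1 / s).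
  { unfold Q, d; replace (s * (a + (2 * INR i + 1) / s - a) - 2 * INR i) with 1 by (field; lra).
    field; lra. }
  destruct (rolle (fun x => Q d * P x - P d * Q x) (fun x => Q d * (u x * e x) - P d * e x) c d) as [x [Hx E]].
  - intros z; apply is_derive_minus_R; apply is_derive_scal_R; auto.
  - exact Hcd.
  - rewrite Pc, Qc; ring.
  - exists x; split; [exact Hx |].
    pose proof (Ep x Hx).
    change (u x * (RInt (beta 0%nat) 0 1 / s) = P b); rewrite <- Qd, <- Pd.
    apply Rmult_eq_reg_r with (e x); lra.
Qed.

(** Each test integral is a multiple of the value of the derivative at some point of the bump's
    cell. If all of them are at most the largest one, the derivative is controlled at [2 ^ (m - 1)]
    separated points, hence everywhere up to its oscillation in order [m]. *)
Lemma derivative_testing (m : nat) (w : R -> R) (Om c : R) (beta : nat -> R -> R) :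
  (0 < m)%nat -> modulus w -> 0 <= Om -> 0 <= c ->
  (forall x, continuous (beta 0%nat) x) -> (forall x, x <= 0 \/ 1 <= x -> beta 0%nat x = 0) ->
  (forall x, 0 < x < 1 -> 0 < beta 0%nat x) ->
  exists c3, 0 <= c3 /\ forall (f : nat -> R -> R) (a b : R), a < b -> w (b - a) <= Om ->
    chain m f -> (forall x y, Rabs (f m x - f m y) <= c * w (Rabs (x - y))) ->
    exists i, (i < 2 ^ (m - 1))%nat /\ forall y, a <= y <= b ->
      (b - a) * Rabs (f 1%nat y) <=
        c3 * (Rabs (RInt (fun x => f 1%nat x * wave beta (2 * 2 ^ (m - 1) / (b - a)) a i 0 x) a b) + (b - a) ^ m).
Proof.
  intros Hm Hw HOm Hc Cb B0 Bp.
  set (N := 2 ^ (m - 1)).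
  assert (HN : 0 < N) by (apply pow_lt; lra).
  (* The tower starts at the first derivative, so [m - 1] orders remain and [N] points are needed.
     The interval is cut into [2 * N] cells, whence the separation. *)
  destruct (sparse_small (m - 1) (/ (2 * N))) as [c2 [Hc2 Hsp]]; [apply Rinv_0_lt_compat; lra |].
  set (I0 := RInt (beta 0%nat) 0 1).
  assert (HI0 : 0 < I0) by (apply RInt_gt_0; [lra | exact Bp | intros; apply Cb]).
  assert (HK : 0 <= c2 * (2 * N / I0)) by (apply Rmult_le_pos; [exact Hc2 | apply Rdiv_le_0_compat; lra]).
  assert (HK' : 0 <= c2 * (c * Om)) by (repeat apply Rmult_le_pos; assumption).
  exists (c2 * (2 * N / I0) + c2 * (c * Om)); split; [lra |].
  intros f a b Hab HwOm Cf Of.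
  set (L := b - a) in *; assert (HL : 0 < L) by (unfold L; lra).
  set (s := 2 * N / L); assert (Hs : 0 < s) by (apply Rdiv_lt_0_compat; lra).
  set (J := fun i => RInt (fun x => f 1%nat x * wave beta s a i 0 x) a b).
  assert (EN : INR (2 ^ (m - 1)) = N) by (rewrite pow_INR; unfold N; f_equal).
  assert (H2 : (1 <= 2 ^ (m - 1))%nat) by (apply Nat.neq_0_lt_0, Nat.pow_nonzero; lia).
  destruct (argmax_abs J (2 ^ (m - 1) - 1)) as [i0 [Hi0 Hmax]].
  exists i0; split; [lia |]; intros y Hy; fold (J i0).
  assert (HsL : s * (b - a) = 2 * N) by (fold L; unfold s; field; lra).
  assert (Hx : forall i, exists x, (i < 2 ^ (m - 1))%nat ->
    a + 2 * INR i / s < x < a + (2 * INR i + 1) / s /\ f 1%nat x * (I0 / s) = J i).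
  { intros i; destruct (Compare_dec.lt_dec i (2 ^ (m - 1))) as [Hi | Hi]; [| exists 0; tauto].
    destruct (wave_mean_value beta (f 1%nat) s a b i Cb B0 Bp) as [x Hx]; try assumption.
    - apply (chain_continuous m w c f Hw Hc Cf Of); lia.
    - rewrite HsL, <- EN; apply le_INR in Hi; rewrite S_INR in Hi; lra.
    - exists x; intros _; exact Hx. }
  destruct (choice _ Hx) as [x Hx'].
  set (dl := Rabs (J i0) * s / I0).
  assert (Hdl : 0 <= dl) by (apply Rdiv_le_0_compat; [apply Rmult_le_pos; [apply Rabs_pos | lra] | lra]).
  pose proof (mod_nonneg w L Hw ltac:(lra)) as HwL.
  assert (Hb : Rabs (f 1%nat y) <= c2 * (dl + c * w L * L ^ (m - 1))).
  { apply (Hsp (fun k => f (S k)) a b (c * w L) dl x); try assumption.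
    - intros k Hk t; apply Cf; lia.
    - apply Rmult_le_pos; assumption.
    - intros t z Ht Hz; replace (S (m - 1)) with m by lia.
      eapply Rle_trans; [apply Of |]; apply Rmult_le_compat_l; [exact Hc |].
      apply (mod_mono w Hw); [apply Rabs_pos | apply Rabs_le; unfold L; lra].
    - intros i Hi; destruct (Hx' i Hi) as [h1 h2]; split.
      + pose proof (pos_INR i).
        assert (0 <= 2 * INR i / s) by (apply Rdiv_le_0_compat; lra).
        assert (a + (2 * INR i + 1) / s <= b); [| lra].
        apply Rmult_le_reg_l with s; [exact Hs |].
        replace (s * (a + (2 * INR i + 1) / s)) with (s * a + (2 * INR i + 1)) by (field; lra).
        assert (2 * INR i + 1 <= 2 * N); [| lra].
        rewrite <- EN; apply le_INR in Hi; rewrite S_INR in Hi; lra.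
      + assert (HJ : Rabs (f 1%nat (x i)) * (I0 / s) <= Rabs (J i0)).
        { rewrite <- (Rabs_pos_eq (I0 / s)) by (apply Rdiv_le_0_compat; lra).
          rewrite <- Rabs_mult, h2; apply Hmax; lia. }
        apply Rmult_le_reg_r with (I0 / s); [apply Rdiv_lt_0_compat; lra |].
        unfold dl; replace (Rabs (J i0) * s / I0 * (I0 / s)) with (Rabs (J i0)) by (field; split; lra); exact HJ.
    - intros i Hi; destruct (Hx' i ltac:(lia)) as [h1 _]; destruct (Hx' (S i) Hi) as [h2 _].
      rewrite S_INR in h2.
      replace (/ (2 * N) * (b - a)) with (/ s) by (fold L; unfold s; field; split; lra).
      replace (/ s) with (2 * (INR i + 1) / s - (2 * INR i + 1) / s) by (field; lra); lra. }
  apply Rmult_le_compat_l with (r := L) in Hb; [| lra].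
  eapply Rle_trans; [exact Hb |].
  replace (L * (c2 * (dl + c * w L * L ^ (m - 1)))) with
    (c2 * (2 * N / I0) * Rabs (J i0) + c2 * (c * w L) * L ^ m).
  2: { unfold dl, s; replace m with (S (m - 1)) at 1 by lia; simpl; field; split; lra. }
  pose proof (Rabs_pos (J i0)); assert (Hpm : 0 < L ^ m) by now apply pow_lt.
  assert (c2 * (c * w L) * L ^ m <= c2 * (c * Om) * L ^ m).
  { apply Rmult_le_compat_r; [lra |]; repeat apply Rmult_le_compat_l; assumption. }
  pose proof (Rmult_le_pos _ _ HK (Rlt_le _ _ Hpm)); pose proof (Rmult_le_pos _ _ HK' H).
  lra.
Qed.

(** An amplitude of order [w L * L ^ m] is just what the class allows at scale [L]. The lemma is
    applied with [sqrt (w t)] in the place of [w]. *)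
Lemma scaled_osc (m : nat) (w : R -> R) (z : nat -> R -> R) (B Lam A nu L a c : R) :
  modulus w -> chain (S m) z -> (forall x, Rabs (z (S m) x) <= B) -> 0 <= Lam -> 0 < nu -> 0 < L ->
  Rabs A <= Lam * w L * L ^ m ->
  forall x y, Rabs (x - y) <= L ->
  Rabs (A * (nu / L) ^ m * z m (nu / L * (x - a) - c) - A * (nu / L) ^ m * z m (nu / L * (y - a) - c))
    <= Lam * nu ^ S m * B * w (Rabs (x - y)).
Proof.
  intros Hw Hz HB HLam Hnu HL HA x y Hxy.
  assert (HB0 : 0 <= B) by (eapply Rle_trans; [apply Rabs_pos | apply (HB 0)]).
  assert (HnL : 0 < nu / L) by now apply Rdiv_lt_0_compat.
  rewrite <- Rmult_minus_distr_l, !Rabs_mult, (Rabs_pos_eq ((nu / L) ^ m)) by (apply pow_le; lra).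
  set (X := nu / L * (x - a) - c); set (Y := nu / L * (y - a) - c).
  assert (E1 : Rabs (z m X - z m Y) <= B * (nu * (Rabs (x - y) / L))).
  { eapply Rle_trans.
    - apply (mvt_abs (z m) (z (S m)) (Rmin X Y) (Rmax X Y) B);
        [intros t; apply Hz; lia | intros; apply HB | |]; split; auto using Rmin_l, Rmin_r, Rmax_l, Rmax_r.
    - right; replace (X - Y) with (nu / L * (x - y)) by (unfold X, Y; ring).
      rewrite Rabs_mult, (Rabs_pos_eq (nu / L)) by lra; field; lra. }
  pose proof (mod_scaled w L (Rabs (x - y)) Hw HL (conj (Rabs_pos _) Hxy)) as E2.
  assert (Hp : 0 <= (nu / L) ^ m) by (apply pow_le; lra).
  apply Rle_trans with (Lam * w L * L ^ m * (nu / L) ^ m * (B * (nu * (Rabs (x - y) / L)))).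
  - apply Rmult_le_compat; [apply Rmult_le_pos; [apply Rabs_pos | exact Hp] | apply Rabs_pos | | exact E1].
    apply Rmult_le_compat_r; assumption.
  - replace (Lam * w L * L ^ m * (nu / L) ^ m) with (Lam * w L * (L ^ m * (nu / L) ^ m)) by ring.
    rewrite <- Rpow_mult_distr; replace (L * (nu / L)) with nu by (field; lra).
    replace (Lam * w L * nu ^ m * (B * (nu * (Rabs (x - y) / L)))) with
      (Lam * nu ^ S m * B * (w L * (Rabs (x - y) / L))) by (simpl; ring).
    apply Rmult_le_compat_l; [| exact E2].
    repeat apply Rmult_le_pos; solve [lra | apply pow_le; lra].
Qed.

Lemma bump_energy (beta : nat -> R -> R) :
  (forall x, is_derive (beta 0%nat) x (beta 1%nat x)) -> (forall x, continuous (beta 1%nat) x) ->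
  beta 0%nat 0 = 0 -> 0 < beta 0%nat (1 / 2) -> 0 < RInt (fun x => beta 1%nat x * beta 1%nat x) 0 1.
Proof.
  intros D C Z P; set (t := beta 0%nat (1 / 2)) in *.
  assert (C2 : forall x, continuous (fun x => beta 1%nat x * beta 1%nat x) x).
  { intros x; now apply continuous_mult_R. }
  assert (Mono : forall u v : R -> R, (forall x, is_derive u x (v x)) -> (forall x, 0 <= v x) ->
    forall x y, x <= y -> u x <= u y).
  { intros u v Du Hv x y Hxy; destruct (mvt_point u v x y Du) as [z [_ E]].
    assert (0 <= v z * (y - x)) by (apply Rmult_le_pos; [apply Hv | lra]); lra. }
  set (K := fun x => RInt (fun x => beta 1%nat x * beta 1%nat x) 0 x).
  assert (DK : forall x, is_derive K x (beta 1%nat x * beta 1%nat x)).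
  { intros x; now apply (is_derive_prim (fun x => beta 1%nat x * beta 1%nat x)). }
  assert (K0 : K 0 = 0) by (unfold K; now rewrite RInt_point).
  assert (H1 : K (1 / 2) <= K 1) by (apply (Mono K _ DK); [intros; apply Rle_0_sqr | lra]).
  (* A Cauchy-Schwarz argument: the derivative of this combination is a square, and comparing 0 with
     1/2 gives [K (1 / 2) >= 3 / 2 * t ^ 2]. *)
  assert (H2 : K 0 - 2 * t * beta 0%nat 0 + t * t * 0 <= K (1 / 2) - 2 * t * beta 0%nat (1 / 2) + t * t * (1 / 2)).
  { apply (Mono (fun x => K x - 2 * t * beta 0%nat x + t * t * x)
             (fun x => (beta 1%nat x - t) * (beta 1%nat x - t))); [| intros; apply Rle_0_sqr | lra].
    intros x; apply is_derive_ext_val with (beta 1%nat x * beta 1%nat x - 2 * t * beta 1%nat x + t * t * 1); [ring |].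
    apply is_derive_plus_R; [apply is_derive_minus_R; [apply DK | now apply is_derive_scal_R] |].
    apply (is_derive_scal_R (fun x => x)), (is_derive_id (K := R_AbsRing)). }
  rewrite K0, Z in H2; fold t in H2.
  assert (0 < t * t) by (apply Rmult_lt_0_compat; assumption).
  change (0 < K 1); lra.
Qed.

(** * The perturbation of the two components in one gap *)

Lemma RInt_scal_R (c : R) (u : R -> R) (a b : R) : (forall x, continuous u x) ->
  RInt (fun x => c * u x) a b = c * RInt u a b.
Proof.
  intros Hu; exact (RInt_scal (V := R_CompleteNormedModule) u a b c (continuous_ex_RInt u a b Hu)).
Qed.

Lemma RInt_ext_R (u v : R -> R) (a b : R) : (forall x, u x = v x) -> RInt u a b = RInt v a b.
Proof. intros H; apply RInt_ext; intros x _; apply H. Qed.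

Definition gap_correction (m : nat) (w : R -> R) (C a b E : R) (f g ph ps : nat -> R -> R) : Prop :=
  chain m ph /\ chain m ps /\
  (forall k, (k <= m)%nat -> ph k a = 0 /\ ph k b = 0) /\
  (forall k, (k <= m)%nat -> ps k a = 0 /\ ps k b = 0) /\
  (forall x y, a <= x <= b -> a <= y <= b -> Rabs (ph m x - ph m y) <= C * sqrt (w (Rabs (x - y)))) /\
  (forall x y, a <= x <= b -> a <= y <= b -> Rabs (ps m x - ps m y) <= C * sqrt (w (Rabs (x - y)))) /\
  2 * RInt (fun x => (f 1%nat x + ph 1%nat x) * (g 0%nat x + ps 0%nat x)
                     - (g 1%nat x + ps 1%nat x) * (f 0%nat x + ph 0%nat x)) a b
  = 2 * RInt (fun x => f 1%nat x * g 0%nat x - g 1%nat x * f 0%nat x) a b + E.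

Lemma gap_perturb (m : nat) (w : R -> R) (Om c Cd : R) :
  (0 < m)%nat -> modulus w -> 0 <= Om -> 0 <= c -> 0 <= Cd ->
  exists C', 0 <= C' /\ forall (f g : nat -> R -> R) (a b E : R),
    a < b -> w (b - a) <= Om -> chain m f -> chain m g ->
    (forall x y, Rabs (f m x - f m y) <= c * w (Rabs (x - y))) ->
    (forall x y, Rabs (g m x - g m y) <= c * w (Rabs (x - y))) ->
    (forall Mf Mg, (forall x, a <= x <= b -> Rabs (f 1%nat x) <= Mf) ->
      (forall x, a <= x <= b -> Rabs (g 1%nat x) <= Mg) ->
      Rabs E <= Cd * w (b - a) * (b - a) ^ m * ((b - a) ^ m + (b - a) * Mf + (b - a) * Mg)) ->
    exists ph ps, gap_correction m w C' a b E f g ph ps.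
Proof.
  intros Hm Hw HOm Hc HCd.
  destruct (bump_exists (m + 2)) as [beta [b1 [b2 [b3 b4]]]].
  destruct (bump_bound (m + 2) beta b2 b3) as [B [HB0 HB]].
  destruct (derivative_testing m w Om c beta Hm Hw HOm Hc) as [c3 [Hc3 Htest]];
    [intros; apply b2; lia | intros; apply b3; [lia | assumption] | exact b4 |].
  set (kap := RInt (fun x => beta 1%nat x * beta 1%nat x) 0 1).
  assert (Hkap : 0 < kap).
  { apply bump_energy; [intros; apply b1; lia | intros; apply b2; lia | apply b3; [lia | lra] | apply b4; lra]. }
  set (N := 2 ^ (m - 1)) in *.
  assert (HN : 1 <= N) by (apply pow_R1_Rle; lra).
  assert (EN : INR (2 ^ (m - 1)) = N) by (rewrite pow_INR; unfold N; f_equal).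
  set (C1 := Cd * (1 + 2 * c3)).
  assert (HC1 : 0 <= C1) by (apply Rmult_le_pos; lra).
  assert (HCk : 0 <= C1 / kap) by (apply Rdiv_le_0_compat; assumption).
  pose proof (sqrt_pos Om) as HsOm; pose proof (sqrt_pos (C1 / kap)) as HsCk.
  (* The first term serves the linear correction, whose amplitude is of order [w L * L ^ m], with
     one factor [sqrt (w L)] bounded by [sqrt Om]. The second serves the loop, where [kap] times the
     squared amplitude is at most [C1 * w L * L ^ (2 * m)]. *)
  set (Lam := C1 * sqrt Om + sqrt (C1 / kap)).
  assert (HcO : 0 <= C1 * sqrt Om) by (apply Rmult_le_pos; assumption).
  assert (HLam : 0 <= Lam) by (unfold Lam; lra).
  assert (Hsw := modulus_sqrt w Hw).
  exists (Lam * (2 * N) ^ S m * B); split.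
  { repeat apply Rmult_le_pos; solve [lra | apply pow_le; lra]. }
  intros f g a b E Hab HwOm Cf Cg Of Og HE.
  set (L := b - a) in *; assert (HL : 0 < L) by (unfold L; lra).
  assert (Hpm : 0 < L ^ m) by now apply pow_lt.
  assert (HwL : 0 < w L) by now apply (mod_pos w Hw).
  pose proof (chain_continuous m w c f Hw Hc Cf Of) as Kf.
  pose proof (chain_continuous m w c g Hw Hc Cg Og) as Kg.
  destruct (Htest f a b Hab HwOm Cf Of) as [i_f [Hif Tf]].
  destruct (Htest g a b Hab HwOm Cg Og) as [i_g [Hig Tg]].
  fold L in Tf, Tg.
  set (Jf := RInt (fun x => f 1%nat x * wave beta (2 * N / L) a i_f 0 x) a b) in *.
  set (Jg := RInt (fun x => g 1%nat x * wave beta (2 * N / L) a i_g 0 x) a b) in *.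
  (* The bounds for the derivatives are traded for the test integrals, quantities that a
     perturbation can act on. *)
  assert (HE1 : Rabs E <= C1 * w L * L ^ m * (L ^ m + Rabs Jf + Rabs Jg)).
  { eapply Rle_trans.
    - apply (HE (c3 * (Rabs Jf + L ^ m) / L) (c3 * (Rabs Jg + L ^ m) / L)); intros x Hx;
        (apply Rmult_le_reg_l with L; [exact HL |]); [specialize (Tf x Hx) | specialize (Tg x Hx)];
        (eapply Rle_trans; [eassumption |]); right; field; lra.
    - replace (L * (c3 * (Rabs Jf + L ^ m) / L)) with (c3 * (Rabs Jf + L ^ m)) by (field; lra).
      replace (L * (c3 * (Rabs Jg + L ^ m) / L)) with (c3 * (Rabs Jg + L ^ m)) by (field; lra).
      unfold C1.
      replace (Cd * (1 + 2 * c3) * w L * L ^ m * (L ^ m + Rabs Jf + Rabs Jg)) with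
        (Cd * w L * L ^ m * ((1 + 2 * c3) * (L ^ m + Rabs Jf + Rabs Jg))) by ring.
      apply Rmult_le_compat_l; [repeat apply Rmult_le_pos; lra |].
      pose proof (Rabs_pos Jf); pose proof (Rabs_pos Jg).
      pose proof (Rmult_le_pos _ _ Hc3 H); pose proof (Rmult_le_pos _ _ Hc3 H0); lra. }
  set (good := fun z : nat -> R -> R => chain (S m) z /\ (forall k x, (k <= m)%nat -> continuous (z k) x) /\
    (forall k x, (k <= m)%nat -> x <= 0 \/ 1 <= x -> z k x = 0) /\ (forall x, Rabs (z (S m) x) <= B)).
  assert (G1 : good beta).
  { split; [| split; [| split]].
    - apply (chain_le (m + 2)); [lia | exact b1].
    - intros k x Hk; apply b2; lia.
    - intros k x Hk Hx; apply b3; [lia | exact Hx].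
    - intros x; apply HB; lia. }
  (* The derivative of the bump is also a profile, for which the bump was built with [m + 2]
     orders. *)
  assert (G2 : good (fun k => beta (S k))).
  { split; [| split; [| split]].
    - intros k Hk x; apply b1; lia.
    - intros k x Hk; apply b2; lia.
    - intros k x Hk Hx; apply b3; [lia | exact Hx].
    - intros x; apply HB; lia. }
  set (fam := fun (A nu e : R) (z : nat -> R -> R) (k : nat) (x : R) =>
    A * (nu / L) ^ k * z k (nu / L * (x - a) - e)).
  assert (FamC : forall A nu e z k x, good z -> (k <= m)%nat -> continuous (fam A nu e z k) x).
  { intros A nu e z k x [_ [Gc _]] Hk; unfold fam.
    apply (continuous_scal_R (A * (nu / L) ^ k)).
    apply (continuous_comp (fun x => nu / L * (x - a) - e) (z k)); [| now apply Gc].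
    eapply is_derive_continuous; auto_derive; [exact I | reflexivity]. }
  assert (FamE : forall A nu e z k, good z -> (k <= m)%nat -> 0 <= e -> e + 1 <= nu ->
    fam A nu e z k a = 0 /\ fam A nu e z k b = 0).
  { intros A nu e z k [_ [_ [Gz _]]] Hk He Hen; unfold fam.
    replace (nu / L * (a - a) - e) with (- e) by ring.
    replace (nu / L * (b - a) - e) with (nu - e) by (fold L; field; lra).
    rewrite !Gz by (try assumption; lra); split; ring. }
  assert (FamO : forall A nu e z, good z -> 0 < nu <= 2 * N -> Rabs A <= Lam * sqrt (w L) * L ^ m ->
    forall x y, a <= x <= b -> a <= y <= b ->
    Rabs (fam A nu e z m x - fam A nu e z m y) <= Lam * (2 * N) ^ S m * B * sqrt (w (Rabs (x - y)))).
  { intros A nu e z [Gc [_ [_ GB]]] Hnu HA x y Hx Hy; unfold fam.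
    eapply Rle_trans.
    - apply (scaled_osc m (fun t => sqrt (w t)) z B Lam A nu L a e); try assumption; [lra |].
      apply Rabs_le; unfold L; lra.
    - apply Rmult_le_compat_r; [apply sqrt_pos |].
      apply Rmult_le_compat_r; [exact HB0 |].
      apply Rmult_le_compat_l; [exact HLam |]; apply pow_incr; lra. }
  assert (Fin : forall A1 A2 nu e1 e2 z1 z2, good z1 -> good z2 -> 0 < nu <= 2 * N ->
    0 <= e1 -> e1 + 1 <= nu -> 0 <= e2 -> e2 + 1 <= nu ->
    Rabs A1 <= Lam * sqrt (w L) * L ^ m -> Rabs A2 <= Lam * sqrt (w L) * L ^ m ->
    4 * (RInt (fun x => f 1%nat x * fam A2 nu e2 z2 0%nat x) a b
         - RInt (fun x => g 1%nat x * fam A1 nu e1 z1 0%nat x) a b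
         + RInt (fun x => fam A1 nu e1 z1 1%nat x * fam A2 nu e2 z2 0%nat x) a b) = E ->
    exists ph ps, gap_correction m w (Lam * (2 * N) ^ S m * B) a b E f g ph ps).
  { intros A1 A2 nu e1 e2 z1 z2 Z1 Z2 Hnu He1 He1' He2 He2' HA1 HA2 Heq.
    assert (Ch1 : chain m (fam A1 nu e1 z1)) by (apply chain_scale, (chain_le (S m)); [lia | apply Z1]).
    assert (Ch2 : chain m (fam A2 nu e2 z2)) by (apply chain_scale, (chain_le (S m)); [lia | apply Z2]).
    exists (fam A1 nu e1 z1), (fam A2 nu e2 z2).
    split; [exact Ch1 | split; [exact Ch2 | split; [| split; [| split; [| split]]]]].
    - intros k Hk; now apply FamE.
    - intros k Hk; now apply FamE.
    - now apply FamO.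
    - now apply FamO.
    - rewrite <- Heq; apply area_perturbation.
      + intros; apply Cf; lia.
      + intros; apply Cg; lia.
      + intros; apply Ch1; lia.
      + intros; apply Ch2; lia.
      + apply Kf; lia.
      + apply Kg; lia.
      + intros; apply FamC; [exact Z1 | lia].
      + intros; apply FamC; [exact Z2 | lia].
      + apply FamE; [exact Z1 | lia | assumption | assumption].
      + apply FamE; [exact Z1 | lia | assumption | assumption].
      + apply FamE; [exact Z2 | lia | assumption | assumption].
      + apply FamE; [exact Z2 | lia | assumption | assumption]. }
  assert (Zero : Rabs 0 <= Lam * sqrt (w L) * L ^ m).
  { rewrite Rabs_R0; repeat apply Rmult_le_pos; [exact HLam | apply sqrt_pos | lra]. }
  assert (Wc : forall s i x, continuous (wave beta s a i 0) x).
  { intros s i x; unfold wave.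
    apply (continuous_scal_R (s ^ 0)).
    apply (continuous_comp (fun x => s * (x - a) - 2 * INR i) (beta 0%nat)); [| apply b2; lia].
    eapply is_derive_continuous; auto_derive; [exact I | reflexivity]. }
  assert (Lin : forall (u : R -> R) A i, (forall x, continuous u x) ->
    RInt (fun x => u x * fam A (2 * N) (2 * INR i) beta 0%nat x) a b
      = A * RInt (fun x => u x * wave beta (2 * N / L) a i 0 x) a b).
  { intros u A i Cu; rewrite <- RInt_scal_R by (intros x; apply continuous_mult_R; [apply Cu | apply Wc]).
    apply RInt_ext_R; intros x; unfold fam, wave; ring. }
  assert (LinB : forall J, 0 < Rabs J -> Rabs E <= 3 * C1 * w L * L ^ m * Rabs J ->
    Rabs (E / (4 * J)) <= Lam * sqrt (w L) * L ^ m).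
  { intros J HJ HEJ.
    assert (J <> 0) by (intros ->; rewrite Rabs_R0 in HJ; lra).
    apply Rmult_le_reg_r with (4 * Rabs J); [lra |].
    replace (Rabs (E / (4 * J)) * (4 * Rabs J)) with (Rabs E).
    2: { replace (4 * Rabs J) with (Rabs (4 * J)) by (rewrite Rabs_mult, (Rabs_pos_eq 4) by lra; reflexivity).
         rewrite <- Rabs_mult; f_equal; field; lra. }
    eapply Rle_trans; [exact HEJ |].
    assert (Hsq : w L <= sqrt Om * sqrt (w L)).
    { rewrite <- (sqrt_sqrt (w L)) at 1 by lra.
      apply Rmult_le_compat_r; [apply sqrt_pos | now apply sqrt_le_1_alt]. }
    assert (H1 : C1 * w L <= Lam * sqrt (w L)).
    { unfold Lam; rewrite Rmult_plus_distr_r.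
      pose proof (Rmult_le_compat_l C1 _ _ HC1 Hsq).
      pose proof (Rmult_le_pos _ _ HsCk (sqrt_pos (w L))); lra. }
    replace (3 * C1 * w L * L ^ m * Rabs J) with (3 * (C1 * w L * (L ^ m * Rabs J))) by ring.
    replace (Lam * sqrt (w L) * L ^ m * (4 * Rabs J)) with (4 * (Lam * sqrt (w L) * (L ^ m * Rabs J))) by ring.
    assert (H2 : 0 <= L ^ m * Rabs J) by (apply Rmult_le_pos; lra).
    pose proof (Rmult_le_compat_r _ _ _ H2 H1).
    assert (0 <= C1 * w L * (L ^ m * Rabs J)) by (repeat apply Rmult_le_pos; lra); lra. }
  assert (Lin0 : forall (u : R -> R) i, (forall x, continuous u x) ->
    RInt (fun x => u x * fam 0 (2 * N) (2 * INR i) beta 0%nat x) a b = 0).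
  { intros u i Cu; rewrite Lin by exact Cu; apply Rmult_0_l. }
  assert (Idx : forall i, (i < 2 ^ (m - 1))%nat -> 2 * INR i + 1 <= 2 * N).
  { intros i Hi; rewrite <- EN; apply le_INR in Hi; rewrite S_INR in Hi; lra. }
  pose proof (pos_INR i_f) as Pf; pose proof (pos_INR i_g) as Pg.
  assert (HCwL : 0 <= C1 * w L * L ^ m) by (repeat apply Rmult_le_pos; lra).
  (* If a test integral reaches [L ^ m], it dominates the defect, and moving the other component
     alone repairs it: the quadratic term is then zero. Otherwise the defect is of order
     [w L * L ^ (2 * m)] and is repaired by a loop. *)
  destruct (Rle_dec (L ^ m) (Rmax (Rabs Jf) (Rabs Jg))) as [hbig | hsmall].
  - destruct (Rle_dec (Rabs Jg) (Rabs Jf)) as [hf | hg].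
    + rewrite Rmax_left in hbig by exact hf.
      assert (Jf <> 0) by (intros e; rewrite e, Rabs_R0 in hbig; lra).
      apply (Fin 0 (E / (4 * Jf)) (2 * N) (2 * INR i_f) (2 * INR i_f) beta beta); try assumption; try lra;
        try (now apply Idx).
      * apply LinB; [lra |]; eapply Rle_trans; [exact HE1 |].
        replace (3 * C1 * w L * L ^ m * Rabs Jf) with (C1 * w L * L ^ m * (3 * Rabs Jf)) by ring.
        apply Rmult_le_compat_l; lra.
      * rewrite Lin, Lin0 by (apply Kf || apply Kg; lia); fold Jf.
        rewrite (RInt_ext_R _ (fun x => 0 * fam (E / (4 * Jf)) (2 * N) (2 * INR i_f) beta 0%nat x)).
        2: { intros x; unfold fam; ring. }
        rewrite RInt_scal_R by (intros; apply FamC; [exact G1 | lia]).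
        field; assumption.
    + rewrite Rmax_right in hbig by lra.
      assert (Jg <> 0) by (intros e; rewrite e, Rabs_R0 in hbig; lra).
      apply (Fin (- (E / (4 * Jg))) 0 (2 * N) (2 * INR i_g) (2 * INR i_g) beta beta); try assumption; try lra;
        try (now apply Idx).
      * rewrite Rabs_Ropp; apply LinB; [lra |]; eapply Rle_trans; [exact HE1 |].
        replace (3 * C1 * w L * L ^ m * Rabs Jg) with (C1 * w L * L ^ m * (3 * Rabs Jg)) by ring.
        apply Rmult_le_compat_l; lra.
      * rewrite Lin0, Lin by (apply Kf || apply Kg; lia); fold Jg.
        rewrite (RInt_ext_R _ (fun x => 0 * fam (- (E / (4 * Jg))) (2 * N) (2 * INR i_g) beta 1%nat x)).
        2: { intros x; unfold fam; ring. }
        rewrite RInt_scal_R by (intros; apply FamC; [exact G1 | lia]).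
        field; assumption.
  - apply Rnot_le_lt in hsmall.
    pose proof (Rmax_l (Rabs Jf) (Rabs Jg)); pose proof (Rmax_r (Rabs Jf) (Rabs Jg)).
    assert (HE2 : Rabs E <= 4 * C1 * w L * (L ^ m * L ^ m)).
    { eapply Rle_trans; [exact HE1 |].
      replace (4 * C1 * w L * (L ^ m * L ^ m)) with (C1 * w L * L ^ m * (4 * L ^ m)) by ring.
      apply Rmult_le_compat_l; lra. }
    (* The loop: one component moves along the bump, the other along its derivative. The quadratic
       term is [A1 * A2 * kap] for every [L], as the factor [1 / L] of the derivative cancels the
       length in the change of variables. [P] and [Q] give the linear terms that come with it. *)
    set (z2 := fun k => beta (S k)).
    set (P := RInt (fun x => f 1%nat x * fam 1 1 0 z2 0%nat x) a b).
    set (Q := RInt (fun x => g 1%nat x * fam 1 1 0 beta 0%nat x) a b).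
    assert (EP : forall A, RInt (fun x => f 1%nat x * fam A 1 0 z2 0%nat x) a b = A * P).
    { intros A; unfold P; rewrite <- RInt_scal_R.
      - apply RInt_ext_R; intros x; unfold fam; ring.
      - intros x; apply continuous_mult_R; [apply Kf; lia | apply FamC; [exact G2 | lia]]. }
    assert (EQ : forall A, RInt (fun x => g 1%nat x * fam A 1 0 beta 0%nat x) a b = A * Q).
    { intros A; unfold Q; rewrite <- RInt_scal_R.
      - apply RInt_ext_R; intros x; unfold fam; ring.
      - intros x; apply continuous_mult_R; [apply Kg; lia | apply FamC; [exact G1 | lia]]. }
    assert (CE : forall x, continuous (fun x => beta 1%nat x * beta 1%nat x) x).
    { intros x; apply continuous_mult_R; apply b2; lia. }
    assert (EK : forall A1 A2, RInt (fun x => fam A1 1 0 beta 1%nat x * fam A2 1 0 z2 0%nat x) a b = A1 * A2 * kap).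
    { intros A1 A2.
      rewrite (RInt_deriv (fun x => A1 * A2 * RInt (fun x => beta 1%nat x * beta 1%nat x) 0 (1 / L * (x - a) - 0))).
      - replace (1 / L * (b - a) - 0) with 1 by (fold L; field; lra).
        replace (1 / L * (a - a) - 0) with 0 by ring.
        rewrite RInt_point; unfold zero, kap; simpl; ring.
      - intros x; apply is_derive_ext_val with
          (A1 * A2 * (1 / L * (beta 1%nat (1 / L * (x - a) - 0) * beta 1%nat (1 / L * (x - a) - 0)))).
        + unfold fam, z2; ring.
        + apply is_derive_scal_R, (is_derive_affine (fun y => RInt (fun x => beta 1%nat x * beta 1%nat x) 0 y)).
          now apply (is_derive_prim (fun x => beta 1%nat x * beta 1%nat x)).
      - intros x; apply continuous_mult_R; apply FamC; try lia; assumption. }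
    assert (QB : forall t, kap * t ^ 2 <= Rabs E / 4 -> Rabs t <= Lam * sqrt (w L) * L ^ m).
    { intros t Ht.
      apply Rle_trans with (sqrt (C1 / kap) * sqrt (w L) * L ^ m).
      - rewrite <- (sqrt_pow2 (L ^ m)) by lra.
        rewrite <- (sqrt_mult_alt (C1 / kap)) by lra.
        rewrite <- sqrt_mult_alt by (apply Rmult_le_pos; lra).
        rewrite <- sqrt_Rsqr_abs; apply sqrt_le_1_alt; unfold Rsqr.
        apply Rmult_le_reg_l with kap; [exact Hkap |].
        replace (kap * (C1 / kap * w L * (L ^ m) ^ 2)) with (C1 * w L * (L ^ m * L ^ m)) by (field; lra).
        replace (kap * (t * t)) with (kap * t ^ 2) by ring; lra.
      - apply Rmult_le_compat_r; [lra |]; apply Rmult_le_compat_r; [apply sqrt_pos | unfold Lam; lra]. }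
    (* The sign of [E] fixes the orientation of the loop. *)
    destruct (Rle_dec 0 E) as [hp | hn].
    + destruct (quadratic_root kap (P - Q) (Rabs E / 4) Hkap) as [t [Et Bt]]; [pose proof (Rabs_pos E); lra |].
      apply (Fin t t 1 0 0 beta z2); try assumption; try lra; try (now apply QB).
      rewrite EP, EQ, EK; rewrite (Rabs_pos_eq E hp) in Et.
      replace (t * P - t * Q + t * t * kap) with (kap * t ^ 2 + (P - Q) * t) by ring; rewrite Et; field.
    + destruct (quadratic_root kap (P + Q) (Rabs E / 4) Hkap) as [t [Et Bt]]; [pose proof (Rabs_pos E); lra |].
      apply (Fin t (- t) 1 0 0 beta z2); try assumption; try lra;
        try (rewrite Rabs_Ropp); try (now apply QB).
      rewrite EP, EQ, EK; rewrite (Rabs_left1 E) in Et by lra.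
      replace (- t * P - t * Q + t * - t * kap) with (- (kap * t ^ 2 + (P + Q) * t)) by ring; rewrite Et; field.
Qed.

(** * The class [C^{m,w}] *)

Definition bounded_fun (F : R -> R) : Prop := exists B, 0 <= B /\ forall x, Rabs (F x) <= B.

Definition holder (w : R -> R) (F : R -> R) : Prop :=
  exists C, 0 <= C /\ forall x y, Rabs (F x - F y) <= C * w (Rabs (x - y)).

(* Requiring all derivatives to be bounded makes the class stable under products without
   Leibniz' formula. *)
Fixpoint bounded_class (w : R -> R) (n : nat) (F : R -> R) : Prop :=
  bounded_fun F /\ holder w F /\
  match n with
  | O => True
  | S n => exists F', (forall x, is_derive F x (F' x)) /\ bounded_class w n F'
  end.

Lemma bounded_class_bounded (w : R -> R) (n : nat) (F : R -> R) : bounded_class w n F -> bounded_fun F.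
Proof. destruct n; intros H; apply H. Qed.

Lemma bounded_class_holder (w : R -> R) (n : nat) (F : R -> R) : bounded_class w n F -> holder w F.
Proof. destruct n; intros H; apply H. Qed.

Lemma bounded_class_pred (w : R -> R) (n : nat) : forall F, bounded_class w (S n) F -> bounded_class w n F.
Proof.
  induction n as [| n IH]; intros F [H1 [H2 [F' [DF HF]]]].
  - repeat split; assumption.
  - split; [exact H1 | split; [exact H2 |]]; exists F'; split; [exact DF | now apply IH].
Qed.

Lemma bounded_fun_plus (F G : R -> R) : bounded_fun F -> bounded_fun G -> bounded_fun (fun x => F x + G x).
Proof.
  intros [B [HB HF]] [B' [HB' HG]]; exists (B + B'); split; [lra | intros x; now apply Rabs_le_sum].
Qed.

Lemma bounded_fun_mult (F G : R -> R) : bounded_fun F -> bounded_fun G -> bounded_fun (fun x => F x * G x).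
Proof.
  intros [B [HB HF]] [B' [HB' HG]]; exists (B * B'); split; [now apply Rmult_le_pos | intros x; now apply Rabs_le_prod].
Qed.

Lemma holder_plus (w : R -> R) (F G : R -> R) : holder w F -> holder w G -> holder w (fun x => F x + G x).
Proof.
  intros [B [HB HF]] [B' [HB' HG]]; exists (B + B'); split; [lra | intros x y].
  replace (F x + G x - (F y + G y)) with ((F x - F y) + (G x - G y)) by ring.
  rewrite Rmult_plus_distr_r; now apply Rabs_le_sum.
Qed.

Lemma holder_mult (w : R -> R) (F G : R -> R) :
  bounded_fun F -> bounded_fun G -> holder w F -> holder w G -> holder w (fun x => F x * G x).
Proof.
  intros [BF [HBF bF]] [BG [HBG bG]] [CF [HCF hF]] [CG [HCG hG]].
  exists (BF * CG + CF * BG); split; [apply Rplus_le_le_0_compat; now apply Rmult_le_pos | intros x y].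
  replace (F x * G x - F y * G y) with (F x * (G x - G y) + (F x - F y) * G y) by ring.
  replace ((BF * CG + CF * BG) * w (Rabs (x - y))) with
    (BF * (CG * w (Rabs (x - y))) + CF * w (Rabs (x - y)) * BG) by ring.
  apply Rabs_le_sum; now apply Rabs_le_prod.
Qed.

Lemma bounded_class_plus (w : R -> R) (n : nat) : forall F G,
  bounded_class w n F -> bounded_class w n G -> bounded_class w n (fun x => F x + G x).
Proof.
  induction n as [| n IH]; intros F G [F1 [F2 F3]] [G1 [G2 G3]];
    (split; [now apply bounded_fun_plus | split; [now apply holder_plus |]]); [exact I |].
  destruct F3 as [F' [DF HF]]; destruct G3 as [G' [DG HG]].
  exists (fun x => F' x + G' x); split; [intros; now apply is_derive_plus_R | now apply IH].
Qed.

Lemma bounded_class_mult (w : R -> R) (n : nat) : forall F G,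
  bounded_class w n F -> bounded_class w n G -> bounded_class w n (fun x => F x * G x).
Proof.
  induction n as [| n IH]; intros F G HF HG.
  - destruct HF as [F1 [F2 _]], HG as [G1 [G2 _]].
    split; [now apply bounded_fun_mult | split; [now apply holder_mult | exact I]].
  - pose proof (bounded_class_pred w n F HF) as PF; pose proof (bounded_class_pred w n G HG) as PG.
    destruct HF as [F1 [F2 [F' [DF HF]]]], HG as [G1 [G2 [G' [DG HG]]]].
    split; [now apply bounded_fun_mult | split; [now apply holder_mult |]].
    exists (fun x => F' x * G x + F x * G' x); split; [intros; now apply is_derive_mult_R |].
    apply bounded_class_plus; now apply IH.
Qed.

Lemma bounded_class_const (w : R -> R) (n : nat) (c : R) : modulus w -> bounded_class w n (fun _ => c).
Proof.
  intros Hw; revert c; induction n as [| n IH]; intros c.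
  all: split; [exists (Rabs c); split; [apply Rabs_pos | intros; lra] | split].
  all: try (exists 0; split; [lra |]; intros x y; rewrite Rminus_diag, Rabs_R0; lra).
  - exact I.
  - exists (fun _ => 0); split; [intros x; apply (is_derive_const (K := R_AbsRing) (V := R_NormedModule)) | apply IH].
Qed.

(** Up to distance 1 the ratio property gives [t * w 1 <= w t], so Lipschitz is enough; beyond it
    [w] is at least [w 1] and boundedness of [F] is enough. *)
Lemma lipschitz_holder (w : R -> R) (F F' : R -> R) :
  modulus w -> (forall x, is_derive F x (F' x)) -> bounded_fun F -> bounded_fun F' -> holder w F.
Proof.
  intros Hw DF [B [HB bF]] [B' [HB' bF']].
  assert (Hw1 : 0 < w 1) by (apply (mod_pos w Hw); lra).
  assert (Q1 : 0 <= B' / w 1) by (apply Rdiv_le_0_compat; lra).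
  assert (Q2 : 0 <= 2 * B / w 1) by (apply Rdiv_le_0_compat; lra).
  exists (B' / w 1 + 2 * B / w 1); split; [lra |]; intros x y.
  set (t := Rabs (x - y)); assert (Ht : 0 <= t) by apply Rabs_pos.
  pose proof (mod_nonneg w t Hw Ht) as Hwt.
  pose proof (Rmult_le_pos _ _ Q1 Hwt); pose proof (Rmult_le_pos _ _ Q2 Hwt).
  rewrite Rmult_plus_distr_r.
  destruct (Rle_dec t 1) as [h | h].
  - apply Rle_trans with (B' * t).
    + apply (mvt_abs F F' (Rmin x y) (Rmax x y) B' y x DF); [intros; apply bF' | |];
        split; auto using Rmin_l, Rmin_r, Rmax_l, Rmax_r.
    + pose proof (mod_ratio w Hw t 1 Ht h) as Hr.
      assert (B' * t <= B' / w 1 * w t); [| lra].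
      replace (B' * t) with (B' / w 1 * (t * w 1)) by (field; lra).
      apply Rmult_le_compat_l; lra.
  - apply Rle_trans with (2 * B).
    + replace (2 * B) with (B + B) by ring; unfold Rminus; apply Rabs_le_sum; [apply bF | rewrite Rabs_Ropp; apply bF].
    + assert (2 * B <= 2 * B / w 1 * w t); [| lra].
      replace (2 * B) with (2 * B / w 1 * w 1) at 1 by (field; lra).
      apply Rmult_le_compat_l; [exact Q2 |]; apply (mod_mono w Hw); lra.
Qed.

Lemma bounded_class_chain (w : R -> R) (m : nat) : modulus w -> forall F, chain m F ->
  (forall k, (k <= m)%nat -> bounded_fun (F k)) -> holder w (F m) -> bounded_class w m (F 0%nat).
Proof.
  intros Hw; induction m as [| m IH]; intros F HF HB HH.
  - split; [now apply HB | split; [exact HH | exact I]].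
  - assert (D0 : forall x, is_derive (F 0%nat) x (F 1%nat x)) by (intros; apply HF; lia).
    split; [apply HB; lia | split].
    + apply (lipschitz_holder w (F 0%nat) (F 1%nat)); try assumption; apply HB; lia.
    + exists (F 1%nat); split; [exact D0 |].
      apply (IH (fun k => F (S k))); [now apply chain_shift | intros; apply HB; lia | exact HH].
Qed.

Lemma chain_bounded_class (w : R -> R) (m : nat) : forall F, bounded_class w m F ->
  exists G, G 0%nat = F /\ chain m G /\ holder w (G m).
Proof.
  induction m as [| m IH]; intros F HF.
  - exists (fun _ => F); split; [reflexivity | split]; [intros k Hk; lia | now apply (bounded_class_holder w 0)].
  - destruct HF as [_ [_ [F' [DF HF]]]]; destruct (IH F' HF) as [G [G0 [G1 G2]]].
    exists (fun k => match k with O => F | S k => G k end); split; [reflexivity | split; [| exact G2]].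
    intros [| k] Hk x; [rewrite G0; apply DF | apply G1; lia].
Qed.

Lemma chain_Derive_n (m : nat) (G : nat -> R -> R) : chain m G ->
  forall k, (k <= m)%nat -> forall x, Derive_n (G 0%nat) k x = G k x.
Proof.
  intros HG; induction k as [| k IH]; intros Hk x; [reflexivity |].
  simpl; transitivity (Derive (G k) x).
  - apply Derive_ext; intros t; apply IH; lia.
  - apply is_derive_unique, HG; lia.
Qed.

Lemma Cm_chain (m : nat) (phi : R -> R) : Cm m phi -> chain m (Derive_n phi).
Proof.
  intros [H _] k Hk x; specialize (H (S k) Hk x); simpl in H.
  apply (Derive_correct (Derive_n phi k)), H.
Qed.

(** The member [r] excludes the value minus infinity, which is the supremum of the empty set. *)
Lemma lub_finite (E : R -> Prop) (r C : R) :
  E r -> (forall s, E s -> s <= C) -> is_finite (Lub_Rbar E).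
Proof.
  intros Hr HC; destruct (Lub_Rbar_correct E) as [H1 H2].
  assert (H3 : Rbar_le (Lub_Rbar E) C) by (apply H2; intros s Hs; now apply HC).
  specialize (H1 r Hr); destruct (Lub_Rbar E); simpl in *; [reflexivity | tauto | tauto].
Qed.

Lemma bounded_class_Cmw (m : nat) (w : R -> R) (F : R -> R) :
  modulus w -> bounded_class w m F -> Cmw m w F.
Proof.
  intros Hw HF; destruct (chain_bounded_class w m F HF) as [G [<- [G1 [C [HC G2]]]]].
  pose proof (chain_Derive_n m G G1) as ED.
  split; [split |].
  - intros [| k] Hk x; [exact I |]; simpl.
    apply (ex_derive_ext (G k)); [intros t; symmetry; apply ED; lia |].
    exists (G (S k) x); apply G1; lia.
  - intros x; apply (continuous_ext (G m)); [intros t; symmetry; apply ED; lia |].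
    apply (holder_continuous w C); assumption.
  - apply (lub_finite _ (Rabs (G m 1 - G m 0) / w (Rabs (1 - 0))) C).
    + exists 0, 1; split; [lra | now rewrite !ED by lia].
    + intros s [a [b [Hab ->]]]; rewrite !ED by lia.
      assert (Hp : 0 < w (Rabs (b - a))) by (apply (mod_pos w Hw), Rabs_pos_lt; lra).
      apply Rmult_le_reg_r with (w (Rabs (b - a))); [exact Hp |].
      unfold Rdiv; rewrite Rmult_assoc, Rinv_l, Rmult_1_r by lra; apply G2.
Qed.

Lemma Cmw_holder (m : nat) (w : R -> R) (phi : R -> R) : modulus w -> Cmw m w phi ->
  0 <= holder_seminorm m w phi /\
  forall x y, Rabs (Derive_n phi m x - Derive_n phi m y) <= holder_seminorm m w phi * w (Rabs (x - y)).
Proof.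
  intros Hw [_ Hfin]; unfold holder_seminorm, holder_sup in *.
  destruct (Lub_Rbar_correct (holder_quotients m w phi)) as [H1 _].
  rewrite <- Hfin in H1; simpl in H1; set (l := real (Lub_Rbar (holder_quotients m w phi))) in *.
  assert (Hq : forall a b, a <> b -> Rabs (Derive_n phi m b - Derive_n phi m a) / w (Rabs (b - a)) <= l).
  { intros a b Hab; apply (H1 (Rabs (Derive_n phi m b - Derive_n phi m a) / w (Rabs (b - a)))).
    now exists a, b. }
  split.
  - eapply Rle_trans; [| apply (Hq 0 1); lra].
    apply Rdiv_le_0_compat; [apply Rabs_pos | apply (mod_pos w Hw), Rabs_pos_lt; lra].
  - intros x y; destruct (Req_dec x y) as [<- | ne].
    + rewrite !Rminus_diag, !Rabs_R0, (mod_zero w Hw); lra.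
    + assert (Hp : 0 < w (Rabs (x - y))) by (apply (mod_pos w Hw), Rabs_pos_lt; lra).
      specialize (Hq y x ltac:(lra)).
      apply Rmult_le_compat_r with (r := w (Rabs (x - y))) in Hq; [| lra].
      unfold Rdiv in Hq; rewrite Rmult_assoc, Rinv_l, Rmult_1_r in Hq by lra; exact Hq.
Qed.

Lemma bounded_fun_of_support (F : R -> R) (p q : R) : p <= q ->
  (forall x, continuous F x) -> (forall x, x <= p \/ q <= x -> F x = 0) -> bounded_fun F.
Proof.
  intros Hpq HF H0; destruct (continuous_bounded F p q Hpq HF) as [B [HB Hb]].
  exists B; split; [exact HB |]; intros x.
  destruct (Rle_dec x p); [rewrite H0, Rabs_R0; auto |].
  destruct (Rle_dec q x); [rewrite H0, Rabs_R0; auto |].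
  apply Hb; lra.
Qed.

Lemma lipschitz_abs_continuous (F F' : R -> R) :
  (forall x, is_derive F x (F' x)) -> bounded_fun F' -> abs_continuous F.
Proof.
  intros DF [B [HB bF]] a b Hab eps Heps.
  exists (eps / (B + 1)); split; [apply Rdiv_lt_0_compat; lra |].
  intros l Hl Hlen.
  assert (Hv : forall l lo, nonoverlap lo l b -> 0 <= len_sum l /\ var_sum F l <= B * len_sum l).
  { clear l Hl Hlen; induction l as [| [x y] l IH]; intros lo Hl; simpl in *; [lra |].
    destruct Hl as [h1 [h2 [h3 h4]]]; destruct (IH y h4) as [i1 i2].
    assert (E : Rabs (F y - F x) <= B * Rabs (y - x)).
    { apply (mvt_abs F F' x y B x y DF); [intros; apply bF | lra | lra]. }
    rewrite (Rabs_pos_eq (y - x)) in E by lra; split; lra. }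
  destruct (Hv l a Hl) as [h1 h2].
  apply Rmult_lt_compat_r with (r := B + 1) in Hlen; [| lra].
  replace (eps / (B + 1) * (B + 1)) with eps in Hlen by (field; lra); lra.
Qed.

(** * Assembling the curve *)

(** The data to be extended are the limit jets on [K'] and, at points of [l] off [K'], a value with
    vanishing higher derivatives, equal to 0 at [p] and [q]. The last conclusion keeps the link
    between [f] and the interpolants for the defect estimate. *)
Lemma component_extension (m : nat) (K K' : R -> Prop) (w : R -> R) (C : R) (gam : R -> R)
  (D : list R -> nat -> R -> R) (p q : R) (l : list R) :
  modulus w -> 0 <= C -> interpolants m K w C gam D ->
  (forall x, K' x -> K x /\ accum K x) -> closed_set K' -> p < q ->
  (forall x, K x -> p < x < q) -> (forall x, In x l -> p <= x <= q) -> In p l -> In q l ->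
  (forall x, K x -> K' x \/ In x l) ->
  exists (f : nat -> R -> R) (C' : R), 0 <= C' /\ chain m f /\
    (forall x y, Rabs (f m x - f m y) <= C' * w (Rabs (x - y))) /\
    (forall x, K x -> f 0%nat x = gam x) /\
    (forall k x, (k <= m)%nat -> x <= p \/ q <= x -> f k x = 0) /\
    (forall a, K' a -> is_jet m K w (2 * exch_const m C) a D (fun k => f k a)).
Proof.
  intros Hw HC HD HK' Hcl Hpq Kpq lpq lp lq Kl.
  destruct (choice (fun a U => K' a -> U 0%nat = gam a /\ is_jet m K w (2 * exch_const m C) a D U)) as [U HU].
  { intros a; destruct (classic (K' a)) as [h | h]; [| exists (fun _ => 0); tauto].
    destruct (HK' a h) as [Ka Aa].
    destruct (jet_exists m K w C a gam D HD Hw HC Ka Aa) as [U HU]; exists U; intros _; exact HU. }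
  set (g0 := fun x => if Rle_dec x p then 0 else if Rle_dec q x then 0 else gam x).
  set (u := fun (k : nat) x => if excluded_middle_informative (K' x) then U x k
     else match k with O => g0 x | S _ => 0 end).
  assert (uK : forall k x, K' x -> u k x = U x k).
  { intros k x h; unfold u; destruct (excluded_middle_informative (K' x)); tauto. }
  assert (K'pq : forall x, K' x -> p <= x <= q) by (intros x h; apply HK' in h; destruct h as [h _]; apply Kpq in h; lra).
  assert (u0 : forall k x, x <= p \/ q <= x -> u k x = 0).
  { intros k x Hx; unfold u; destruct (excluded_middle_informative (K' x)) as [h | h].
    - apply HK' in h; destruct h as [h _]; apply Kpq in h; lra.
    - destruct k; [| reflexivity]; unfold g0.
      destruct (Rle_dec x p); [reflexivity |]; destruct (Rle_dec q x); [reflexivity | lra]. }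
  assert (uval : forall x, K x -> u 0%nat x = gam x).
  { intros x Kx; unfold u; destruct (excluded_middle_informative (K' x)) as [h | h]; [now apply HU |].
    unfold g0; pose proof (Kpq x Kx); destruct (Rle_dec x p); [lra |]; destruct (Rle_dec q x); [lra | reflexivity]. }
  set (CW := (exch_const m C + (INR m + 1) * C) * 3 ^ S m).
  assert (HCW : 0 <= CW).
  { pose proof (exch_const_nonneg m C HC); pose proof (pos_INR m).
    apply Rmult_le_pos; [| apply pow_le; lra].
    apply Rplus_le_le_0_compat; [assumption | apply Rmult_le_pos; lra]. }
  assert (HW : whitney m w CW K' u).
  { intros a b k Ka Kb Hk.
    destruct (Req_dec a b) as [<- | ne].
    - rewrite taylor_chain_at, !Rminus_diag, Rabs_R0, (mod_zero w Hw); lra.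
    - rewrite (uK k b Kb).
      replace (taylor_chain m (fun i => u i a) a k b) with (taylor_chain m (U a) a k b).
      + destruct (HK' a Ka) as [a1 a2], (HK' b Kb) as [d1 d2].
        apply (jets_whitney m K w C a b gam D); try assumption; now apply HU.
      + unfold taylor_chain; apply pol_ext; intros; symmetry; now apply uK. }
  destruct (whitney_add_points m w CW K' l u p q Hw HCW Hcl K'pq lpq HW) as [C2 [HC2 HW2]].
  destruct (whitney_extension m w C2 (fun x => K' x \/ In x l) u p q Hw HC2) as [f [C' [HC' [f1 [f2 f3]]]]];
    try assumption.
  - now apply closed_union_list.
  - intros x [h | h]; [now apply K'pq | now apply lpq].
  - now right.
  - now right.
  - exists f, C'; split; [exact HC' | split; [exact f1 | split; [exact f3 | split; [| split]]]].
    + intros x Kx; rewrite f2; [now apply uval | lia | right; right; now apply Kl].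
    + intros k x Hk Hx; rewrite f2; [now apply u0 | exact Hk | destruct Hx; [now left | right; now left]].
    + intros a Ka d Hd cl Hcl' k Hk; rewrite f2; [| exact Hk | right; right; now left].
      rewrite uK by exact Ka; now apply (HU a Ka).
Qed.

Definition area (f g : nat -> R -> R) (x : R) : R := f 1%nat x * g 0%nat x - g 1%nat x * f 0%nat x.

Lemma area_continuous (f g : nat -> R -> R) (x : R) :
  (forall k y, (k <= 1)%nat -> continuous (f k) y) -> (forall k y, (k <= 1)%nat -> continuous (g k) y) ->
  continuous (area f g) x.
Proof.
  intros Cf Cg; apply continuous_minus_R; apply continuous_mult_R; (apply Cf || apply Cg); lia.
Qed.

Lemma RInt_split (F : R -> R) (p a b : R) : (forall x, continuous F x) ->
  RInt F a b = RInt F p b - RInt F p a.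
Proof.
  intros HF.
  pose proof (RInt_Chasles (V := R_CompleteNormedModule) F p a b
    (continuous_ex_RInt F p a HF) (continuous_ex_RInt F a b HF)) as E.
  change (RInt F p a + RInt F a b = RInt F p b) in E.
  change (@eq R (RInt F a b) (RInt F p b - RInt F p a)); lra.
Qed.

Lemma RInt_zero (F : R -> R) (a b : R) : a <= b -> (forall x, a < x < b -> F x = 0) -> RInt F a b = 0.
Proof.
  intros Hab H; rewrite (RInt_ext _ (fun _ => 0)).
  - rewrite RInt_const; apply Rmult_0_r.
  - intros x; rewrite Rmin_left, Rmax_right by exact Hab; apply H.
Qed.

(** For each pair, [defect_pair] is applied to an interpolant through [a], [b] and [m] points near
    [a]. The same nodes must serve both components, so the cluster lies within the smaller of the
    two radii. *)
Lemma defect_on_accum (m : nat) (K K' : R -> Prop) (w : R -> R) (C M p q c : R)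
  (gam1 gam2 h : R -> R) (G : list R -> curve) (f g : nat -> R -> R) :
  (0 < m)%nat -> modulus w -> 0 < M -> 0 <= C -> 0 <= c -> p < q ->
  interpolants m K w C gam1 (fun L => Derive_n (cf (G L))) ->
  interpolants m K w C gam2 (fun L => Derive_n (cg (G L))) ->
  (forall L, node_list m K L -> forall x, In x L -> ch (G L) x = h x) ->
  (forall L, node_list m K L -> forall a b, K a -> K b -> a < b ->
     Rabs (A_fun m (G L) a b / V_fun m (G L) a b) <= M * w (b - a)) ->
  (forall x, K' x -> K x /\ accum K x) -> (forall x, K x -> p <= x <= q) ->
  chain m f -> chain m g ->
  (forall x y, Rabs (f m x - f m y) <= c * w (Rabs (x - y))) ->
  (forall x y, Rabs (g m x - g m y) <= c * w (Rabs (x - y))) ->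
  (forall x, K x -> f 0%nat x = gam1 x) -> (forall x, K x -> g 0%nat x = gam2 x) ->
  (forall a, K' a -> is_jet m K w (2 * exch_const m C) a (fun L => Derive_n (cf (G L))) (fun k => f k a)) ->
  (forall a, K' a -> is_jet m K w (2 * exch_const m C) a (fun L => Derive_n (cg (G L))) (fun k => g k a)) ->
  exists Cd, 0 <= Cd /\
    defect_le m w Cd K' (f 1%nat) (g 1%nat) (fun x => h x - 2 * RInt (area f g) p x).
Proof.
  intros Hm Hw HM HC Hc Hpq I1 I2 Ih IA HK' Kpq Cf Cg Of Og Vf Vg Jf Jg.
  assert (HOm : 0 <= w (q - p)) by (apply mod_nonneg; [exact Hw | lra]).
  destruct (defect_pair m w M (w (q - p)) c Hm Hw HM HOm Hc) as [Cd [HCd Hpair]].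
  exists Cd; split; [exact HCd |].
  intros a b Mf Mg Ka' Kb' Hab HMf HMg.
  destruct (HK' a Ka') as [Ka Aa], (HK' b Kb') as [Kb _].
  pose proof (Kpq a Ka); pose proof (Kpq b Kb).
  set (L := b - a); assert (HL : 0 < L) by (unfold L; lra).
  (* A tolerance below [w L * L ^ (m - k)] for all [k <= m] at once. *)
  set (eps := w L * Rmin 1 L ^ m).
  assert (Heps : 0 < eps).
  { apply Rmult_lt_0_compat; [now apply (mod_pos w Hw) | apply pow_lt, Rmin_pos; lra]. }
  assert (He : forall k, (k <= m)%nat -> eps <= w L * L ^ (m - k)).
  { intros k Hk; apply Rmult_le_compat_l; [apply mod_nonneg; [exact Hw | lra] |].
    apply pow_lower; [exact HL | lra | lia]. }
  destruct (jet_far_point m K w C a b gam1 _ _ eps I1 Hw HC Ka Aa Kb ltac:(lra) (Jf a Ka') Heps) as [d1 [Hd1 F1]].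
  destruct (jet_far_point m K w C a b gam2 _ _ eps I2 Hw HC Ka Aa Kb ltac:(lra) (Jg a Ka') Heps) as [d2 [Hd2 F2]].
  destruct (cluster_exists K a Aa m (Rmin d1 d2) nil (Rmin_pos _ _ Hd1 Hd2)) as [l [[l1 [l2 l3]] _]].
  destruct (F1 l) as [N1 E1].
  { split; [exact l1 | split; [exact l2 |]]; intros x Hx; destruct (l3 x Hx) as [? [? Hd]].
    repeat split; try assumption; eapply Rlt_le_trans; [exact Hd | apply Rmin_l]. }
  destruct (F2 l) as [_ E2].
  { split; [exact l1 | split; [exact l2 |]]; intros x Hx; destruct (l3 x Hx) as [? [? Hd]].
    repeat split; try assumption; eapply Rlt_le_trans; [exact Hd | apply Rmin_r]. }
  set (X := b :: a :: l) in *.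
  destruct (I1 X N1) as [_ [_ v1]]; destruct (I2 X N1) as [_ [_ v2]].
  assert (Xa : In a X) by (right; now left).
  assert (Xb : In b X) by now left.
  pose proof (v1 a Xa) as v1a; pose proof (v1 b Xb) as v1b; pose proof (v2 a Xa) as v2a; pose proof (v2 b Xb) as v2b.
  simpl in v1a, v1b, v2a, v2b.
  assert (CA : forall x, continuous (area f g) x).
  { intros x; apply area_continuous; intros k y Hk;
      [apply (chain_continuous m w c f) | apply (chain_continuous m w c g)]; try assumption; lia. }
  replace (h b - 2 * RInt (area f g) p b - (h a - 2 * RInt (area f g) p a))
    with (ch (G X) b - ch (G X) a - 2 * RInt (area f g) a b).
  2: { rewrite (RInt_split (area f g) p a b CA), !(Ih X N1) by assumption; ring. }
  apply Hpair; try assumption.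
  - apply (mod_mono w Hw); lra.
  - intros k Hk; rewrite Rabs_minus_sym; eapply Rle_trans; [now apply E1 | now apply He].
  - intros k Hk; rewrite Rabs_minus_sym; eapply Rle_trans; [now apply E2 | now apply He].
  - rewrite Vf, v1a by assumption; reflexivity.
  - rewrite Vf, v1b by assumption; reflexivity.
  - rewrite Vg, v2a by assumption; reflexivity.
  - rewrite Vg, v2b by assumption; reflexivity.
  - now apply IA.
Qed.

(** As [0 < m], short pairs have a defect of at most a constant times [w L * L], which is [o(L)]:
    the defect has zero derivative along the set. *)
Lemma defect_local (m : nat) (w : R -> R) (C : R) (S : R -> Prop) (f1 g1 D : R -> R) (p q : R) :
  (0 < m)%nat -> modulus w -> 0 <= C -> p < q -> (forall x, S x -> p <= x <= q) -> S p -> S q ->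
  (forall x, continuous f1 x) -> (forall x, continuous g1 x) -> defect_le m w C S f1 g1 D ->
  (forall x, x <= p -> D x = D p) -> (forall x, q <= x -> D x = D q) ->
  forall eps, 0 < eps -> exists delta, 0 < delta /\
    forall a b, outer p q S a -> outer p q S b -> Rabs (b - a) < delta -> Rabs (D b - D a) <= eps * Rabs (b - a).
Proof.
  intros Hm Hw HC Hpq Spq Sp Sq Cf Cg HD Dp Dq eps Heps.
  destruct (continuous_bounded f1 p q ltac:(lra) Cf) as [Bf [HBf0 HBf]].
  destruct (continuous_bounded g1 p q ltac:(lra) Cg) as [Bg [HBg0 HBg]].
  set (B := C * (1 + Bf + Bg)).
  assert (HB : 0 <= B) by (apply Rmult_le_pos; lra).
  destruct (mod_lim w Hw (eps / (B + 1))) as [d [Hd Hwd]]; [apply Rdiv_lt_0_compat; lra |].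
  exists (Rmin 1 d); split; [apply Rmin_pos; lra |].
  pose proof (Rmin_l 1 d); pose proof (Rmin_r 1 d).
  assert (Main : forall a b, S a -> S b -> a < b -> b - a < Rmin 1 d -> Rabs (D b - D a) <= eps * (b - a)).
  { intros a b Sa Sb Hab Hba; pose proof (Spq a Sa); pose proof (Spq b Sb).
    eapply Rle_trans; [apply (HD a b Bf Bg Sa Sb Hab); intros; [apply HBf | apply HBg]; lra |].
    set (L := b - a) in *; assert (HL : 0 < L) by (unfold L; lra).
    specialize (Hwd L ltac:(lra) ltac:(lra)).
    pose proof (mod_nonneg w L Hw ltac:(lra)) as HwL.
    assert (HLm : L ^ m <= L).
    { replace m with (Datatypes.S (m - 1)) by lia; simpl.
      apply Rle_trans with (L * 1); [| lra]; apply Rmult_le_compat_l; [lra | apply pow_le_one; lra]. }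
    assert (Hp0 : 0 <= L ^ m) by (apply pow_le; lra).
    assert (H3 : L ^ m + L * Bf + L * Bg <= 1 + Bf + Bg).
    { pose proof (Rmult_le_compat_r Bf L 1 HBf0 ltac:(lra)); pose proof (Rmult_le_compat_r Bg L 1 HBg0 ltac:(lra)); lra. }
    apply Rle_trans with (C * w L * L * (1 + Bf + Bg)).
    - apply Rmult_le_compat; try assumption.
      + repeat apply Rmult_le_pos; assumption.
      + repeat apply Rplus_le_le_0_compat; try apply Rmult_le_pos; lra.
      + apply Rmult_le_compat_l; [now apply Rmult_le_pos | exact HLm].
    - replace (C * w L * L * (1 + Bf + Bg)) with (B * w L * L) by (unfold B; ring).
      apply Rmult_le_compat_r; [lra |].
      apply Rmult_lt_compat_r with (r := B + 1) in Hwd; [| lra].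
      replace (eps / (B + 1) * (B + 1)) with eps in Hwd by (field; lra); lra. }
  pose proof (outer_clamp R D p q S Hpq Sp Sq Dp Dq) as Hcl.
  assert (Main2 : forall a b, outer p q S a -> outer p q S b -> a < b -> b - a < Rmin 1 d ->
    Rabs (D b - D a) <= eps * (b - a)).
  { intros a b Oa Ob Hab Hba.
    destruct (Hcl a Oa) as [Sa <-]; destruct (Hcl b Ob) as [Sb <-].
    pose proof (clamp_mono p q a b ltac:(lra)) as Hle.
    set (a' := clamp p q a) in *; set (b' := clamp p q b) in *.
    destruct (Req_dec a' b') as [<- | ne].
    - rewrite Rminus_diag, Rabs_R0; apply Rmult_le_pos; lra.
    - eapply Rle_trans; [apply Main; try assumption; lra |]; apply Rmult_le_compat_l; lra. }
  intros a b Oa Ob Hab.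
  destruct (Rtotal_order a b) as [h | [<- | h]].
  - rewrite (Rabs_pos_eq (b - a)) in * by lra; now apply Main2.
  - rewrite !Rminus_diag, Rabs_R0; lra.
  - rewrite (Rabs_minus_sym b a) in *; rewrite (Rabs_minus_sym (D b)).
    rewrite (Rabs_pos_eq (a - b)) in * by lra; now apply Main2.
Qed.

(** The corrections are chosen independently in the gaps. They can be glued because they vanish to
    order [m] at the ends, so that the data on the closed set are zero, and because their constant
    [C'] is the same for all gaps. *)
Lemma horizontal_correction (m : nat) (w : R -> R) (S : R -> Prop) (p q c Cd : R)
  (f g : nat -> R -> R) (h : R -> R) :
  (0 < m)%nat -> modulus w -> 0 <= c -> 0 <= Cd -> p < q -> closed_set S ->
  (forall x, S x -> p <= x <= q) -> S p -> S q ->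
  chain m f -> chain m g ->
  (forall x y, Rabs (f m x - f m y) <= c * w (Rabs (x - y))) ->
  (forall x y, Rabs (g m x - g m y) <= c * w (Rabs (x - y))) ->
  (forall k x, (k <= m)%nat -> x <= p \/ q <= x -> f k x = 0) ->
  (forall k x, (k <= m)%nat -> x <= p \/ q <= x -> g k x = 0) ->
  (forall x, x <= p \/ q <= x -> h x = 0) ->
  defect_le m w Cd S (f 1%nat) (g 1%nat) (fun x => h x - 2 * RInt (area f g) p x) ->
  exists (ph ps : nat -> R -> R) (C' : R), 0 <= C' /\ chain m ph /\ chain m ps /\
    (forall x y, Rabs (ph m x - ph m y) <= C' * sqrt (w (Rabs (x - y)))) /\
    (forall x y, Rabs (ps m x - ps m y) <= C' * sqrt (w (Rabs (x - y)))) /\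
    (forall k x, (k <= m)%nat -> outer p q S x -> ph k x = 0 /\ ps k x = 0) /\
    (forall x, S x -> 2 * RInt (area (fun k y => f k y + ph k y) (fun k y => g k y + ps k y)) p x = h x).
Proof.
  intros Hm Hw Hc HCd Hpq HS Spq Sp Sq Cf Cg Of Og Zf Zg Zh HD.
  assert (HOm : 0 <= w (q - p)) by (apply mod_nonneg; [exact Hw | lra]).
  destruct (gap_perturb m w (w (q - p)) c Cd Hm Hw HOm Hc HCd) as [C' [HC' Hgap]].
  pose proof (chain_continuous m w c f Hw Hc Cf Of) as Kf.
  pose proof (chain_continuous m w c g Hw Hc Cg Og) as Kg.
  assert (CA : forall x, continuous (area f g) x).
  { intros x; apply area_continuous; intros; [apply Kf | apply Kg]; lia. }
  set (D := fun x => h x - 2 * RInt (area f g) p x) in *.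
  set (O := outer p q S).
  pose proof (modulus_sqrt w Hw) as Hsw.
  set (spec := fun (ab : R * R) (v : (nat -> R -> R) * (nat -> R -> R)) => gap O (fst ab) (snd ab) ->
    gap_correction m w C' (fst ab) (snd ab) (D (snd ab) - D (fst ab)) f g (fst v) (snd v)).
  destruct (choice spec) as [v Hv].
  { intros [a b]; unfold spec; simpl; destruct (classic (gap O a b)) as [Hg | Hg].
    2: { exists (fun _ _ => 0, fun _ _ => 0); tauto. }
    destruct (outer_gap p q a b S Sp Sq Hg) as [Sa [Sb [Hpa [Hab Hbq]]]].
    destruct (Hgap f g a b (D b - D a) Hab) as [ph [ps Hp]]; try assumption.
    - apply (mod_mono w Hw); lra.
    - intros Mf Mg HMf HMg; now apply HD.
    - exists (ph, ps); intros _; exact Hp. }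
  unfold spec in Hv; clear spec.
  assert (HO : closed_set O) by now apply outer_closed.
  assert (Op : O p) by (left; lra).
  assert (Hloc0 : forall k, (k < m)%nat -> forall a, O a -> forall eps, 0 < eps -> exists delta, 0 < delta /\
     forall b, O b -> Rabs (b - a) < delta -> Rabs (0 - 0 - 0 * (b - a)) <= eps * Rabs (b - a)).
  { intros k _ a _ eps Heps; exists 1; split; [lra |]; intros b _ _.
    replace (0 - 0 - 0 * (b - a)) with 0 by ring; rewrite Rabs_R0.
    apply Rmult_le_pos; [lra | apply Rabs_pos]. }
  assert (Hum : forall a b : R, O a -> O b -> Rabs (0 - 0) <= C' * sqrt (w (Rabs (b - a)))).
  { intros a b _ _; rewrite Rminus_diag, Rabs_R0; apply Rmult_le_pos; [exact HC' | apply sqrt_pos]. }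
  destruct (glue_chain m O (fun t => sqrt (w t)) C' p (fun _ _ => 0) (fun a b => fst (v (a, b))) HO
    (outer_below p q S) (outer_above p q S) Hsw HC' Op (fun _ => eq_refl) Hloc0 Hum) as [ph [p1 [p2 [p3 p4]]]].
  { intros a b Hg; destruct (Hv (a, b) Hg) as [v1 [v2 [v3 [v4 [v5 [v6 _]]]]]].
    split; [exact v1 | split; [exact v3 | exact v5]]. }
  destruct (glue_chain m O (fun t => sqrt (w t)) C' p (fun _ _ => 0) (fun a b => snd (v (a, b))) HO
    (outer_below p q S) (outer_above p q S) Hsw HC' Op (fun _ => eq_refl) Hloc0 Hum) as [ps [s1 [s2 [s3 s4]]]].
  { intros a b Hg; destruct (Hv (a, b) Hg) as [v1 [v2 [v3 [v4 [v5 [v6 _]]]]]].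
    split; [exact v2 | split; [exact v4 | exact v6]]. }
  assert (HC3 : 0 <= 3 * C') by lra.
  pose proof (chain_continuous m _ (3 * C') ph Hsw HC3 p1 p4) as Kph.
  pose proof (chain_continuous m _ (3 * C') ps Hsw HC3 s1 s4) as Kps.
  set (F := fun k y => f k y + ph k y); set (G := fun k y => g k y + ps k y).
  assert (CAF : forall x, continuous (area F G) x).
  { intros x; apply area_continuous; intros k y Hk; unfold F, G; apply continuous_plus_R;
      (apply Kf || apply Kg || apply Kph || apply Kps); lia. }
  exists ph, ps, (3 * C'); split; [exact HC3 | split; [exact p1 | split; [exact s1 | split; [exact p4 | split; [exact s4 | split]]]]].
  { intros k x Hk Ox; split; [now apply p2 | now apply s2]. }
  set (E := fun x => h x - 2 * RInt (area F G) p x).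
  assert (EO : forall x, O x -> E x = E p).
  { intros x Ox; apply (constant_on_closed O E HO (outer_below p q S) (outer_above p q S)); try assumption.
    - intros a Oa eps Heps.
      (* The change of the integrand vanishes on the closed set, where the corrections and their
         first derivatives are zero. Near [a] it therefore alters the lift by [o(b - a)], and the
         zero derivative of [D] carries over to [E]. *)
      set (th := fun x => area F G x - area f g x).
      assert (Cth : forall x, continuous th x) by (intros y; now apply continuous_minus_R).
      assert (th0 : th a = 0).
      { unfold th, area, F, G; rewrite !p2, !s2 by (assumption || lia); ring. }
      pose proof (is_derive_prim th p a Cth) as Dth; rewrite th0 in Dth.
      destruct (is_derive_eps_inv _ _ _ Dth (eps / 4)) as [d1 [Hd1 H1]]; [lra |].
      destruct (defect_local m w Cd S (f 1%nat) (g 1%nat) D p q) with (eps := eps / 2) as [d2 [Hd2 H2]];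
        try assumption; try lra.
      + intros; apply Kf; lia.
      + intros; apply Kg; lia.
      + intros y Hy; unfold D; rewrite !Zh by (left; lra).
        assert (E0 : RInt (area f g) y p = 0).
        { apply RInt_zero; [exact Hy |]; intros t Ht.
          unfold area; rewrite (Zf 1%nat), (Zg 1%nat) by (lia || lra); ring. }
        rewrite (RInt_split (area f g) p y p CA) in E0; lra.
      + intros y Hy; unfold D; rewrite !Zh by (right; lra).
        assert (E0 : RInt (area f g) q y = 0).
        { apply RInt_zero; [exact Hy |]; intros t Ht.
          unfold area; rewrite (Zf 1%nat), (Zg 1%nat) by (lia || lra); ring. }
        rewrite (RInt_split (area f g) p q y CA) in E0; lra.
      + exists (Rmin d1 d2); split; [now apply Rmin_pos |].
        intros b Ob Hb; specialize (H1 b (Rlt_le_trans _ _ _ Hb (Rmin_l _ _))).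
        specialize (H2 a b Oa Ob (Rlt_le_trans _ _ _ Hb (Rmin_r _ _))).
        assert (Eth : forall y, RInt th p y = RInt (area F G) p y - RInt (area f g) p y).
        { intros y; unfold th.
          exact (RInt_minus (V := R_CompleteNormedModule) (area F G) (area f g) p y
            (continuous_ex_RInt _ p y CAF) (continuous_ex_RInt _ p y CA)). }
        rewrite !Eth in H1; unfold D in H2; unfold E.
        match type of H1 with Rabs ?X <= _ =>
          replace (h b - 2 * RInt (area F G) p b - (h a - 2 * RInt (area F G) p a)) with
          ((h b - 2 * RInt (area f g) p b - (h a - 2 * RInt (area f g) p a)) + - (2 * X)) by ring end.
        replace (eps * Rabs (b - a)) with (eps / 2 * Rabs (b - a) + 2 * (eps / 4 * Rabs (b - a))) by field.
        apply Rabs_le_sum; [exact H2 |]; rewrite Rabs_Ropp; apply Rabs_le_prod; [rewrite Rabs_pos_eq; lra | exact H1].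
    - intros a b Hg.
      destruct (Hv (a, b) Hg) as [_ [_ [_ [_ [_ [_ HI]]]]]]; simpl in HI.
      assert (HI' : 2 * RInt (area F G) a b = 2 * RInt (area f g) a b + (D b - D a)).
      { etransitivity; [| exact HI]; f_equal; apply RInt_ext; intros t Ht.
        rewrite Rmin_left, Rmax_right in Ht by (destruct Hg as [_ [_ [? _]]]; lra).
        unfold area, F, G; rewrite !(p3 a b Hg), !(s3 a b Hg) by (lia || lra); reflexivity. }
      rewrite (RInt_split _ p a b CAF), (RInt_split _ p a b CA) in HI'.
      unfold D in HI'; unfold E; lra. }
  (* The constant is the value at [p], where both [h] and the integral are 0. *)
  intros x Sx; specialize (EO x (or_intror (or_intror Sx))); unfold E in EO.
  rewrite RInt_point in EO; unfold zero in EO; simpl in EO; rewrite (Zh p) in EO by (left; lra).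
  change (2 * RInt (area F G) p x = h x); lra.
Qed.

(** Up to distance 1, [w t] is at most [sqrt (w 1) * sqrt (w t)]. At large distances [w] may exceed
    its root by any factor, and the bound for [F] takes over. *)
Lemma holder_sqrt (w : R -> R) (F : R -> R) :
  modulus w -> bounded_fun F -> holder w F -> holder (fun t => sqrt (w t)) F.
Proof.
  intros Hw [B [HB bF]] [C [HC hF]].
  assert (Hw1 : 0 < w 1) by (apply (mod_pos w Hw); lra).
  assert (Hs1 : 0 < sqrt (w 1)) by now apply sqrt_lt_R0.
  assert (Q1 : 0 <= C * sqrt (w 1)) by (apply Rmult_le_pos; lra).
  assert (Q2 : 0 <= 2 * B / sqrt (w 1)) by (apply Rdiv_le_0_compat; lra).
  exists (C * sqrt (w 1) + 2 * B / sqrt (w 1)); split; [lra |]; intros x y.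
  set (t := Rabs (x - y)); assert (Ht : 0 <= t) by apply Rabs_pos.
  pose proof (mod_nonneg w t Hw Ht) as Hwt; pose proof (sqrt_pos (w t)) as Hst.
  pose proof (Rmult_le_pos _ _ Q1 Hst); pose proof (Rmult_le_pos _ _ Q2 Hst).
  rewrite Rmult_plus_distr_r.
  destruct (Rle_dec t 1) as [h | h].
  - assert (w t <= sqrt (w 1) * sqrt (w t)).
    { rewrite <- (sqrt_sqrt (w t)) at 1 by exact Hwt.
      apply Rmult_le_compat_r; [exact Hst |]; apply sqrt_le_1_alt, (mod_mono w Hw); lra. }
    eapply Rle_trans; [apply hF |]; fold t.
    apply Rmult_le_compat_l with (r := C) in H1; lra.
  - apply Rle_trans with (2 * B).
    + replace (2 * B) with (B + B) by ring; unfold Rminus; apply Rabs_le_sum; [apply bF | rewrite Rabs_Ropp; apply bF].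
    + assert (2 * B <= 2 * B / sqrt (w 1) * sqrt (w t)); [| lra].
      replace (2 * B) with (2 * B / sqrt (w 1) * sqrt (w 1)) at 1 by (field; lra).
      apply Rmult_le_compat_l; [exact Q2 |]; apply sqrt_le_1_alt, (mod_mono w Hw); lra.
Qed.

Lemma nonisolated_closed (K : R -> Prop) : closed_set K -> closed_set (fun x => K x /\ ~ isolated_point K x).
Proof.
  intros HK; apply closed_of_nbhd; intros x Hx.
  destruct (classic (K x)) as [Kx | Kx].
  - assert (Hi : isolated_point K x) by (apply NNPP; tauto).
    pose proof Hi as [_ [e [He Hy]]]; exists e; split; [exact He |].
    intros y Hyx [Ky Hn]; rewrite (Hy y Ky Hyx) in Hn; tauto.
  - destruct (closed_nbhd K x HK Kx) as [d [Hd H]]; exists d; split; [exact Hd |].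
    intros y Hy [Ky _]; now apply (H y).
Qed.

Lemma nonisolated_accum (K : R -> Prop) (x : R) : K x -> ~ isolated_point K x -> accum K x.
Proof.
  intros Kx Hn eps Heps; apply NNPP; intros H; apply Hn; split; [exact Kx |].
  exists eps; split; [exact Heps |]; intros y Ky Hy.
  apply NNPP; intros ne; apply H; now exists y.
Qed.

(** The derivative of the third coordinate is built from products in the class of order [m - 1], so
    the third coordinate has order [m]. It is bounded because its integrand vanishes outside
    [[p, q]]. *)
Lemma horizontal_lift (m : nat) (w : R -> R) (F G : nat -> R -> R) (p q : R) :
  (0 < m)%nat -> modulus w -> p < q -> chain m F -> chain m G ->
  (forall k x, (k <= m)%nat -> continuous (F k) x) -> (forall k x, (k <= m)%nat -> continuous (G k) x) ->
  (forall k x, (k <= m)%nat -> x <= p \/ q <= x -> F k x = 0) ->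
  (forall k x, (k <= m)%nat -> x <= p \/ q <= x -> G k x = 0) ->
  holder w (F m) -> holder w (G m) ->
  let Gam : curve := fun x => (F 0%nat x, G 0%nat x, 2 * RInt (area F G) p x) in
  horizontal Gam /\ Cmw_curve m w Gam.
Proof.
  intros Hm Hw Hpq CF CG KF KG ZF ZG HF HG Gam.
  assert (BF : forall k, (k <= m)%nat -> bounded_fun (F k)).
  { intros k Hk; apply (bounded_fun_of_support (F k) p q); [lra | intros; now apply KF | intros; now apply ZF]. }
  assert (BG : forall k, (k <= m)%nat -> bounded_fun (G k)).
  { intros k Hk; apply (bounded_fun_of_support (G k) p q); [lra | intros; now apply KG | intros; now apply ZG]. }
  destruct m as [| n]; [lia |].
  pose proof (bounded_class_chain w (S n) Hw F CF BF HF) as cF0.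
  pose proof (bounded_class_chain w (S n) Hw G CG BG HG) as cG0.
  assert (cF1 : bounded_class w n (F 1%nat)).
  { apply (bounded_class_chain w n Hw (fun k => F (S k))); [now apply chain_shift | intros; apply BF; lia | exact HF]. }
  assert (cG1 : bounded_class w n (G 1%nat)).
  { apply (bounded_class_chain w n Hw (fun k => G (S k))); [now apply chain_shift | intros; apply BG; lia | exact HG]. }
  assert (CA : forall x, continuous (area F G) x).
  { intros x; apply area_continuous; intros k y Hk; [apply KF | apply KG]; lia. }
  (* Written with sums and products only, to match the closure lemmas of [bounded_class]. *)
  set (dH := fun x => 2 * (F 1%nat x * G 0%nat x + -1 * (G 1%nat x * F 0%nat x))).
  assert (cdH : bounded_class w n dH).
  { apply bounded_class_mult; [now apply bounded_class_const |].
    apply bounded_class_plus; [| apply bounded_class_mult; [now apply bounded_class_const |]];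
      apply bounded_class_mult; try assumption; now apply bounded_class_pred. }
  assert (DH : forall x, is_derive (ch Gam) x (dH x)).
  { intros x; apply is_derive_ext_val with (2 * area F G x); [unfold dH, area; ring |].
    apply (is_derive_scal_R (fun x => RInt (area F G) p x)); now apply is_derive_prim. }
  assert (D1 : forall x, is_derive (cf Gam) x (F 1%nat x)) by (intros; apply CF; lia).
  assert (D2 : forall x, is_derive (cg Gam) x (G 1%nat x)) by (intros; apply CG; lia).
  assert (BH : bounded_fun (ch Gam)).
  { destruct (continuous_bounded (ch Gam) p q ltac:(lra)) as [B [HB Hb]].
    { intros x; apply (is_derive_continuous _ x (dH x)), DH. }
    assert (Z : forall t, t <= p \/ q <= t -> area F G t = 0).
    { intros t Ht; unfold area; rewrite (ZF 1%nat), (ZG 1%nat) by (lia || assumption); ring. }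
    exists B; split; [exact HB |]; intros x.
    destruct (Rle_dec x p) as [h1 | h1]; [| destruct (Rle_dec q x) as [h2 | h2]; [| apply Hb; lra]].
    - replace (ch Gam x) with (ch Gam p); [apply Hb; lra |].
      assert (E : RInt (area F G) x p = 0) by (apply RInt_zero; [exact h1 | intros; apply Z; lra]).
      rewrite (RInt_split _ p x p CA) in E; unfold ch, Gam; simpl; lra.
    - replace (ch Gam x) with (ch Gam q); [apply Hb; lra |].
      assert (E : RInt (area F G) q x = 0) by (apply RInt_zero; [exact h2 | intros; apply Z; lra]).
      rewrite (RInt_split _ p q x CA) in E; unfold ch, Gam; simpl; lra. }
  pose proof (bounded_class_bounded w n dH cdH) as BdH.
  split; [split; [| split; [| split]] | split; [| split]].
  - apply (lipschitz_abs_continuous _ (F 1%nat) D1); apply BF; lia.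
  - apply (lipschitz_abs_continuous _ (G 1%nat) D2); apply BG; lia.
  - now apply (lipschitz_abs_continuous _ dH DH).
  (* The curve is differentiable everywhere, so the exceptional set is empty. *)
  - exists (fun _ => False); split.
    + intros eps Heps; exists (fun _ => 0), (fun _ => 0); split; [intros; lra | split; [tauto |]].
      intros k; rewrite (sum_eq _ (fun _ => 0)) by (intros; ring); rewrite sum_cte; lra.
    + intros x _; split; [now exists (F 1%nat x) | split; [now exists (G 1%nat x) | split; [now exists (dH x) |]]].
      rewrite (is_derive_unique _ _ _ (D1 x)), (is_derive_unique _ _ _ (D2 x)), (is_derive_unique _ _ _ (DH x)).
      unfold dH, cf, cg, Gam; simpl; ring.
  - now apply bounded_class_Cmw.
  - now apply bounded_class_Cmw.
  - apply bounded_class_Cmw; [exact Hw |].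
    split; [exact BH | split; [now apply (lipschitz_holder w _ dH) |]].
    now exists dH.
Qed.

Theorem theorem1p8 (m : nat) (K : R -> Prop) (gamma : R -> R * R * R)
  (w : R -> R) (M : R) :
  (0 < m)%nat ->
  Rtopology.compact K ->
  finitely_many_isolated K ->
  modulus_of_continuity w ->
  0 < M ->
  (exists GX : (R -> Prop) -> curve,
     (forall X, (forall x, X x -> K x) -> has_card X (m + 2) ->
        Cmw_curve m w (GX X) /\
        (forall x, X x -> GX X x = gamma x) /\
        (forall a b, K a -> K b -> a < b ->
           Rabs (A_fun m (GX X) a b / V_fun m (GX X) a b) <= M * w (b - a))) /\
     (exists C, forall X, (forall x, X x -> K x) -> has_card X (m + 2) ->
        curve_seminorm m w (GX X) <= C)) ->
  exists G : curve,
    horizontal G /\ Cmw_curve m (fun t => sqrt (w t)) G /\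
    (forall x, K x -> G x = gamma x).
Proof.
  intros Hm Hcomp [l0 Hl0] Hmod HM [GX [HGX [C0 HC0]]].
  pose proof (modulus_of_continuity_modulus w Hmod) as Hw.
  destruct (compact_P1 K Hcomp) as [k1 [k2 HKb]].
  pose proof (compact_P2 K Hcomp) as Kcl.
  (* The list [l0] may contain points outside [K]; they are enclosed as well. The margin of 1 then
     puts [p] and [q] strictly outside [K], where zero jets can be prescribed. *)
  destruct (list_bound (fun x => x) (k1 :: k2 :: l0)) as [B [HB HlB]].
  set (p := - B - 1); set (q := B + 1).
  assert (Hpq : p < q) by (unfold p, q; lra).
  assert (Bd : forall x, Rabs x <= B -> - B <= x <= B).
  { intros x; unfold Rabs; destruct (Rcase_abs x); lra. }
  assert (Kpq : forall x, K x -> p < x < q).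
  { intros x Kx; apply HKb in Kx; unfold p, q.
    pose proof (Bd k1 (HlB k1 ltac:(now left))); pose proof (Bd k2 (HlB k2 ltac:(right; now left))); lra. }
  set (l := p :: q :: l0).
  assert (lpq : forall x, In x l -> p <= x <= q).
  { intros x [<- | [<- | Hx]]; [lra | lra |].
    pose proof (Bd x (HlB x ltac:(right; now right))); unfold p, q; lra. }
  set (K' := fun x => K x /\ ~ isolated_point K x).
  assert (HK' : forall x, K' x -> K x /\ accum K x).
  { intros x [Kx Hn]; split; [exact Kx | now apply nonisolated_accum]. }
  assert (K'cl : closed_set K') by now apply nonisolated_closed.
  assert (Kl : forall x, K x -> K' x \/ In x l).
  { intros x Kx; destruct (classic (isolated_point K x)) as [Hi | Hi]; [| left; now split].
    right; right; right; now apply Hl0. }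
  (* Permuted lists give equivalent predicates that are not identified, so their curves may differ;
     the exchange argument allows for this. *)
  set (G0 := fun L : list R => GX (fun x => In x L)).
  assert (HN : forall L, node_list m K L -> has_card (fun x => In x L) (m + 2)).
  { intros L [N1 [N2 N3]]; exists L; repeat split; tauto. }
  set (C := Rmax 0 C0).
  assert (HC : 0 <= C) by apply Rmax_l.
  set (g1 := fun x => fst (fst (gamma x))); set (g2 := fun x => snd (fst (gamma x))).
  assert (Hsemi : forall L, node_list m K L ->
    forall phi, (phi = cf (G0 L) \/ phi = cg (G0 L)) -> Cmw m w phi /\ holder_seminorm m w phi <= C).
  { intros L HL phi Hphi; pose proof (HN L HL) as Hc; destruct HL as [_ [_ HLK]].
    destruct (HGX _ HLK Hc) as [[c1 [c2 c3]] _]; specialize (HC0 _ HLK Hc).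
    unfold curve_seminorm in HC0; pose proof (Rmax_r 0 C0) as HCC; fold C in HCC.
    destruct (Cmw_holder m w _ Hw c1) as [n1 _]; destruct (Cmw_holder m w _ Hw c2) as [n2 _];
      destruct (Cmw_holder m w _ Hw c3) as [n3 _].
    destruct Hphi as [-> | ->]; (split; [assumption | unfold G0; lra]). }
  assert (Hint : forall pr : curve -> R -> R, (forall L, pr (G0 L) = cf (G0 L)) \/ (forall L, pr (G0 L) = cg (G0 L)) ->
    forall gam, (forall L, node_list m K L -> forall x, In x L -> pr (G0 L) x = gam x) ->
    interpolants m K w C gam (fun L => Derive_n (pr (G0 L)))).
  { intros pr Hpr gam Hgam L HL.
    assert (Hphi : pr (G0 L) = cf (G0 L) \/ pr (G0 L) = cg (G0 L)) by (destruct Hpr as [e | e]; [left | right]; apply e).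
    destruct (Hsemi L HL _ Hphi) as [Hcm Hle]; destruct (Cmw_holder m w _ Hw Hcm) as [_ Hh].
    split; [apply Cm_chain, Hcm | split; [| now apply Hgam]].
    intros x y; eapply Rle_trans; [apply Hh |].
    apply Rmult_le_compat_r; [apply mod_nonneg; [exact Hw | apply Rabs_pos] | exact Hle]. }
  assert (Hval : forall L, node_list m K L -> forall x, In x L -> G0 L x = gamma x).
  { intros L HL x Hx; pose proof (HN L HL) as Hc; destruct HL as [_ [_ HLK]].
    destruct (HGX _ HLK Hc) as [_ [Hv _]]; now apply Hv. }
  assert (I1 : interpolants m K w C g1 (fun L => Derive_n (cf (G0 L)))).
  { apply (Hint cf); [now left |]; intros L HL x Hx; unfold cf, g1; now rewrite (Hval L HL x Hx). }
  assert (I2 : interpolants m K w C g2 (fun L => Derive_n (cg (G0 L)))).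
  { apply (Hint cg); [now right |]; intros L HL x Hx; unfold cg, g2; now rewrite (Hval L HL x Hx). }
  assert (lp : In p l) by now left.
  assert (lq : In q l) by (right; now left).
  destruct (component_extension m K K' w C g1 _ p q l Hw HC I1 HK' K'cl Hpq Kpq lpq lp lq Kl)
    as [f [cf' [Hcf [f1 [f2 [f3 [f4 f5]]]]]]].
  destruct (component_extension m K K' w C g2 _ p q l Hw HC I2 HK' K'cl Hpq Kpq lpq lp lq Kl)
    as [g [cg' [Hcg [e1 [e2 [e3 [e4 e5]]]]]]].
  set (c := cf' + cg').
  assert (Hc : 0 <= c) by (unfold c; lra).
  assert (Of : forall x y, Rabs (f m x - f m y) <= c * w (Rabs (x - y))).
  { intros x y; eapply Rle_trans; [apply f2 |]; apply Rmult_le_compat_r; [| unfold c; lra].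
    apply mod_nonneg; [exact Hw | apply Rabs_pos]. }
  assert (Og : forall x y, Rabs (g m x - g m y) <= c * w (Rabs (x - y))).
  { intros x y; eapply Rle_trans; [apply e2 |]; apply Rmult_le_compat_r; [| unfold c; lra].
    apply mod_nonneg; [exact Hw | apply Rabs_pos]. }
  set (h := fun x => if Rle_dec x p then 0 else if Rle_dec q x then 0 else snd (gamma x)).
  assert (hK : forall x, K x -> h x = snd (gamma x)).
  { intros x Kx; apply Kpq in Kx; unfold h.
    destruct (Rle_dec x p); [lra |]; destruct (Rle_dec q x); [lra | reflexivity]. }
  assert (h0 : forall x, x <= p \/ q <= x -> h x = 0).
  { intros x Hx; unfold h; destruct (Rle_dec x p); [reflexivity |].
    destruct (Rle_dec q x); [reflexivity | lra]. }
  destruct (defect_on_accum m K K' w C M p q c g1 g2 h G0 f g) as [Cd [HCd HD]]; try assumption.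
  { intros L HL x Hx; unfold ch; rewrite (Hval L HL x Hx), hK; [reflexivity | now apply HL]. }
  { intros L HL a b Ka Kb Hab; pose proof (HN L HL) as Hcd; destruct HL as [_ [_ HLK]].
    destruct (HGX _ HLK Hcd) as [_ [_ HA]]; now apply HA. }
  { intros x Kx; apply Kpq in Kx; lra. }
  pose proof (chain_continuous m w c f Hw Hc f1 Of) as Kf.
  pose proof (chain_continuous m w c g Hw Hc e1 Og) as Kg.
  assert (K'pq : forall x, K' x -> p <= x <= q) by (intros x [Kx _]; apply Kpq in Kx; lra).
  destruct (defect_add_points m w Cd K' l (f 1%nat) (g 1%nat) _ p q Hw HCd K'cl Hpq K'pq lpq
    (Kf 1%nat Hm) (Kg 1%nat Hm) HD) as [Ce [HCe HDe]].
  destruct (horizontal_correction m w (fun x => K' x \/ In x l) p q c Ce f g h Hm Hw Hc HCe Hpq)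
    as [ph [ps [C' [HC' [p1 [s1 [p2 [s2 [Z Hh]]]]]]]]]; try assumption; try (now right).
  { now apply closed_union_list. }
  { intros x [Hx | Hx]; [now apply K'pq | now apply lpq]. }
  pose proof (modulus_sqrt w Hw) as Hsw.
  pose proof (chain_continuous m _ C' ph Hsw HC' p1 p2) as Kph.
  pose proof (chain_continuous m _ C' ps Hsw HC' s1 s2) as Kps.
  set (F := fun k y => f k y + ph k y) in *; set (G := fun k y => g k y + ps k y) in *.
  assert (Bf : bounded_fun (f m)) by (apply (bounded_fun_of_support (f m) p q); [lra | now apply Kf | intros; now apply f4]).
  assert (Bg : bounded_fun (g m)) by (apply (bounded_fun_of_support (g m) p q); [lra | now apply Kg | intros; now apply e4]).
  destruct (horizontal_lift m (fun t => sqrt (w t)) F G p q) as [Hhor HCm]; try assumption.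
  - now apply chain_plus.
  - now apply chain_plus.
  - intros k x Hk; apply continuous_plus_R; [now apply Kf | now apply Kph].
  - intros k x Hk; apply continuous_plus_R; [now apply Kg | now apply Kps].
  - intros k x Hk Hx; unfold F; rewrite f4 by assumption.
    destruct (Z k x Hk) as [-> _]; [destruct Hx; [now left | right; now left] | ring].
  - intros k x Hk Hx; unfold G; rewrite e4 by assumption.
    destruct (Z k x Hk) as [_ ->]; [destruct Hx; [now left | right; now left] | ring].
  - apply holder_plus; [apply holder_sqrt; [exact Hw | exact Bf | now exists c] | now exists C'].
  - apply holder_plus; [apply holder_sqrt; [exact Hw | exact Bg | now exists c] | now exists C'].
  - exists (fun x => (F 0%nat x, G 0%nat x, 2 * RInt (area F G) p x)); split; [exact Hhor | split; [exact HCm |]].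
    intros x Kx.
    assert (Sx : K' x \/ In x l) by now apply Kl.
    destruct (Z 0%nat x (Nat.le_0_l m) (or_intror (or_intror Sx))) as [z1 z2].
    rewrite (Hh x Sx), (hK x Kx); unfold F, G; rewrite z1, z2, (f3 x Kx), (e3 x Kx), !Rplus_0_r.
    unfold g1, g2; destruct (gamma x) as [[? ?] ?]; reflexivity.
Qed.
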